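(* Let $d \geq 2$ be an integer. Let $\xi_1, \xi_2, \ldots$ be independent random vectors, each uniformly distributed on the Euclidean unit sphere $S^{d-1} \subset \mathbb{R}^d$, and let $G_1, G_2, \ldots$ be independent standard Gaussian random vectors in $\mathbb{R}^d$ (mean zero, identity covariance matrix). Then for every $m \geq 1$, all real numbers $a_1, \ldots, a_m$ and every $t > 0$, \[ \mathbb{P}\left(\left\|\sum_{i=1}^m a_i \xi_i\right\| > t\right) \leq 397 \cdot \mathbb{P}\left(\left\|\sum_{i=1}^m a_i \frac{G_i}{\sqrt{d}}\right\| > t\right). \]
   Context: $\|\cdot\|$ denotes the standard Euclidean norm on $\mathbb{R}^d$. *)

(* Defs.v *)
From HB Require Import structures.
From mathcomp Require Import all_boot all_order all_algebra.
From mathcomp Require Import all_classical all_reals all_analysis.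
Set Implicit Arguments. Unset Strict Implicit. Unset Printing Implicit Defensive.
Import Order.TTheory GRing.Theory Num.Theory.
Local Open Scope classical_set_scope.
Local Open Scope ring_scope.

(* Vectors of R^d are represented as d-tuples of reals; d.-tuple R carries the
   product (= Borel) sigma-algebra from MathComp-Analysis. *)
Section Vectors.
Context {R : realType} {d : nat}.

Definition enorm (x : d.-tuple R) : R := Num.sqrt (\sum_(j < d) tnth x j ^+ 2).

Definition vscale (c : R) (x : d.-tuple R) : d.-tuple R :=
  [tuple c * tnth x j | j < d].

Definition lincomb (m : nat) (a : 'I_m -> R) (v : nat -> d.-tuple R)
  : d.-tuple R := [tuple \sum_(i < m) a i * tnth (v i) j | j < d].

Definition mxapply (U : 'M[R]_d) (x : d.-tuple R) : d.-tuple R :=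
  [tuple \sum_(k < d) U j k * tnth x k | j < d].

Definition orthogonal_mx (U : 'M[R]_d) : Prop := U *m U^T = 1%:M.

Definition unit_sphere : set (d.-tuple R) := [set x | enorm x = 1].

End Vectors.

Section RandomVectors.
Context {R : realType} {dO : measure_display} {Omega : measurableType dO}.
Variable P : probability Omega R.
Variable d : nat.

Definition mutually_independent (X : nat -> Omega -> d.-tuple R) : Prop :=
  (forall i, measurable_fun setT (X i)) /\
  forall (s : seq nat) (B : nat -> set (d.-tuple R)),
    uniq s -> (forall i, measurable (B i)) ->
    P (\big[setI/setT]_(i <- s) (X i @^-1` B i))
    = (\prod_(i <- s) P (X i @^-1` B i))%E.

(* X is uniformly distributed on S^{d-1}: its law is the (unique)
   rotation-invariant probability measure on the sphere. *)
Definition uniform_on_sphere (X : Omega -> d.-tuple R) : Prop :=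
  [/\ measurable_fun setT X,
      P (X @^-1` unit_sphere) = 1%E &
      forall U : 'M[R]_d, orthogonal_mx U ->
        forall B : set (d.-tuple R), measurable B ->
          P ((fun w => mxapply U (X w)) @^-1` B) = P (X @^-1` B)].

(* X is a standard Gaussian vector in R^d: its coordinates are independent
   N(0,1) random variables (mean zero, identity covariance). *)
Definition std_gaussian_vector (X : Omega -> d.-tuple R) : Prop :=
  measurable_fun setT X /\
  forall B : 'I_d -> set R, (forall j, measurable (B j)) ->
    P [set w | forall j : 'I_d, B j (tnth (X w) j)]
    = (\prod_(j < d) normal_prob 0 1 (B j))%E.

End RandomVectors.

(* Main.v *)
(* Replace the spherical summands by Gaussian ones one at a time.  By rotation
   invariance, the tail of |s + a x| with x uniform on the sphere depends on the
   law of s only through the tail of |s|, so the bound known for the first k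
   summands can be used conditionally on x, at the cost of the same constant 397;
   this turns s into sigma g / sqrt d with g a standard Gaussian vector.  It then
   suffices to compare |g + b x|^2 with (1 + b^2 / d) |g|^2 with constant 1 above
   the level z0 = d + 2 (for the second variable).  By the Cameron-Martin formula
   and the even moments of the sphere, |g + b x|^2 is a Poisson(b^2 / 2) mixture of
   the chi-square laws with d + 2k degrees of freedom; along z = z0 (1 + b^2 / d)
   its tail P(|g + b x|^2 > z) is nonincreasing in b, because a tilted Poisson
   variable has variance at most its mean.  Below the level d + 2 the Gaussian tail
   is at least 1/80 by a fourth moment argument, so there the constant 397 makes
   the bound trivial. *)
Require Import Defs.
From HB Require Import structures.
From mathcomp Require Import all_boot all_order all_algebra.
From mathcomp Require Import all_classical all_reals all_analysis.
From mathcomp Require Import measurable_realfun ring lra.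
Set Implicit Arguments. Unset Strict Implicit. Unset Printing Implicit Defensive.
Import Order.TTheory GRing.Theory Num.Theory.
Import numFieldNormedType.Exports.
Local Open Scope classical_set_scope.
Local Open Scope ring_scope.

(** The level d + 2 comes from the derivative along the path. It reduces to the sum of Q_k (m - k),
    with m the Poisson parameter and Q_k the tilted weights, which satisfy k (d + 2k) Q_k = m z
    Q_(k-1). If the normalised Q has mean mu and variance at most mu, then m z <= (d + 2 + 2 mu) mu,
    so mu >= m once z >= d + 2 + 2m; along the path from z0 this means z (z0 - d) >= 2 z0, which at
    z = z0 is z0 >= d + 2. Chi-square densities are not taken from polar coordinates: the Gaussian
    mass of a thin shell is squeezed between multiples of its volume, and volumes are known from
    scaling. The uniform law is given only by rotation invariance, so its even moments come from
    comparing coefficients in the moments of x_0 + e x_l. Mixtures are truncated, so that only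
    finite sums are differentiated, at the price of a boundary term that vanishes like a term of an
    exponential series. The argument needs a constant of at least 80 = 20 * 4: a quartic test
    polynomial gives 1/20 at level d, and moving to d + 2 costs a factor e <= 4. *)

(** * Image measures, laws and densities *)

Definition image_measure d d' (T : measurableType d) (T' : measurableType d')
    (R : realType) (m : {measure set T -> \bar R}) (f : T -> T')
    (mf : measurable_fun setT f) : {measure set T' -> \bar R} :=
  measure_function_pushforward__canonical__measure_function_Measure m mf.

Lemma ge0_integral_image d d' (T : measurableType d) (T' : measurableType d')
    (R : realType) (m : {measure set T -> \bar R}) (f : T -> T')
    (mf : measurable_fun setT f) (g : T' -> \bar R) :
  measurable_fun setT g -> (forall y, 0 <= g y)%E ->
  (\int[image_measure m mf]_y g y = \int[m]_x g (f x))%E.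
Proof. by move=> mg g0; rewrite (ge0_integral_pushforward mf). Qed.

Section Law.
Local Open Scope ereal_scope.
Context d d' (T : measurableType d) (T' : measurableType d') (R : realType).
Variables (P : probability T R) (X : T -> T') (mX : measurable_fun setT X).

Definition law : probability T' R :=
  distribution P (HB.pack_for {mfun T >-> T'} X
    (isMeasurableFun.Build _ _ _ _ X mX)).

Lemma lawE A : law A = P (X @^-1` A).
Proof. by []. Qed.

Lemma ge0_integral_law (f : T' -> \bar R) :
  measurable_fun setT f -> (forall y, 0 <= f y) ->
  \int[law]_y f y = \int[P]_x f (X x).
Proof. by move=> mf f0; rewrite /law ge0_integral_distribution. Qed.

End Law.

Section Density.
Local Open Scope ereal_scope.
Context d (T : measurableType d) (R : realType) (mu : {measure set T -> \bar R}).
Variables (f : T -> R) (mf : measurable_fun setT f) (f0 : forall x, (0 <= f x)%R).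

(** The proofs of measurability and positivity are arguments, so that the term [density mf f0]
    carries what its canonical measure structure requires. *)
Definition density of measurable_fun setT f & (forall x, (0 <= f x)%R)
  : set T -> \bar R := fun A => \int[mu]_(x in A) (f x)%:E.

Let density0 : density mf f0 set0 = 0.
Proof. by rewrite /density integral_set0. Qed.

Let density_ge0 A : 0 <= density mf f0 A.
Proof. by apply: integral_ge0 => x _; rewrite lee_fin. Qed.

Let density_sigma_additive : semi_sigma_additive (density mf f0).
Proof.
move=> F mF tF mUF; rewrite /density ge0_integral_bigcup//.
- by apply: is_cvg_ereal_nneg_natsum_cond => n _ _; exact: density_ge0.
- by apply: measurable_funTS; exact/measurable_EFinP.
- by move=> x _; rewrite lee_fin.
Qed.

HB.instance Definition _ := isMeasure.Build _ _ _ (density mf f0)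
  density0 density_ge0 density_sigma_additive.

Import HBNNSimple.

(** Monotone convergence along simple approximations of [g] reduces the claim to level sets, where
    it is the definition of [density]. *)
Lemma ge0_integral_density (g : T -> \bar R) :
  measurable_fun setT g -> (forall x, 0 <= g x) ->
  \int[density mf f0]_x g x = \int[mu]_x (g x * (f x)%:E).
Proof.
move=> mg g0.
have mef : measurable_fun setT (fun x => (f x)%:E) by exact/measurable_EFinP.
pose h := nnsfun_approx measurableT mg.
have -> : \int[density mf f0]_x g x =
    lim (\int[density mf f0]_x (EFin \o h n) x @[n --> \oo]).
  have gE x : setT x -> g x = lim ((EFin \o h n) x @[n --> \oo]).
    by move=> _; apply/esym/cvg_lim => //; exact: cvg_nnsfun_approx.
  under eq_integral => x _ do rewrite (gE x I).
  apply: monotone_convergence => //.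
  - by move=> n; exact/measurable_EFinP.
  - by move=> n x _; rewrite lee_fin.
  - by move=> x _ a b ab; rewrite lee_fin; exact/lefP/nd_nnsfun_approx.
have -> : \int[mu]_x (g x * (f x)%:E) =
    lim (\int[mu]_x ((EFin \o h n) x * (f x)%:E) @[n --> \oo]).
  have fg x : setT x ->
      g x * (f x)%:E = lim ((EFin \o h n) x * (f x)%:E @[n --> \oo]).
    move=> _; apply/esym/cvg_lim => //; apply: cvgeZr => //.
    exact: cvg_nnsfun_approx.
  under eq_integral => x _ do rewrite (fg x I).
  apply: (@monotone_convergence _ _ _ mu _ measurableT
    (fun n x => (EFin \o h n) x * (f x)%:E)).
  - by move=> n; apply: emeasurable_funM => //; exact/measurable_EFinP.
  - by move=> n x _; rewrite mule_ge0 ?lee_fin.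
  - move=> x _ a b ab; rewrite lee_wpmul2r ?lee_fin//.
    exact/lefP/nd_nnsfun_approx.
suff suf n : \int[density mf f0]_x (EFin \o h n) x =
    \int[mu]_x ((EFin \o h n) x * (f x)%:E).
  by under eq_fun do rewrite suf.
transitivity (\int[density mf f0]_x (\sum_(y \in range (h n))
    (y * \1_(h n @^-1` [set y]) x)%:E)).
  by apply: eq_integral => x _; rewrite /= fimfunE -fsumEFin.
rewrite ge0_integral_fsum//; last 2 first.
- by move=> r; exact/measurable_EFinP/measurable_funM.
- by move=> r x _; exact: nnfun_muleindic_ge0.
transitivity (\int[mu]_x (\sum_(y \in range (h n))
    (y * \1_(h n @^-1` [set y]) x)%:E * (f x)%:E)); last first.
  apply: eq_integral => x _.
  rewrite -ge0_mule_fsuml => [|y]; last exact: nnfun_muleindic_ge0.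
  by rewrite fsumEFin // -(fimfunE _ x).
rewrite ge0_integral_fsum//; last 2 first.
- move=> r; apply: emeasurable_funM => //.
  exact/measurable_EFinP/measurable_funM.
- by move=> r x _; rewrite mule_ge0 ?lee_fin// -lee_fin nnfun_muleindic_ge0.
apply: eq_fsbigr => r /[!inE] -[t _ <-].
have mA : measurable (h n @^-1` [set h n t]) by exact: measurable_sfunP.
under [RHS]eq_integral do rewrite EFinM -muleA.
rewrite integralZl_indic_nnsfun// integral_indic// setIT /=.
rewrite ge0_integralZl//.
- congr (_ * _); rewrite /density integral_mkcond; apply: eq_integral => x _.
  by rewrite patchE indicE; case: ifPn => _; rewrite ?mul1e ?mul0e.
- by apply: emeasurable_funM => //; exact/measurable_EFinP.
- by move=> x _; rewrite mule_ge0 ?lee_fin.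
- by rewrite lee_fin.
Qed.

End Density.

(** * Measures on tuples determined by their values on boxes *)

Section Boxes.
Local Open Scope ereal_scope.
Context (R : realType).

Definition box n (B : 'I_n -> set R) : set (n.-tuple R) :=
  [set x | forall j, B j (tnth x j)].

Lemma measurable_box n (B : 'I_n -> set R) :
  (forall j, measurable (B j)) -> measurable (box B).
Proof.
move=> mB; have -> : box B = \bigcap_(j in [set: 'I_n]) ((@tnth n R)^~ j @^-1` B j).
  by apply/seteqP; split=> [x Bx j _|x Bx j]; [exact: Bx|exact: Bx].
apply: fin_bigcap_measurable => // j _.
by rewrite -[X in measurable X]setTI; exact: measurable_tnth.
Qed.

Lemma measurable_boxE n :
  @measurable _ (n.-tuple R) =
  <<s [set box B | B in [set B : 'I_n -> set R | forall j, measurable (B j)]] >>.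
Proof.
apply/seteqP; split; last first.
  apply: smallest_sub; first exact: sigma_algebra_measurable.
  by move=> _ [B mB <-]; exact: measurable_box.
apply: smallest_sub; first exact: smallest_sigma_algebra.
elim/big_ind: _ => // [A A' sA sA' X [/sA|/sA']//|i _ _ [A mA <-]].
rewrite setTI; apply: sub_sigma_algebra.
exists (fun j => if j == i then A else setT) => [j|]; first by case: ifP.
apply/seteqP; split=> [x /(_ i)|x Ax j]; first by rewrite eqxx.
by case: eqP => // ->.
Qed.

(** Boxes are stable under intersection and generate the sigma-algebra, and the cubes with sides
    [-k, k] exhaust the space. Finiteness is asked on cubes only, so that infinite measures such as
    [lebvol] are covered. *)
Lemma tuple_measure_unique n (m1 m2 : {measure set (n.-tuple R) -> \bar R}) :
  (forall B, (forall j, measurable (B j)) -> m1 (box B) = m2 (box B)) ->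
  (forall k : nat, m1 (box (fun=> `[(- k%:R)%R, k%:R%R]%classic)) < +oo) ->
  forall A, measurable A -> m1 A = m2 A.
Proof.
move=> m12 m1oo A mA.
apply: (measure_unique _ (fun k : nat => box (fun _ : 'I_n => `[(- k%:R)%R, k%:R%R]%classic))
  (@measurable_boxE n)) => //.
- move=> _ _ [B mB <-] [C mC <-]; exists (fun j => B j `&` C j).
    by move=> j; exact: measurableI.
  apply/seteqP; split=> [x h|x [hB hC] j]; last by split; [exact: hB|exact: hC].
  by split=> j; have [] := h j.
- by move=> i; exists (fun _ => `[(- i%:R)%R, i%:R%R]%classic).
- apply/seteqP; split=> // x _.
  exists (Num.truncn (\sum_j `|tnth x j|)).+1 => // j /=.
  rewrite in_itv /= -ler_norml.
  apply: (@le_trans _ _ (\sum_j `|tnth x j|)%R); last exact/ltW/truncnS_gt.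
  by rewrite (bigD1 j)//= lerDl sumr_ge0.
- by move=> _ [B mB <-]; exact: m12.
Qed.

Lemma lift_tuple_box n (B : 'I_n.+1 -> set R) (x : R) (y : n.-tuple R) :
  box B [tuple of x :: y] <-> B ord0 x /\ box (fun j => B (lift ord0 j)) y.
Proof.
split=> [h|[h1 h2] j].
  split; first exact: (h ord0).
  by move=> j; have := h (lift ord0 j); rewrite tnthS.
by case: (unliftP ord0 j) => [i ->|->//]; rewrite tnthS; exact: h2.
Qed.

(** For a probability [nu] this says that [gam] is the n-fold product of [nu]; testing boxes is
    enough by [tuple_measure_unique]. *)
Definition has_iid_coords n (nu : set R -> \bar R) (gam : set (n.-tuple R) -> \bar R) :=
  forall B : 'I_n -> set R, (forall j, measurable (B j)) ->
    gam (box B) = \prod_(j < n) nu (B j).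

(** Induction on the dimension: [gam] is the image of the product of [nu] and the law of the tail,
    because both agree on boxes, and Tonelli splits off the first factor. *)
Lemma integral_prod_iid n (nu : probability R R)
    (gam : probability (n.-tuple R) R) (h : 'I_n -> R -> R) :
  has_iid_coords nu gam ->
  (forall j, measurable_fun setT (h j)) -> (forall j x, (0 <= h j x)%R) ->
  \int[gam]_x (\prod_(j < n) h j (tnth x j))%:E =
  \prod_(j < n) \int[nu]_y (h j y)%:E.
Proof.
elim: n => [|n IH] in gam h *; move=> hg mh h0.
  under eq_integral do rewrite big_ord0.
  by rewrite integral_cst// mul1e; apply: etrans (probability_setT gam) _; rewrite big_ord0.
pose tl (x : n.+1.-tuple R) : n.-tuple R := [tuple of behead x].
have mtl : measurable_fun setT tl by exact: measurable_behead.
pose gam' := law gam mtl.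
have hg' : has_iid_coords nu gam'.
  move=> B mB; rewrite lawE.
  pose B' j := oapp B setT (unlift ord0 j).
  have -> : tl @^-1` box B = box B'.
    apply/seteqP; split=> x.
      rewrite [in X in _ -> X](tuple_eta x) => Bx; apply/lift_tuple_box; split.
        by rewrite /B' unlift_none.
      by move=> j; rewrite /B' liftK; exact: Bx.
    rewrite {1}(tuple_eta x) => /lift_tuple_box[_ Bx] j.
    by have := Bx j; rewrite /B' liftK.
  rewrite hg; last by move=> j; rewrite /B'; case: unlift => /=.
  rewrite big_ord_recl /B' unlift_none /= probability_setT mul1e.
  by apply: eq_bigr => j _; rewrite liftK.
pose cn (p : R * n.-tuple R) : n.+1.-tuple R := [tuple of p.1 :: p.2].
have mcn : measurable_fun setT cn by exact: measurable_cons.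
pose pm := law (nu \x gam') mcn.
have gamE A : measurable A -> gam A = pm A.
  apply: tuple_measure_unique => [B mB|k].
    apply: (etrans (hg _ mB)); apply/esym/(etrans (lawE _ _ _)).
    have -> : cn @^-1` box B = B ord0 `*` box (fun j => B (lift ord0 j)).
      by apply/seteqP; split=> -[x y] /lift_tuple_box.
    apply: (etrans (product_measure1E _ _ (mB ord0) _)).
      by apply: measurable_box.
    by rewrite big_ord_recl; congr (_ * _); exact: hg'.
  rewrite (le_lt_trans (probability_le1 _ _)) ?ltry//.
  by apply: measurable_box => j; exact: measurable_itv.
have mF m (q : 'I_m -> R -> R) : (forall j, measurable_fun setT (q j)) ->
    measurable_fun setT (fun x : m.-tuple R => (\prod_(j < m) q j (tnth x j))%:E).
  move=> mq; apply/measurable_EFinP.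
  apply: measurable_prod => j _.
  by apply: measurableT_comp => //; exact: measurable_tnth.
have F0 m (q : 'I_m -> R -> R) : (forall j x, (0 <= q j x)%R) ->
    forall x : m.-tuple R, 0 <= (\prod_(j < m) q j (tnth x j))%:E.
  by move=> q0 x; rewrite lee_fin; apply: prodr_ge0.
rewrite (eq_measure_integral pm); last by move=> A mA _; exact: gamE.
rewrite ge0_integral_law; [|exact: mF|exact: F0].
rewrite fubini_tonelli1/=; last 2 first.
- exact: (measurableT_comp (mF _ _ mh) mcn).
- by move=> x; exact: F0.
transitivity (\int[nu]_x ((h ord0 x)%:E *
    \prod_(j < n) \int[nu]_y (h (lift ord0 j) y)%:E)).
  apply: eq_integral => x _; rewrite /fubini_F.
  rewrite -(IH gam' (fun j => h (lift ord0 j)))// -ge0_integralZl//.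
  - apply: eq_integral => y _; rewrite big_ord_recl EFinM /=.
    by congr (_ * _%:E); apply: eq_bigr => j _; rewrite /cn tnthS.
  - exact: (mF _ (fun j => h (lift ord0 j))).
  - by move=> y _; apply: (F0 _ (fun j => h (lift ord0 j))).
  - by rewrite lee_fin.
rewrite big_ord_recl.
rewrite ge0_integralZr//.
- exact/measurable_EFinP.
- by move=> x _; rewrite lee_fin.
- by elim/big_ind: _ => // [x y|j _]; [exact: mule_ge0|apply: integral_ge0 => y _; rewrite lee_fin].
Qed.

End Boxes.

Lemma integral_lincomb d (T : measurableType d) (R : realType)
    (mu : {measure set T -> \bar R}) (D : set T) (c I : nat -> R) (f : nat -> T -> R) N :
  measurable D -> (forall i, mu.-integrable D (EFin \o f i)) ->
  (forall i, \int[mu]_(x in D) (f i x)%:E = (I i)%:E)%E ->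
  mu.-integrable D (fun x => (\sum_(i < N) c i * f i x)%:E) /\
  (\int[mu]_(x in D) (\sum_(i < N) c i * f i x)%:E = (\sum_(i < N) c i * I i)%:E)%E.
Proof.
move=> mD fi fI; elim: N => [|N [IH1 IH2]].
  under eq_fun do rewrite big_ord0.
  by rewrite big_ord0 integral0; split => //; exact: integrable0.
have iN : mu.-integrable D (fun x => (c N)%:E * (EFin \o f N) x)%E.
  by apply: integrableZl => //; exact: fi.
have -> : (fun x => (\sum_(i < N.+1) c i * f i x)%:E) =
    ((fun x => (\sum_(i < N) c i * f i x)%:E) \+ (fun x => (c N)%:E * (EFin \o f N) x))%E.
  by apply/funext => x; rewrite big_ord_recr /= EFinD EFinM.
split; first exact: integrableD.
rewrite integralD// IH2 integralZl//.
by rewrite [X in (_ + _ * X)%E]fI big_ord_recr /= EFinD EFinM.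
Qed.

(** * The one-dimensional Gaussian law *)

Section StandardNormal.
Local Open Scope ereal_scope.
Context (R : realType).
Notation mu := (@lebesgue_measure R).

(** [normal_prob 0 1] lives on [measurableTypeR R]; its image under the identity is the same law on
    [R] with the measurable structure that tuples use. *)
Definition std_normal : probability R R :=
  law (normal_prob 0 1) (@measurable_id _ (measurableTypeR R) setT
    : measurable_fun setT (idfun : measurableTypeR R -> R)).

Lemma measurable_affine (c b : R) :
  measurable_fun setT (fun y : measurableTypeR R => (c + b * y)%R : measurableTypeR R).
Proof. by apply: measurable_funD => //; exact: measurable_funM. Qed.

(** For positive slope, a rescaled image of Lebesgue measure has the right value on intervals and
    uniqueness applies; a negative slope is reduced to this by reflection. *)
Lemma lebesgue_measure_affine (c b : R) (A : set (measurableTypeR R)) :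
  b != 0%R -> measurable A ->
  mu ((fun y => c + b * y)%R @^-1` A) = `|b|^-1%:E * mu A.
Proof.
have pos (b' : R) B : (0 < b')%R -> measurable B ->
    mu ((fun y => c + b' * y)%R @^-1` B) = b'^-1%:E * mu B.
  move=> b0 mB.
  have b'n : b'^-1%:E * b'%:E = 1 by rewrite -EFinM mulVf ?gt_eqF.
  pose m' := mscale (NngNum (ltW b0)) (image_measure mu (measurable_affine c b')).
  have m'E X : m' X = b'%:E * mu ((fun y => c + b' * y)%R @^-1` X) by [].
  suff -> : mu B = m' B by rewrite m'E muleA b'n mul1e.
  apply: lebesgue_measure_unique mB => _ [[x y] _ <-] /=.
  transitivity (m' `]x, y]%classic) => //; rewrite m'E.
  have -> : (fun z => c + b' * z)%R @^-1` `]x, y] = `]((x - c) / b')%R, ((y - c) / b')%R]%classic.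
    apply/seteqP; split=> z /=; rewrite !in_itv /= ltr_pdivrMr// ler_pdivlMr//;
      by rewrite ltrBlDl lerBrDl (mulrC z).
  rewrite !lebesgue_measure_itv /= !lte_fin ltr_pM2r ?invr_gt0// ltrD2r.
  case: ifPn => _; last by rewrite mule0.
  by rewrite -!EFinB -EFinM; congr EFin; field; rewrite gt_eqF.
move=> b0 mA; have [b1|b1] := ltP 0%R b; first by rewrite gtr0_norm ?pos.
have b2 : (0 < - b)%R by rewrite oppr_gt0 lt_neqAle b0.
rewrite ltr0_norm -?oppr_gt0// -pos//.
rewrite -[RHS]lebesgue_measureN.
  congr (mu _); apply/seteqP; split=> y /=; by rewrite mulrNN.
by rewrite -[X in measurable X]setTI; exact: measurable_affine.
Qed.

Lemma ge0_integral_affine (c b : R) (h : measurableTypeR R -> \bar R) : b != 0%R ->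
  measurable_fun setT h -> (forall x, 0 <= h x) ->
  \int[mu]_y h (c + b * y)%R = `|b|^-1%:E * \int[mu]_u h u.
Proof.
move=> b0 mh h0.
have bge : (0 <= `|b|^-1)%R by rewrite invr_ge0.
have -> : `|b|^-1%:E * \int[mu]_u h u = \int[mscale (NngNum bge) mu]_u h u.
  by rewrite ge0_integral_mscale.
rewrite -(ge0_integral_image mu (measurable_affine c b))//.
by apply: eq_measure_integral => A mA _; exact: lebesgue_measure_affine.
Qed.

Lemma normal_probE (m s : R) (B : set (measurableTypeR R)) :
  normal_prob m s B = \int[mu]_y (\1_B y * normal_pdf m s y)%:E.
Proof.
rewrite /normal_prob integral_mkcond; apply: eq_integral => y _.
by rewrite patchE indicE; case: ifPn => _; rewrite ?mul1r ?mul0r.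
Qed.

Lemma integral_normal_prob (m s : R) (g : measurableTypeR R -> \bar R) :
  measurable_fun setT g -> (forall x, 0 <= g x) ->
  \int[normal_prob m s]_x g x = \int[mu]_x (g x * (normal_pdf m s x)%:E).
Proof.
move=> mg g0.
rewrite -(ge0_integral_density mu (measurable_normal_pdf m s) (normal_pdf_ge0 m s))//.
Qed.

Lemma integral_std_normal (g : measurableTypeR R -> \bar R) :
  measurable_fun setT g -> (forall x, 0 <= g x) ->
  \int[std_normal]_x g x = \int[mu]_x (g x * (normal_pdf 0 1 x)%:E).
Proof.
by move=> mg g0; rewrite -integral_normal_prob// ge0_integral_law.
Qed.

Lemma normal_pdf_affine (c b u : R) : b != 0%R ->
  normal_pdf c b u = (`|b|^-1 * normal_pdf 0 1 ((u - c) / b))%R.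
Proof.
move=> b0; rewrite !normal_pdfE ?oner_neq0// /normal_peak /normal_fun mulrA; congr (_ * expR _)%R.
  rewrite expr1n mul1r -mulrnAr sqrtrM ?sqr_ge0// sqrtr_sqr invfM.
  by rewrite mulrC.
rewrite subr0; field.
by rewrite b0.
Qed.

Lemma std_normal_affine (c b : R) (B : set (measurableTypeR R)) : b != 0%R -> measurable B ->
  std_normal [set y | B (c + b * y)%R] = normal_prob c b B.
Proof.
move=> b0 mB.
have mind : measurable_fun setT (fun u : measurableTypeR R => (\1_B u)%:E : \bar R).
  exact/measurable_EFinP.
have mC : measurable [set y | B (c + b * y)%R].
  by rewrite -[X in measurable X]setTI; exact: (measurable_affine c b measurableT mB).
transitivity (\int[std_normal]_y (\1_B (c + b * y)%R)%:E).
  rewrite (_ : (fun y => (\1_B (c + b * y)%R)%:E) = EFin \o \1_[set y | B (c + b * y)%R]).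
    by rewrite integral_indic// setIT.
  by apply/funext => y; rewrite /= !indicE.
rewrite integral_std_normal; last 2 first.
- exact: (measurableT_comp mind (measurable_affine c b)).
- by move=> y; rewrite lee_fin.
pose h u := (\1_B u)%:E * (normal_pdf 0 1 ((u - c) / b))%:E.
have mh : measurable_fun setT (h : measurableTypeR R -> \bar R).
  apply: emeasurable_funM => //; apply/measurable_EFinP.
  apply: measurableT_comp; first exact: measurable_normal_pdf.
  by apply: measurable_funM => //; exact: measurable_funB.
have -> : \int[mu]_y ((\1_B (c + b * y)%R)%:E * (normal_pdf 0 1 y)%:E) = \int[mu]_y h (c + b * y)%R.
  by apply: eq_integral => y _; rewrite /h addrAC subrr add0r mulrAC mulfV// mul1r.
rewrite ge0_integral_affine//; last first.
  by move=> x; rewrite mule_ge0 ?lee_fin ?normal_pdf_ge0.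
rewrite -ge0_integralZl//; last first.
  by move=> x _; rewrite mule_ge0 ?lee_fin ?normal_pdf_ge0.
rewrite /normal_prob [RHS]integral_mkcond; apply: eq_integral => u _.
rewrite patchE /h indicE (normal_pdf_affine c u b0).
by case: ifPn => _; rewrite ?mul0e ?mule0// mul1e EFinM.
Qed.

(** The factor e^(x^2/2) cancels the Gaussian density up to its peak 1 / sqrt (2 pi), so Lebesgue
    measure is recovered from the Gaussian law. *)
Lemma integral_std_normal_sqr (B : set (measurableTypeR R)) : measurable B ->
  \int[std_normal]_x (\1_B x * expR (x ^+ 2 / 2))%:E = (normal_peak 1)%:E * mu B.
Proof.
move=> mB; have me : measurable_fun setT (fun x : measurableTypeR R => expR (x ^+ 2 / 2)).
  by apply: measurableT_comp => //; apply: measurable_funM => //; exact: measurable_funX.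
rewrite integral_std_normal; last 2 first.
- by apply/measurable_EFinP; exact: measurable_funM.
- by move=> x; rewrite lee_fin mulr_ge0 ?expR_ge0.
have E x : ((\1_B x * expR (x ^+ 2 / 2)) * normal_pdf 0 1 x =
    normal_peak 1 * \1_B x)%R.
  rewrite normal_pdfE ?oner_neq0// /normal_fun subr0 expr1n mulNr expRN.
  by field; rewrite gt_eqF// expR_gt0.
under eq_integral do rewrite -EFinM E EFinM.
rewrite ge0_integralZl//.
- by rewrite integral_indic// setIT.
- exact/measurable_EFinP.
- by rewrite lee_fin normal_peak_ge0.
Qed.

Lemma std_normal_shift (v : R) (B : set (measurableTypeR R)) : measurable B ->
  std_normal [set y | B (v + y)%R] =
  \int[std_normal]_x (\1_B x * expR (v * x - v ^+ 2 / 2))%:E.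
Proof.
move=> mB.
have -> : [set y | B (v + y)%R] = [set y | B (v + 1 * y)%R].
  by apply/seteqP; split=> y /=; rewrite mul1r.
rewrite std_normal_affine ?oner_neq0// integral_std_normal; last 2 first.
- apply/measurable_EFinP; apply: measurable_funM => //.
  by apply: measurableT_comp => //; apply: measurable_funB => //; exact: measurable_funM.
- by move=> x; rewrite lee_fin mulr_ge0 ?expR_ge0.
rewrite /normal_prob integral_mkcond; apply: eq_integral => x _.
rewrite patchE indicE -EFinM; case: ifPn => _; last by rewrite !mul0r.
rewrite mul1r !normal_pdfE ?oner_neq0// /normal_fun mulrCA -expRD; congr (_ * expR _)%:E.
by field.
Qed.

(** The integrand times the Gaussian density is a multiple of the N(0, 2) density. This exponential
    moment makes all moments of |g|^2 finite. *)
Lemma integral_std_normal_expR4 : \int[std_normal]_x (expR (x ^+ 2 / 4))%:E < +oo.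
Proof.
have s2 : (Num.sqrt 2 != 0 :> R)%R by rewrite gt_eqF// sqrtr_gt0.
rewrite integral_std_normal; last 2 first.
- apply/measurable_EFinP; apply: measurableT_comp => //.
  by apply: measurable_funM => //; exact: measurable_funX.
- by move=> x; rewrite lee_fin expR_ge0.
have -> : \int[mu]_x ((expR (x ^+ 2 / 4))%:E * (normal_pdf 0 1 x)%:E) =
    \int[mu]_x ((normal_peak 1 / normal_peak (Num.sqrt 2))%:E * (normal_pdf 0 (Num.sqrt 2) x)%:E).
  apply: eq_integral => x _.
  rewrite -!EFinM !normal_pdfE ?oner_neq0//; congr EFin; rewrite [RHS]mulrA divfK; last first.
    by rewrite gt_eqF// normal_peak_gt0.
  rewrite /normal_fun mulrCA -expRD; congr (_ * expR _)%R.
  by rewrite sqr_sqrtr//; field.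
rewrite ge0_integralZl ?integral_normal_pdf ?mule1 ?ltry//.
- by apply/measurable_EFinP; exact: measurable_normal_pdf.
- by move=> x _; rewrite lee_fin normal_pdf_ge0.
- by rewrite lee_fin divr_ge0 ?normal_peak_ge0.
Qed.

(** With y independent of x and u = a x + b y, the joint density of (x, u) is factored both ways:
    given x, u is N(a x, b^2); given u, x is N(a u / s^2, (b / s)^2). *)
Lemma normal_pdf_convolution (a b u x : R) : b != 0%R ->
  let s := Num.sqrt (a ^+ 2 + b ^+ 2) in
  (normal_pdf (a * x) b u * normal_pdf 0 1 x =
  normal_pdf 0 s u * normal_pdf (a * u / s ^+ 2) (b / s) x)%R.
Proof.
move=> b0 s; have s2 : (s ^+ 2 = a ^+ 2 + b ^+ 2)%R by rewrite sqr_sqrtr// addr_ge0 ?sqr_ge0.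
have s2n0 : (a ^+ 2 + b ^+ 2 != 0)%R.
  by rewrite gt_eqF// ltr_wpDl ?sqr_ge0// exprn_even_gt0.
have s0 : s != 0%R by apply: contra_neq s2n0 => e; rewrite -s2 e expr0n.
rewrite !normal_pdfE ?oner_neq0//; last by rewrite mulf_neq0 ?invr_eq0.
rewrite mulrACA [RHS]mulrACA /normal_fun -!expRD; congr (_ * expR _)%R.
  rewrite /normal_peak -!invfM -!sqrtrM.
  - by congr ((Num.sqrt _)^-1)%R; rewrite exprMn exprVn !expr1n; field.
  - by rewrite mulrn_wge0// mulr_ge0 ?sqr_ge0 ?pi_ge0.
  - by rewrite mulrn_wge0// mulr_ge0 ?sqr_ge0 ?pi_ge0.
rewrite exprMn exprVn s2; field.
by rewrite s2n0 b0.
Qed.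

Lemma std_normal_convolution (a b : R) (B : set (measurableTypeR R)) :
  (0 <= a)%R -> measurable B ->
  \int[std_normal]_x std_normal [set y | B (a * x + b * y)%R] =
  std_normal [set y | B (Num.sqrt (a ^+ 2 + b ^+ 2) * y)%R].
Proof.
(* For b = 0 the conditional law has no density; the claim then rests on sqrt (a^2) = a, hence on 0
   <= a. *)
move=> a0 mB; have [->|b0] := eqVneq b 0%R.
  rewrite expr0n addr0 sqrtr_sqr ger0_norm//.
  have mC : measurable [set y | B (a * y)%R].
    rewrite -[X in measurable X]setTI.
    have : measurable_fun setT (fun y : measurableTypeR R => (a * y)%R) by exact: measurable_funM.
    exact.
  transitivity (\int[std_normal]_x (\1_[set y | B (a * y)%R] x)%:E).
    apply: eq_integral => x _; rewrite indicE.
    have [xB|xB] := boolP (x \in _).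
      have -> : [set y | B (a * x + 0 * y)%R] = setT.
        apply/seteqP; split=> // y _ /=; rewrite mul0r addr0.
        by move: xB; rewrite inE.
      exact: probability_setT.
    have -> : [set y | B (a * x + 0 * y)%R] = set0.
      apply/seteqP; split=> // y /=; rewrite mul0r addr0 => h.
      by move: xB; rewrite notin_setE.
    exact: measure0.
  by rewrite integral_indic// setIT.
set s := Num.sqrt _.
have s0 : s != 0%R.
  by rewrite gt_eqF// sqrtr_gt0 ltr_wpDl ?sqr_ge0// exprn_even_gt0.
have -> : [set y | B (s * y)%R] = [set y | B (0 + s * y)%R].
  by apply/seteqP; split=> y /=; rewrite add0r.
rewrite std_normal_affine//.
under eq_integral do rewrite std_normal_affine//.
pose F (p : measurableTypeR R * measurableTypeR R) : \bar R :=
  ((\1_B p.2 * normal_pdf (a * p.1) b p.2) * normal_pdf 0 1 p.1)%:E.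
have F0 p : 0 <= F p by rewrite lee_fin !mulr_ge0 ?normal_pdf_ge0.
have mpdf : measurable_fun setT (fun p : measurableTypeR R * measurableTypeR R => normal_pdf (a * p.1) b p.2).
  rewrite (_ : (fun p => _) = (fun p : measurableTypeR R * measurableTypeR R =>
    normal_pdf 0 b (p.2 - a * p.1))%R).
    apply: measurableT_comp; first exact: measurable_normal_pdf.
    apply: measurable_funB; first exact: measurable_snd.
    by apply: measurable_funM => //; exact: measurable_fst.
  by apply/funext => p; rewrite !normal_pdfE// /normal_fun subr0.
have mi : measurable_fun setT (\1_B : measurableTypeR R -> R) by exact: measurable_indic.
have mF : measurable_fun setT F.
  apply/measurable_EFinP; apply: measurable_funM.
    apply: measurable_funM => //.
    exact: (measurableT_comp mi measurable_snd).
  exact: (measurableT_comp (measurable_normal_pdf 0 1) measurable_fst).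
have inner x : normal_prob (a * x) b B * (normal_pdf 0 1 x)%:E = \int[mu]_y F (x, y).
  rewrite /F /=; under eq_integral do rewrite EFinM.
  rewrite ge0_integralZr//.
  - by rewrite normal_probE.
  - by apply/measurable_EFinP; apply: measurable_funM => //; exact: measurable_normal_pdf.
  - by move=> y _; rewrite lee_fin mulr_ge0 ?normal_pdf_ge0.
  - by rewrite lee_fin normal_pdf_ge0.
rewrite integral_std_normal; last 2 first.
- rewrite (_ : (fun x => _) = fun x => \int[mu]_y (\1_B y * normal_pdf (a * x) b y)%:E).
    apply: (@measurable_fun_fubini_tonelli_F _ _ _ _ R mu
      (fun p : measurableTypeR R * measurableTypeR R => (\1_B p.2 * normal_pdf (a * p.1) b p.2)%:E)).
      apply/measurable_EFinP; apply: measurable_funM => //.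
      exact: (measurableT_comp mi measurable_snd).
    by move=> p; rewrite lee_fin mulr_ge0 ?normal_pdf_ge0.
  by apply/funext => x; rewrite normal_probE.
- by move=> x; exact: measure_ge0.
under eq_integral do rewrite inner.
(* Integrating in x first leaves the density of u times the total mass 1 of the conditional
   density. *)
rewrite (fubini_tonelli F)// normal_probE.
apply: eq_integral => u _; rewrite /F /=.
under eq_integral do rewrite -mulrA normal_pdf_convolution// -/s mulrA EFinM.
rewrite ge0_integralZl.
- by rewrite integral_normal_pdf mule1.
- exact: measurableT.
- by apply/measurable_EFinP; exact: measurable_normal_pdf.
- by move=> x _; rewrite lee_fin normal_pdf_ge0.
- by rewrite lee_fin mulr_ge0 ?normal_pdf_ge0.
Qed.

End StandardNormal.

Lemma expn_le_expR (R : realType) (x : R) k : 0 <= x -> x ^+ k <= k`!%:R * expR x.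
Proof.
move=> x0; case: k => [|k]; first by rewrite expr0 fact0 mul1r -[leLHS]expR0 ler_expR.
have := expR_ge1Dxn k x0; have f0 : 0 < (k.+1)`!%:R :> R by rewrite ltr0n fact_gt0.
move=> h; rewrite mulrC -ler_pdivrMr//; apply: le_trans h; by rewrite lerDr.
Qed.

(** * The Gaussian vector: volumes, tail moments, shifts and sums *)

Section GaussianVector.
Local Open Scope ereal_scope.
Context (R : realType) (d : nat).
Notation mu := (@lebesgue_measure R).
Notation N := (std_normal R).

Definition sqn (x : d.-tuple R) : R := (\sum_(j < d) tnth x j ^+ 2)%R.
Definition vadd (x y : d.-tuple R) : d.-tuple R := [tuple (tnth x j + tnth y j)%R | j < d].
Definition dotp (x y : d.-tuple R) : R := (\sum_(j < d) tnth x j * tnth y j)%R.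

Lemma sqn_ge0 x : (0 <= sqn x)%R.
Proof. by apply: sumr_ge0 => j _; exact: sqr_ge0. Qed.

Lemma sqn_vscale c x : sqn (vscale c x) = (c ^+ 2 * sqn x)%R.
Proof.
by rewrite /sqn mulr_sumr; apply: eq_bigr => j _; rewrite tnth_mktuple exprMn.
Qed.

Lemma sqn_vadd x y : sqn (vadd x y) = (sqn x + 2 * dotp x y + sqn y)%R.
Proof.
rewrite /sqn /dotp mulr_sumr -!big_split /=; apply: eq_bigr => j _.
by rewrite tnth_mktuple; ring.
Qed.

Lemma measurable_mktuple d' (T : measurableType d') (f : 'I_d -> T -> R) :
  (forall j, measurable_fun setT (f j)) ->
  measurable_fun setT (fun x => [tuple f j x | j < d]).
Proof.
move=> mf; apply/measurable_fun_tnthP => j.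
by rewrite (_ : _ \o _ = f j)//; apply/funext => x /=; rewrite tnth_mktuple.
Qed.

Lemma measurable_sqn : measurable_fun setT sqn.
Proof.
by apply: measurable_sum => j; apply: measurable_funX; exact: measurable_tnth.
Qed.

Lemma measurable_vscale c : measurable_fun setT (@vscale R d c).
Proof.
apply: measurable_mktuple => j; apply: measurable_funM => //.
exact: measurable_tnth.
Qed.

Lemma measurable_comb2 (a b : R) :
  measurable_fun setT (fun p : d.-tuple R * d.-tuple R => vadd (vscale a p.1) (vscale b p.2)).
Proof.
apply: measurable_mktuple => j; apply: measurable_funD.
  apply: (measurableT_comp (measurable_tnth j)).
  exact: (measurableT_comp (measurable_vscale a) measurable_fst).
apply: (measurableT_comp (measurable_tnth j)).
exact: (measurableT_comp (measurable_vscale b) measurable_snd).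
Qed.

Lemma measurable_dotp y : measurable_fun setT (dotp y).
Proof.
by apply: measurable_sum => j; apply: measurable_funM => //; exact: measurable_tnth.
Qed.

Lemma measurable_sqn_gt z : measurable [set x | (z < sqn x)%R].
Proof.
rewrite -[X in measurable X]setTI.
rewrite (_ : [set x | (z < sqn x)%R] = sqn @^-1` `]z, +oo[%classic).
  by apply: measurable_sqn.
by apply/seteqP; split=> x /=; rewrite in_itv /= andbT.
Qed.

Lemma measurable_sqn_le z : measurable [set x | (sqn x <= z)%R].
Proof.
rewrite -[X in measurable X]setTI.
rewrite (_ : [set x | (sqn x <= z)%R] = sqn @^-1` `]-oo, z]%classic).
  by apply: measurable_sqn.
by apply/seteqP; split=> x /=; rewrite in_itv.
Qed.

Lemma measurable_expR_sqn (c : R) :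
  measurable_fun setT (fun x : d.-tuple R => expR (c * sqn x)).
Proof.
by apply: measurableT_comp => //; apply: measurable_funM => //; exact: measurable_sqn.
Qed.

Lemma indic_box (B : 'I_d -> set R) x :
  \1_(box B) x = (\prod_(j < d) \1_(B j) (tnth x j))%R :> R.
Proof.
rewrite indicE; have [xB|xB] := boolP (x \in box B).
  rewrite big1// => j _; rewrite indicE mem_set//.
  by move: xB; rewrite inE; exact.
have [j Bj] : exists j, ~ B j (tnth x j).
  by move: xB; rewrite notin_setE => /existsNP.
by rewrite (bigD1 j)//= indicE memNset// mul0r.
Qed.

Variables (gam : probability (d.-tuple R) R).
Hypothesis hg : has_iid_coords N gam.

(** By [lebvol_box] this is Lebesgue measure on R^d divided by (2 pi)^(d/2). Being a density with
    respect to [gam], it can be compared pointwise with Gaussian integrals over shells. *)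
Definition lebvol := density gam (measurable_expR_sqn 2^-1) (fun x => expR_ge0 _).

Lemma lebvol_box (B : 'I_d -> set R) : (forall j, measurable (B j)) ->
  lebvol (box B) = \prod_(j < d) ((normal_peak 1)%:E * mu (B j)).
Proof.
move=> mB; rewrite /lebvol /density integral_mkcond.
rewrite (eq_integral (fun x => (\prod_(j < d) (\1_(B j) (tnth x j) *
    expR (tnth x j ^+ 2 / 2)))%:E)); last first.
  move=> x _; rewrite patchE big_split /= -indic_box indicE -expR_sum.
  rewrite /sqn mulr_sumr; under [in RHS]eq_bigr do rewrite mulrC.
  by case: ifPn => _; rewrite ?mul1r ?mul0r.
rewrite (integral_prod_iid (h := fun j x => \1_(B j) x * expR (x ^+ 2 / 2))%R hg).
- by apply: eq_bigr => j _; exact: integral_std_normal_sqr (mB j).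
- move=> j; apply: measurable_funM; first exact: measurable_indic.
  by apply: measurableT_comp => //; apply: measurable_funM => //; exact: measurable_funX.
- by move=> j x; rewrite mulr_ge0 ?expR_ge0.
Qed.

Lemma lebvol_cube_lty (k : nat) :
  lebvol (box (fun=> `[(- k%:R)%R, k%:R%R]%classic)) < +oo.
Proof.
rewrite lebvol_box; last by move=> j; exact: measurable_itv.
rewrite big_const_ord; elim: d => [|n IHn] /=; first exact: ltry.
have h : (normal_peak 1)%:E * mu `[(- k%:R)%R, k%:R%R]%classic \is a fin_num.
  by rewrite lebesgue_measure_itv; case: ifPn => _; rewrite fin_numM.
rewrite -ge0_fin_numE; last first.
  elim: n {IHn} => [|n IHn] /=; rewrite mule_ge0//; apply: mule_ge0 => //;
  by rewrite lee_fin normal_peak_ge0.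
rewrite fin_numM// ge0_fin_numE//.
elim: n {IHn} => [|n IHn] //=; rewrite mule_ge0//; apply: mule_ge0 => //.
by rewrite lee_fin normal_peak_ge0.
Qed.

(** Coordinatewise scaling on boxes, extended by uniqueness. Volumes of balls and shells follow as
    powers of the radius. *)
Lemma lebvol_scale (s : R) (A : set (d.-tuple R)) : (0 < s)%R -> measurable A ->
  lebvol (vscale s @^-1` A) = (s^-1 ^+ d)%:E * lebvol A.
Proof.
move=> s0 mA; have s1 : (0 <= s^-1 ^+ d)%R by rewrite exprn_ge0// invr_ge0 ltW.
have mB' (B : 'I_d -> set R) j : measurable (B j) -> measurable [set y | B j (s * y)%R].
  move=> mB; rewrite -[X in measurable X]setTI.
  have : measurable_fun setT (fun y : R => s * y)%R by exact: measurable_funM.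
  exact.
pose m1 := mscale (NngNum s1) lebvol.
pose m2 := image_measure lebvol (measurable_vscale s).
apply/esym.
rewrite -[LHS]/(m1 A) -[RHS]/(m2 A).
apply: tuple_measure_unique mA => [B mB|k].
  transitivity ((s^-1 ^+ d)%:E * lebvol (box B)) => //.
  transitivity (lebvol (vscale s @^-1` box B)) => //.
  have -> : vscale s @^-1` box B = box (fun j => [set y | B j (s * y)%R]).
    by apply/seteqP; split=> x h j; have := h j; rewrite /= tnth_mktuple.
  rewrite !lebvol_box//; last by move=> j; exact: mB'.
  rewrite (_ : (s^-1 ^+ d)%:E = \prod_(j < d) (s^-1)%:E); last first.
    by rewrite prodEFin prodr_const card_ord.
  rewrite -big_split /=; apply: eq_bigr => j _.
  rewrite muleCA; congr (_ * _).
  rewrite (_ : [set y | B j (s * y)%R] = (fun y => 0 + s * y)%R @^-1` B j).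
    by rewrite (lebesgue_measure_affine 0 (lt0r_neq0 s0) (mB j)) gtr0_norm.
  by apply/seteqP; split=> y /=; rewrite add0r.
by apply: lte_mul_pinfty => //; exact: lebvol_cube_lty.
Qed.

Lemma lebvol_ball (z : R) : (0 < z)%R ->
  lebvol [set x | (sqn x <= z)%R] = (Num.sqrt z ^+ d)%:E * lebvol [set x | (sqn x <= 1)%R].
Proof.
move=> z0; have sz : (0 < (Num.sqrt z)^-1)%R by rewrite invr_gt0 sqrtr_gt0.
rewrite (_ : [set x | (sqn x <= z)%R] = vscale (Num.sqrt z)^-1 @^-1` [set x | (sqn x <= 1)%R]).
  by rewrite lebvol_scale// ?invrK//; exact: measurable_sqn_le.
apply/seteqP; split=> x /=; rewrite sqn_vscale exprVn sqr_sqrtr ?(ltW z0)//;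
  by rewrite mulrC ler_pdivrMr// mul1r.
Qed.

Definition unit_vol : R := fine (lebvol [set x | (sqn x <= 1)%R]).

Lemma unit_volE : lebvol [set x | (sqn x <= 1)%R] = unit_vol%:E.
Proof.
rewrite /unit_vol fineK// ge0_fin_numE//.
apply: (@le_lt_trans _ _ (lebvol (box (fun=> `[(- 1%:R)%R, 1%:R%R]%classic)))).
  apply: le_measure; rewrite ?inE.
  - exact: measurable_sqn_le.
  - by apply: measurable_box => j; exact: measurable_itv.
  - move=> x /= x1 j; rewrite /= in_itv /= -ler_norml.
    rewrite -(ler_pXn2r (n := 2))// ?nnegrE// expr1n real_normK ?num_real//.
    apply: le_trans x1; rewrite /sqn (bigD1 j)//= lerDl.
    by apply: sumr_ge0 => i _; exact: sqr_ge0.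
exact: (lebvol_cube_lty 1).
Qed.

Lemma unit_vol_ge0 : (0 <= unit_vol)%R.
Proof. exact: fine_ge0. Qed.

Lemma lebvol_shell (u w : R) : (0 < u)%R -> (u <= w)%R ->
  lebvol [set x | (u < sqn x)%R /\ (sqn x <= w)%R] =
  ((Num.sqrt w ^+ d - Num.sqrt u ^+ d) * unit_vol)%:E.
Proof.
move=> u0 uw; have w0 := lt_le_trans u0 uw.
have mS : measurable [set x | (u < sqn x)%R /\ (sqn x <= w)%R].
  by apply: measurableI; [exact: measurable_sqn_gt|exact: measurable_sqn_le].
have : lebvol [set x | (sqn x <= w)%R] = lebvol [set x | (sqn x <= u)%R] +
    lebvol [set x | (u < sqn x)%R /\ (sqn x <= w)%R].
  rewrite -measureU//; last 2 first.
  - exact: measurable_sqn_le.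
  - by apply/seteqP; split=> // x /= [h1 [h2 _]]; move: (lt_le_trans h2 h1); rewrite ltxx.
  congr lebvol; apply/seteqP; split=> x /=.
    by have [xu xw|ux xw] := leP (sqn x) u; [left|right].
  by case=> [h|[]//]; exact: le_trans uw.
rewrite (lebvol_ball w0) (lebvol_ball u0) unit_volE.
move: (lebvol _) => X; case: X => [r| |] //= [E].
by congr EFin; rewrite mulrBl E addrAC subrr add0r.
Qed.

Lemma measurable_sqnX k (D : set (d.-tuple R)) :
  measurable_fun D (fun x : d.-tuple R => (sqn x ^+ k)%:E).
Proof.
apply: measurable_funTS; apply/measurable_EFinP; apply: measurable_funX; exact: measurable_sqn.
Qed.

Lemma sqnX_ge0 k x : 0 <= (sqn x ^+ k)%:E.
Proof. by rewrite lee_fin exprn_ge0// sqn_ge0. Qed.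

(** r^k <= k! 4^k e^(r/4), and the exponential moment factorises over coordinates. *)
Lemma integral_sqnX_lty k : \int[gam]_x (sqn x ^+ k)%:E < +oo.
Proof.
have h4 : \int[gam]_x (expR (4^-1 * sqn x))%:E < +oo.
  rewrite (eq_integral (fun x : d.-tuple R => (\prod_(j < d) expR (tnth x j ^+ 2 / 4))%:E)); last first.
    move=> x _; rewrite -expR_sum /sqn mulr_sumr.
    by under eq_bigr do rewrite mulrC.
  rewrite (integral_prod_iid (h := fun j x => expR (x ^+ 2 / 4))%R hg); last 2 first.
  - move=> _; apply: measurableT_comp => //.
    by apply: measurable_funM => //; exact: measurable_funX.
  - by move=> _ x; exact: expR_ge0.
  have I0 : 0 <= \int[N]_x (expR (x ^+ 2 / 4))%:E.
    by apply: integral_ge0 => x _; rewrite lee_fin expR_ge0.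
  have If : \int[N]_x (expR (x ^+ 2 / 4))%:E \is a fin_num.
    by rewrite ge0_fin_numE// integral_std_normal_expR4.
  rewrite -(fineK If) prodEFin; exact: ltry.
apply: (@le_lt_trans _ _ (\int[gam]_x ((k`!%:R * 4 ^+ k)%:E * (expR (4^-1 * sqn x))%:E))).
  apply: ge0_le_integral => //.
  - by move=> x _; exact: sqnX_ge0.
  - exact: measurable_sqnX.
  - apply: emeasurable_funM => //; apply/measurable_EFinP; exact: measurable_expR_sqn.
  - move=> x _; rewrite lee_fin.
    have x4 : (0 <= 4^-1 * sqn x)%R by rewrite mulr_ge0 ?sqn_ge0.
    have := expn_le_expR k x4; rewrite exprMn exprVn mulrC ler_pdivrMr ?exprn_gt0//.
    by rewrite mulrAC.
rewrite ge0_integralZl//.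
- by rewrite lte_mul_pinfty.
- apply/measurable_EFinP; exact: measurable_expR_sqn.
Qed.

(** Weighting the chi-square law with d degrees of freedom by r^k gives, after normalisation, the
    one with d + 2k degrees; divided by the full moment E |g|^(2k), this is therefore the tail of
    that law. For the Gaussian [gam], [fine] meets only finite values, by [tail_momentE]. *)
Definition tail_moment k (z : R) : R :=
  fine (\int[gam]_(x in [set x | (z < sqn x)%R]) (sqn x ^+ k)%:E).

Lemma tail_momentE k z :
  (tail_moment k z)%:E = \int[gam]_(x in [set x | (z < sqn x)%R]) (sqn x ^+ k)%:E.
Proof.
rewrite fineK// ge0_fin_numE; last by apply: integral_ge0 => x _; exact: sqnX_ge0.
apply: le_lt_trans (integral_sqnX_lty k); apply: ge0_subset_integral => //.
- exact: measurable_sqn_gt.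
- exact: measurable_sqnX.
- by move=> x _; exact: sqnX_ge0.
Qed.

Lemma tail_moment_ge0 k z : (0 <= tail_moment k z)%R.
Proof. by apply: fine_ge0; apply: integral_ge0 => x _; exact: sqnX_ge0. Qed.

Lemma tail_moment0 z : (tail_moment 0 z)%:E = gam [set x | (z < sqn x)%R].
Proof.
rewrite tail_momentE (eq_integral (cst 1))//.
by rewrite integral_cst ?mul1e//; exact: measurable_sqn_gt.
Qed.

(** A negative level, in practice -1, makes the tail condition always true and so encodes full
    moments; level 0 would leave out the origin. *)
Lemma tail_moment_neg k z : (z < 0)%R ->
  (tail_moment k z)%:E = \int[gam]_x (sqn x ^+ k)%:E.
Proof.
move=> z0; rewrite tail_momentE; congr integral.
by apply/seteqP; split=> // x _ /=; exact: lt_le_trans (sqn_ge0 x).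
Qed.

Lemma tail_momentS k z : (0 < z)%R ->
  (z * tail_moment k z <= tail_moment k.+1 z)%R.
Proof.
move=> z0; rewrite -lee_fin EFinM !tail_momentE.
rewrite -ge0_integralZl; last 4 first.
- exact: measurable_sqn_gt.
- exact: measurable_sqnX.
- by move=> x _; exact: sqnX_ge0.
- by rewrite lee_fin ltW.
apply: ge0_le_integral => //.
- exact: measurable_sqn_gt.
- by move=> x _; rewrite mule_ge0 ?sqnX_ge0// lee_fin ltW.
- by apply: emeasurable_funM => //; exact: measurable_sqnX.
- exact: measurable_sqnX.
- move=> x /= zx; rewrite -EFinM lee_fin exprS ler_wpM2r ?(ltW zx)//.
  by rewrite exprn_ge0// sqn_ge0.
Qed.

Lemma measurable_shell (u w : R) :
  measurable [set x | (u < sqn x)%R /\ (sqn x <= w)%R].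
Proof. by apply: measurableI; [exact: measurable_sqn_gt|exact: measurable_sqn_le]. Qed.

Lemma tail_momentB k (u w : R) : (u <= w)%R ->
  (tail_moment k u - tail_moment k w)%:E =
  \int[gam]_(x in [set x | (u < sqn x)%R /\ (sqn x <= w)%R]) (sqn x ^+ k)%:E.
Proof.
move=> uw; have : (tail_moment k u)%:E = (tail_moment k w)%:E +
    \int[gam]_(x in [set x | (u < sqn x)%R /\ (sqn x <= w)%R]) (sqn x ^+ k)%:E.
  rewrite !tail_momentE -ge0_integral_setU; last 5 first.
  - exact: measurable_sqn_gt.
  - exact: measurable_shell.
  - exact: measurable_sqnX.
  - by move=> x _; exact: sqnX_ge0.
  - apply/disj_setPS => x /= [h1 [_ h2]]; move: (lt_le_trans h1 h2).
    by rewrite ltxx.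
  congr integral; apply/seteqP; split=> x /=.
    by move=> ux; have [xw|wx] := leP (sqn x) w; [right|left].
  by case=> [h|[]//]; exact: le_lt_trans h.
case: (\int[gam]_(x in _) _) => [r| |] //= [->].
by congr EFin; rewrite addrAC subrr add0r.
Qed.

Lemma tail_moment_le k (u w : R) : (u <= w)%R -> (tail_moment k w <= tail_moment k u)%R.
Proof.
move=> uw; rewrite -subr_ge0 -lee_fin tail_momentB//.
by apply: integral_ge0 => x _; exact: sqnX_ge0.
Qed.

Lemma tail_moment0_total : tail_moment 0 (-1) = 1%R.
Proof.
apply: EFin_inj; rewrite tail_moment0 -(probability_setT gam); congr (gam _).
by apply/seteqP; split=> // x _ /=; apply: lt_le_trans (sqn_ge0 x); rewrite ltrN10.
Qed.

Lemma integrable_sqnX k : gam.-integrable setT (fun x => (sqn x ^+ k)%:E).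
Proof.
apply/integrableP; split; first exact: measurable_sqnX.
under eq_integral do rewrite gee0_abs ?sqnX_ge0//.
exact: integral_sqnX_lty.
Qed.

(** Moment method: a polynomial lying below the indicator of (D, +oo) on [0, +oo) is integrated
    against the law of |g|^2, and its integral is a combination of full moments. *)
Lemma tail_moment_poly (c : nat -> R) N (D : R) :
  (forall z, (0 <= z)%R -> (\sum_(i < N) c i * z ^+ i <= (D < z)%R%:R)%R) ->
  (\sum_(i < N) c i * tail_moment i (-1) <= tail_moment 0 D)%R.
Proof.
move=> hc.
have iE := integral_lincomb c N measurableT integrable_sqnX
  (fun i => esym (tail_moment_neg i (ltrN10 R))).
have [i1 i2] := iE; rewrite -lee_fin -i2 tail_moment0.
rewrite -[X in _ <= gam X]setIT -integral_indic//; last exact: measurable_sqn_gt.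
apply: le_integral => //.
  apply/integrableP; split; first by apply/measurable_EFinP/measurable_indic; exact: measurable_sqn_gt.
  under eq_integral do rewrite gee0_abs ?lee_fin//.
  rewrite integral_indic//; last exact: measurable_sqn_gt.
  rewrite (le_lt_trans (probability_le1 _ _)) ?ltry//; rewrite setIT; exact: measurable_sqn_gt.
move=> x _; rewrite lee_fin (le_trans (hc _ (sqn_ge0 x)))// indicE.
rewrite (_ : (x \in [set x | (D < sqn x)%R]) = (D < sqn x)%R)//.
by apply/idP/idP; rewrite inE.
Qed.

(** With respect to [lebvol] the Gaussian has density e^(-|x|^2/2). On the shell, each factor of
    |x|^(2k) e^(-|x|^2/2) is bounded by its value at an endpoint, and the volume of the shell is
    known. Together with the lower bound below, this determines the derivative of [tail_moment] in
    the level. *)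
Lemma tail_momentB_ub k (u w : R) : (0 < u)%R -> (u <= w)%R ->
  (tail_moment k u - tail_moment k w <=
   w ^+ k * expR (- u / 2) * (unit_vol * (Num.sqrt w ^+ d - Num.sqrt u ^+ d)))%R.
Proof.
move=> u0 uw; have w0 : (0 <= w)%R by rewrite (le_trans (ltW u0)).
rewrite -lee_fin tail_momentB// [leRHS]EFinM (mulrC unit_vol) -lebvol_shell//.
rewrite /lebvol /density -ge0_integralZl; last 4 first.
- exact: measurable_shell.
- by apply: measurable_funTS; apply/measurable_EFinP; exact: measurable_expR_sqn.
- by move=> x _; rewrite lee_fin expR_ge0.
- by rewrite lee_fin mulr_ge0 ?expR_ge0 ?exprn_ge0.
apply: ge0_le_integral => //.
- exact: measurable_shell.
- by move=> x _; exact: sqnX_ge0.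
- exact: measurable_sqnX.
- apply: emeasurable_funM => //; apply: measurable_funTS; apply/measurable_EFinP.
  exact: measurable_expR_sqn.
- move=> x /= [ux xw]; rewrite -EFinM lee_fin -mulrA -expRD.
  rewrite -[leLHS]mulr1; apply: ler_pM => //.
  + by rewrite exprn_ge0// sqn_ge0.
  + by apply: lerXn2r; rewrite ?nnegrE ?sqn_ge0.
  + by rewrite -[leLHS]expR0 ler_expR; lra.
Qed.

Lemma tail_momentB_lb k (u w : R) : (0 < u)%R -> (u <= w)%R ->
  (u ^+ k * expR (- w / 2) * (unit_vol * (Num.sqrt w ^+ d - Num.sqrt u ^+ d)) <=
   tail_moment k u - tail_moment k w)%R.
Proof.
move=> u0 uw; have w0 : (0 <= w)%R by rewrite (le_trans (ltW u0)).
rewrite -lee_fin tail_momentB// [leLHS]EFinM (mulrC unit_vol) -lebvol_shell//.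
rewrite /lebvol /density -ge0_integralZl; last 4 first.
- exact: measurable_shell.
- by apply: measurable_funTS; apply/measurable_EFinP; exact: measurable_expR_sqn.
- by move=> x _; rewrite lee_fin expR_ge0.
- by rewrite lee_fin mulr_ge0 ?expR_ge0 ?exprn_ge0// ltW.
apply: ge0_le_integral => //.
- exact: measurable_shell.
- by move=> x _; rewrite -EFinM lee_fin !mulr_ge0 ?expR_ge0// exprn_ge0// ltW.
- apply: emeasurable_funM => //; apply: measurable_funTS; apply/measurable_EFinP.
  exact: measurable_expR_sqn.
- exact: measurable_sqnX.
- move=> x /= [ux xw]; rewrite -EFinM lee_fin -mulrA -expRD.
  rewrite -[leRHS]mulr1; apply: ler_pM => //.
  + by rewrite exprn_ge0// ltW.
  + by apply: lerXn2r; rewrite ?nnegrE ?sqn_ge0 ?(ltW u0) ?(ltW ux).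
  + by rewrite -[leRHS]expR0 ler_expR; lra.
Qed.

(** Controls the mass near the origin, which the shell bounds do not reach; it lets identities for
    tails pass to full moments. *)
Lemma tail_moment_near0 k (e : R) : (0 < e)%R -> (e <= 1)%R ->
  (tail_moment k (-1) - tail_moment k e <= unit_vol * Num.sqrt e ^+ d)%R.
Proof.
move=> e0 e1; rewrite -lee_fin tail_momentB; last by rewrite (le_trans _ (ltW e0))//; lra.
rewrite EFinM muleC -unit_volE -lebvol_ball//.
rewrite (_ : [set x | (-1 < sqn x)%R /\ (sqn x <= e)%R] = [set x | (sqn x <= e)%R]); last first.
  apply/seteqP; split=> [x []//|x xe]; split=> //.
  by apply: lt_le_trans (sqn_ge0 x); rewrite ltrN10.
apply: ge0_le_integral => //.
- exact: measurable_sqn_le.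
- by move=> x _; exact: sqnX_ge0.
- exact: measurable_sqnX.
- apply: measurable_funTS; apply/measurable_EFinP; exact: measurable_expR_sqn.
- move=> x /= xe; rewrite lee_fin; apply: (@le_trans _ _ 1%R).
    by rewrite exprn_ile1 ?sqn_ge0// (le_trans xe).
  by rewrite -[leLHS]expR0 ler_expR mulr_ge0 ?sqn_ge0.
Qed.

Lemma measurable_shift y : measurable_fun setT (vadd y).
Proof.
apply: measurable_mktuple => j; apply: measurable_funD => //.
exact: measurable_tnth.
Qed.

Lemma measurable_cameron_martin y :
  measurable_fun setT (fun x : d.-tuple R => expR (dotp y x - sqn y / 2)).
Proof.
apply: measurableT_comp => //; apply: measurable_funB => //.
exact: measurable_dotp.
Qed.

(** Both sides are measures in [A]; on boxes they factor into the one-dimensional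
    [std_normal_shift]. *)
Lemma cameron_martin y A : measurable A ->
  gam (vadd y @^-1` A) = \int[gam]_(x in A) (expR (dotp y x - sqn y / 2))%:E.
Proof.
move=> mA.
pose m1 := law gam (measurable_shift y).
pose m2 := density gam (measurable_cameron_martin y) (fun x => expR_ge0 _).
rewrite -[LHS]/(m1 A) -[RHS]/(m2 A).
apply: tuple_measure_unique mA => [B mB|k].
  have mS (v : R) j : measurable [set z | B j (v + z)%R].
    rewrite -[X in measurable X]setTI.
    have : measurable_fun setT (fun z : R => v + z)%R by exact: measurable_funD.
    exact.
  transitivity (gam (vadd y @^-1` box B)) => //.
  transitivity (\int[gam]_(x in box B) (expR (dotp y x - sqn y / 2))%:E) => //.
  have -> : vadd y @^-1` box B = box (fun j => [set z | B j (tnth y j + z)%R]).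
    by apply/seteqP; split=> x h j; have := h j; rewrite /= tnth_mktuple.
  rewrite (hg (fun j => mS (tnth y j) j)) integral_mkcond.
  rewrite (eq_integral (fun x : d.-tuple R => (\prod_(j < d) (\1_(B j) (tnth x j) *
      expR (tnth y j * tnth x j - tnth y j ^+ 2 / 2)))%:E)); last first.
    move=> x _; rewrite patchE big_split /= -indic_box indicE -expR_sum.
    rewrite /sqn /dotp mulr_suml sumrB.
    by case: ifPn => _; rewrite ?mul1r ?mul0r.
  rewrite (integral_prod_iid (h := fun j x => \1_(B j) x *
      expR (tnth y j * x - tnth y j ^+ 2 / 2))%R hg).
  - by apply: eq_bigr => j _; exact: std_normal_shift (mB j).
  - move=> j; apply: measurable_funM; first exact: measurable_indic.
    by apply: measurableT_comp => //; apply: measurable_funB => //; exact: measurable_funM.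
  - by move=> j x; rewrite mulr_ge0 ?expR_ge0.
rewrite (le_lt_trans (probability_le1 _ _)) ?ltry//.
by apply: measurable_box => j; exact: measurable_itv.
Qed.

(** Sections of a box are boxes, so the claim splits into one [std_normal_convolution] per
    coordinate. *)
Lemma gaussian_convolution (a b : R) A : (0 <= a)%R -> measurable A ->
  (gam \x gam) [set p | A (vadd (vscale a p.1) (vscale b p.2))] =
  gam [set x | A (vscale (Num.sqrt (a ^+ 2 + b ^+ 2)) x)].
Proof.
move=> a0 mA; set s := Num.sqrt _.
pose m1 := law (gam \x gam) (measurable_comb2 a b).
pose m2 := law gam (measurable_vscale s).
rewrite -[LHS]/(m1 A) -[RHS]/(m2 A).
apply: tuple_measure_unique mA => [B mB|k]; last first.
  rewrite (le_lt_trans (probability_le1 _ _)) ?ltry//.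
  by apply: measurable_box => j; exact: measurable_itv.
have mS j : measurable [set z | B j (s * z)%R].
  rewrite -[X in measurable X]setTI.
  have : measurable_fun setT (fun z : R => s * z)%R by exact: measurable_funM.
  exact.
pose C j := [set p : R * R | B j (a * p.1 + b * p.2)%R].
have mC j : measurable (C j).
  rewrite -[X in measurable X]setTI.
  have : measurable_fun setT (fun p : R * R => a * p.1 + b * p.2)%R.
    by apply: measurable_funD; apply: measurable_funM => //.
  exact.
have xC j x : xsection (C j) x = [set y | B j (a * x + b * y)%R].
  by apply/seteqP; split=> y; rewrite /xsection /= inE.
transitivity (\prod_(j < d) N [set z | B j (s * z)%R]); last first.
  rewrite -(hg mS); congr (gam _).
  by apply/seteqP; split=> x h j; have := h j; rewrite /= tnth_mktuple.
transitivity (\int[gam]_x (\prod_(j < d) fine (N (xsection (C j) (tnth x j))))%:E).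
  transitivity ((gam \x gam) [set p | box B (vadd (vscale a p.1) (vscale b p.2))]) => //.
  transitivity (\int[gam]_x gam (xsection
      [set p | box B (vadd (vscale a p.1) (vscale b p.2))] x)) => //.
  apply: eq_integral => x _.
  have -> : xsection [set p | box B (vadd (vscale a p.1) (vscale b p.2))] x =
      [set y | box B (vadd (vscale a x) (vscale b y))].
    by apply/seteqP; split=> y; rewrite /xsection /= inE.
  have -> : [set y | box B (vadd (vscale a x) (vscale b y))] =
      box (fun j => xsection (C j) (tnth x j)).
    by apply/seteqP; split=> y h j; have := h j; rewrite xC /= !tnth_mktuple.
  rewrite hg -?prodEFin; last by move=> j; exact: measurable_xsection.
  apply: eq_bigr => j _; rewrite fineK//; apply: fin_num_measure.
  exact: measurable_xsection.
rewrite (integral_prod_iid (h := fun j x => fine (N (xsection (C j) x))) hg).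
- apply: eq_bigr => j _.
  rewrite -(std_normal_convolution b a0 (mB j)).
  apply: eq_integral => x _; rewrite fineK ?xC//.
  by apply: fin_num_measure; rewrite -xC; exact: measurable_xsection.
- move=> j; apply: (measurableT_comp (fine_measurable measurableT)).
  exact: (measurable_fun_xsection N (mC j)).
- by move=> j x; exact: fine_ge0.
Qed.

End GaussianVector.

(** * Calculus and Poisson weights *)

Section RealLemmas.
Context (R : realType).

Lemma le_of_derive_le (f df : R -> R) (a b e : R) : a <= b ->
  (forall x, a <= x <= b -> is_derive x 1 f (df x)) ->
  (forall x, a <= x <= b -> df x <= e) -> f b <= f a + e * (b - a).
Proof.
move=> ab hf hd.
have cf : {within `[a, b], continuous f}.
  by apply: derivable_within_continuous => x; rewrite in_itv /= => /hf [].
have hf' x : x \in `]a, b[ -> is_derive x 1 f (df x).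
  by rewrite in_itv /= => /andP[ac cb]; apply: hf; rewrite !ltW.
have [c] := MVT_segment ab hf' cf; rewrite in_itv /= => cab E.
rewrite -lerBlDl E; apply: ler_wpM2r; [by rewrite subr_ge0|exact: hd].
Qed.

Lemma is_derive_expn (f : R -> R) m (x df : R) : is_derive x 1 f df ->
  is_derive x 1 (fun z => f z ^+ m) (m%:R * f x ^+ m.-1 * df).
Proof.
move=> h; have -> : (fun z => f z ^+ m) = f ^+ m.
  by apply/funext => z; elim: m => [|m IH]; rewrite ?expr0// !exprS IH.
exact: (is_deriveX m h).
Qed.

Lemma is_derive_mul (f g : R -> R) (x df dg : R) : is_derive x 1 f df ->
  is_derive x 1 g dg -> is_derive x 1 (fun z => f z * g z) (df * g x + f x * dg).
Proof.
move=> hf hg; apply: (is_derive_eq (is_deriveM hf hg)).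
by rewrite /GRing.scale /= addrC (mulrC (g x)).
Qed.

Lemma is_derive_comp (f g : R -> R) (x a b : R) : is_derive (g x) 1 f a ->
  is_derive x 1 g b -> is_derive x 1 (fun z => f (g z)) (a * b).
Proof. by move=> hf hg; exact: (is_derive1_comp hf hg). Qed.

Lemma is_derive_scale (f : R -> R) (c x df : R) : is_derive x 1 f df ->
  is_derive x 1 (fun z => c * f z) (c * df).
Proof. by move=> hf; exact: (is_deriveZ c hf). Qed.

Lemma is_derive_sub (f g : R -> R) (x df dg : R) : is_derive x 1 f df ->
  is_derive x 1 g dg -> is_derive x 1 (fun z => f z - g z) (df - dg).
Proof. by move=> hf hg; exact: (is_deriveB hf hg). Qed.

Lemma is_derive_affine (a b x : R) : is_derive x 1 (fun z => a * z + b) a.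
Proof.
apply: (is_derive_eq (is_deriveD (is_deriveZ a (is_derive_id x 1)) (is_derive_cst b x 1))).
by rewrite /GRing.scale /= mulr1 addr0.
Qed.

(** Replaces limits at infinity: a constant that is O(1 / y) vanishes. *)
Lemma norm_le_inv_eq0 (x C y0 : R) : (forall y, y0 <= y -> 0 < y -> `|x| <= C / y) -> x = 0.
Proof.
move=> h; apply/eqP; rewrite -normr_eq0; apply/negPn/negP => x0.
have xp : 0 < `|x| by rewrite lt_neqAle eq_sym x0 /=.
pose y := Num.max 1 (Num.max y0 (C / `|x| + 1)).
have y0y : y0 <= y by rewrite !le_max lexx orbT.
have y1 : 1 <= y by rewrite le_max lexx.
have y2 : C / `|x| + 1 <= y by rewrite !le_max lexx !orbT.
have yp : 0 < y by apply: lt_le_trans y1.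
have := h y y0y yp; rewrite ler_pdivlMr// => h1.
have : C / `|x| < y by apply: lt_le_trans y2; rewrite ltrDl.
by rewrite ltr_pdivrMr// mulrC ltNge h1.
Qed.

Lemma is_derive_bigsum (f : nat -> R -> R) (df : nat -> R) N (x : R) :
  (forall k, is_derive x 1 (f k) (df k)) ->
  is_derive x 1 (fun z => \sum_(k < N) f k z) (\sum_(k < N) df k).
Proof.
move=> h; elim: N => [|N IH].
  rewrite big_ord0 (_ : (fun z => _) = cst 0); first exact: is_derive_cst.
  by apply/funext => z; rewrite big_ord0.
rewrite big_ord_recr /= (_ : (fun z => _) = (fun z => \sum_(k < N) f k z) + f N).
  exact: is_deriveD.
by apply/funext => z; rewrite big_ord_recr.
Qed.

Definition poisson k (m : R) : R := m ^+ k / k`!%:R * expR (- m).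

Lemma poisson_ge0 k m : 0 <= m -> 0 <= poisson k m.
Proof. by move=> m0; rewrite /poisson !mulr_ge0 ?expR_ge0 ?exprn_ge0 ?invr_ge0. Qed.

Lemma poissonS k m : k.+1%:R * poisson k.+1 m = m * poisson k m.
Proof.
have f0 : k`!%:R != 0 :> R by rewrite pnatr_eq0 -lt0n fact_gt0.
have k0 : 1 + k%:R != 0 :> R by rewrite nat1r pnatr_eq0.
by rewrite /poisson factS natrM exprS; field; rewrite f0 k0.
Qed.

Lemma is_derive_poisson k (m : R) : is_derive m 1 (poisson k)
  ((if k is k'.+1 then poisson k' m else 0) - poisson k m).
Proof.
have h1 : is_derive m 1 (fun x : R => k`!%:R^-1 * x ^+ k) (k`!%:R^-1 * (k%:R * m ^+ k.-1 * 1)).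
  apply: is_derive_scale; apply: is_derive_expn; exact: is_derive_id.
have h2 : is_derive m 1 (fun x : R => expR (- x)) (expR (- m) * (-1)).
  exact: (@is_derive_comp expR (fun x => - x) m _ _ (is_derive_expR (- m)) (is_deriveNid m 1)).
have -> : poisson k = fun x => k`!%:R^-1 * x ^+ k * expR (- x).
  by apply/funext => x; rewrite /poisson (mulrC (x ^+ k)).
apply: (is_derive_eq (is_derive_mul h1 h2)); rewrite /poisson; case: k {h1} => [|k].
  by rewrite fact0 expr0; field.
have f0 : k`!%:R != 0 :> R by rewrite pnatr_eq0 -lt0n fact_gt0.
have k0 : 1 + k%:R != 0 :> R by rewrite nat1r pnatr_eq0.
by rewrite factS natrM /= exprS; field; rewrite f0 k0.
Qed.

(** Since p_k' = p_(k-1) - p_k in the Poisson parameter, summation by parts puts the derivative on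
    the increments of [psi]. Truncation leaves a single boundary term, of favourable sign when [m]
    and [psi] are nonnegative. *)
Lemma abel_poisson (psi : nat -> R) m N :
  \sum_(k < N.+1) ((if nat_of_ord k is k'.+1 then poisson k' m else 0) - poisson k m) * psi k =
  \sum_(k < N.+1) poisson k m * (psi k.+1 - psi k) - poisson N m * psi N.+1.
Proof.
elim: N => [|N IH]; first by rewrite !big_ord1 /=; ring.
by rewrite big_ord_recr /= IH [in RHS]big_ord_recr /=; ring.
Qed.

End RealLemmas.

(** * Chi-square tails and the monotonicity of their Poisson mixtures *)

Section ChiSquareTail.
Context (R : realType) (n : nat) (J : nat -> R -> R) (v : R).
Notation d := (n.+2%:R : R).
Hypothesis v0 : 0 <= v.
Hypothesis J_ge0 : forall k z, 0 <= J k z.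
Hypothesis J_le : forall k u w, u <= w -> J k w <= J k u.
Hypothesis J_S : forall k z, 0 < z -> z * J k z <= J k.+1 z.
Hypothesis J_ub : forall k u w, 0 < u -> u <= w ->
  J k u - J k w <=
  w ^+ k * expR (- u / 2) * (v * (Num.sqrt w ^+ n.+2 - Num.sqrt u ^+ n.+2)).
Hypothesis J_lb : forall k u w, 0 < u -> u <= w ->
  u ^+ k * expR (- w / 2) * (v * (Num.sqrt w ^+ n.+2 - Num.sqrt u ^+ n.+2)) <=
  J k u - J k w.
Hypothesis J_near0 : forall k e, 0 < e -> e <= 1 ->
  J k (-1) - J k e <= v * Num.sqrt e ^+ n.+2.
Hypothesis J0_total : J 0 (-1) = 1.

(** With d = n + 2 this is z^(k + d/2 - 1) e^(-z/2) for z > 0, so [kcst * kdens 0] is the chi-square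
    density; [kcst] comes from differentiating the volume v z^(d/2). The family [J] stands for the
    tail moments, which enter only through the hypotheses of the section. *)
Definition kdens k (z : R) := Num.sqrt z ^+ (2 * k + n) * expR (- z / 2).
Definition kcst := v * d / 2.

Lemma kcst_ge0 : 0 <= kcst.
Proof. by rewrite /kcst !mulr_ge0. Qed.

Lemma kdens_ge0 k z : 0 <= kdens k z.
Proof. by rewrite /kdens mulr_ge0 ?expR_ge0 ?exprn_ge0. Qed.

Lemma kdensS k z : 0 <= z -> kdens k.+1 z = z * kdens k z.
Proof.
move=> z0; rewrite /kdens mulrA; congr (_ * _).
by rewrite mulnS addSn addSn !exprS mulrA -expr2 sqr_sqrtr.
Qed.

Lemma kdensE k z : 0 <= z -> kdens k z = z ^+ k * (Num.sqrt z ^+ n * expR (- z / 2)).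
Proof.
move=> z0; by rewrite /kdens exprD exprM sqr_sqrtr// mulrA.
Qed.

Lemma is_derive_sqrtX m (z : R) : 0 < z ->
  is_derive z 1 (fun z => Num.sqrt z ^+ m.+2) (m.+2%:R / 2 * Num.sqrt z ^+ m).
Proof.
move=> z0; have ds := is_derive1_sqrt z0.
have s0 : Num.sqrt z != 0 by rewrite gt_eqF// sqrtr_gt0.
apply: (is_derive_eq (is_derive_expn m.+2 ds)).
by rewrite /= exprS; field.
Qed.

Lemma is_derive_expRN2 (z : R) : is_derive z 1 (fun z => expR (- z / 2)) (- expR (- z / 2) / 2).
Proof.
have h : is_derive z 1 (fun z : R => - z / 2) (- 2^-1).
  rewrite (_ : (fun z : R => - z / 2) = fun z => - 2^-1 * z + 0).
    exact: is_derive_affine.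
  by apply/funext => x; rewrite addr0 !mulNr mulrC.
apply: (is_derive_eq (@is_derive_comp R expR (fun z => - z / 2) z _ _ (is_derive_expR (- z / 2)) h)).
by rewrite mulrN -mulNr.
Qed.

Lemma is_derive_kdensS k (z : R) : 0 < z ->
  is_derive z 1 (kdens k.+1) ((k%:R + d / 2) * kdens k z - kdens k.+1 z / 2).
Proof.
move=> z0.
have -> : kdens k.+1 = fun z => Num.sqrt z ^+ (2 * k + n).+2 * expR (- z / 2).
  by apply/funext => x; rewrite /kdens mulnS.
apply: (is_derive_eq (is_derive_mul (is_derive_sqrtX (2 * k + n) z0) (is_derive_expRN2 z))).
rewrite /kdens.
have -> : (2 * k + n).+2%:R = 2 * k%:R + d :> R.
  by rewrite -[(2 * k + n).+2]addn2 -addnA natrD natrM addn2.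
by field.
Qed.

Lemma is_derive_tail k (z : R) : 0 < z -> is_derive z 1 (J k) (- (kcst * kdens k z)).
Proof.
move=> z0.
pose S (w : R) := Num.sqrt w ^+ n.+2.
have dS := is_derive_sqrtX n z0.
pose Sq (h : R) := h^-1 * (S (h + z) - S z).
have cS : Sq h @[h --> 0^'] --> d / 2 * Num.sqrt z ^+ n.
  have [dS1 <-] := dS; rewrite /Sq.
  have := dS1; rewrite /derivable /derive /=.
  rewrite (_ : (fun h => h^-1 *: (Num.sqrt (h *: 1 + z) ^+ n.+2 - Num.sqrt z ^+ n.+2)) = Sq)//.
  by apply/funext => h; rewrite /Sq /S /GRing.scale /= mulr1.
(* For h > 0 the shell bounds carry [a h] below and [b h] above, for h < 0 the other way round. In
   both cases the quotient differs from - a(h) v Sq(h) by at most |b(h) - a(h)| v Sq(h), which tends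
   to 0. *)
pose a (h : R) := z ^+ k * expR (- (h + z) / 2).
pose b (h : R) := (h + z) ^+ k * expR (- z / 2).
have c0 : (fun h : R => h + z) h @[h --> 0^'] --> z.
  rewrite -[X in _ --> X]add0r; apply: cvgD; last exact: cvg_cst.
  exact: (@nbhs_dnbhs _ (0 : R)).
have ca : a h @[h --> 0^'] --> z ^+ k * expR (- z / 2).
  apply: cvgM; first exact: cvg_cst.
  apply: continuous_cvg; first exact: continuous_expR.
  apply: cvgM; last exact: cvg_cst.
  exact: cvgN.
have cb : b h @[h --> 0^'] --> z ^+ k * expR (- z / 2).
  apply: cvgM; last exact: cvg_cst.
  apply: (@cvg_comp _ _ _ (fun h : R => h + z) (fun x : R => x ^+ k) _ _ _ c0).
  exact: exprn_continuous.
pose quot (h : R) := h^-1 * (J k (h + z) - J k z).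
have cq : quot h @[h --> 0^'] --> - (kcst * kdens k z).
  pose e h := `|b h - a h| * (v * Sq h).
  have ce : e h @[h --> 0^'] --> (0 : R).
    have cn : `|b h - a h| @[h --> 0^'] -->
        `|z ^+ k * expR (- z / 2) - z ^+ k * expR (- z / 2)|.
      by apply: cvg_norm; exact: cvgB.
    rewrite subrr normr0 in cn.
    have cvS : v * Sq h @[h --> 0^'] --> v * (d / 2 * Num.sqrt z ^+ n).
      by apply: cvgM => //; exact: cvg_cst.
    have ce' : e h @[h --> 0^'] --> 0 * (v * (d / 2 * Num.sqrt z ^+ n)).
      by apply: cvgM.
    by rewrite mul0r in ce'.
  have cm : - (a h * (v * Sq h)) @[h --> 0^'] --> - (kcst * kdens k z).
    have -> : - (kcst * kdens k z) =
        - ((z ^+ k * expR (- z / 2)) * (v * (d / 2 * Num.sqrt z ^+ n))).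
      by rewrite /kcst kdensE ?(ltW z0)//; ring.
    apply: cvgN; apply: cvgM => //; apply: cvgM => //; exact: cvg_cst.
  apply: (@squeeze_cvgr _ _ _ _ (fun h => - (a h * (v * Sq h)) - e h)
     (fun h => - (a h * (v * Sq h)) + e h)).
  - near=> h.
    have hz : 0 < h + z.
      near: h; exact: (cvgr_gt _ c0).
    have h0 : h != 0 by near: h; exact: nbhs_dnbhs_neq.
    have key : `|quot h + a h * (v * Sq h)| <= e h.
      rewrite /e /quot /Sq.
      have [hp|hn] := ltP 0 h.
        have zh : z <= h + z by rewrite lerDr ltW.
        have U := J_ub k z0 zh; have L := J_lb k z0 zh.
        rewrite -/(b h) -/(a h) -/(S (h + z)) -/(S z) in U L.
        have hi : 0 < h^-1 by rewrite invr_gt0.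
        set X := S (h + z) - S z in U L *.
        have -> : h^-1 * (J k (h + z) - J k z) + a h * (v * (h^-1 * X)) =
          h^-1 * (a h * (v * X) - (J k z - J k (h + z))) by ring.
        have -> : `|b h - a h| * (v * (h^-1 * X)) = h^-1 * (`|b h - a h| * (v * X)) by ring.
        rewrite normrM (gtr0_norm hi) ler_pM2l//.
        rewrite ler0_norm ?subr_le0//.
        have X0 : 0 <= X.
          by rewrite subr_ge0; apply: lerXn2r; rewrite ?nnegrE ?sqrtr_ge0// ler_wsqrtr.
        have vX : 0 <= v * X by rewrite mulr_ge0.
        have N := ler_norm (b h - a h).
        have := ler_wpM2r vX N; rewrite mulrBl; lra.
      have hl : h < 0 by rewrite lt_neqAle h0.
      have zh : h + z <= z by rewrite gerDr.
      have U := J_ub k hz zh; have L := J_lb k hz zh.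
      rewrite -/(b h) -/(a h) -/(S (h + z)) -/(S z) in U L.
      have hi : 0 < - h^-1 by rewrite oppr_gt0 invr_lt0.
      set X := S z - S (h + z) in U L.
      have -> : h^-1 * (J k (h + z) - J k z) + a h * (v * (h^-1 * (S (h + z) - S z))) =
        (- h^-1) * (a h * (v * X) - (J k (h + z) - J k z)) by rewrite /X; ring.
      have -> : `|b h - a h| * (v * (h^-1 * (S (h + z) - S z))) =
         (- h^-1) * (`|b h - a h| * (v * X)) by rewrite /X; ring.
      rewrite normrM (gtr0_norm hi) ler_pM2l//.
      rewrite ger0_norm ?subr_ge0//.
      have X0 : 0 <= X.
        by rewrite subr_ge0; apply: lerXn2r; rewrite ?nnegrE ?sqrtr_ge0// ler_wsqrtr.
      have vX : 0 <= v * X by rewrite mulr_ge0.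
      have N' : a h - b h <= `|b h - a h| by rewrite distrC; exact: ler_norm.
      have := ler_wpM2r vX N'; rewrite mulrBl; lra.
    move: key; rewrite ler_norml; lra.
  - by rewrite -[X in _ --> X]subr0; exact: cvgB.
  - by rewrite -[X in _ --> X]addr0; exact: cvgD.
have qE : (fun h => h^-1 *: ((J k \o shift z) (h *: 1) - J k z)) = quot.
  by apply/funext => h; rewrite /quot /GRing.scale /= mulr1.
split.
  by rewrite /derivable qE; apply/cvg_ex; exists (- (kcst * kdens k z)).
by rewrite /derive qE; apply/cvg_lim.
Unshelve. all: by end_near. Qed.

Lemma kdens_le_inv k : exists2 C : R, 0 <= C & forall y, 1 <= y -> kdens k y <= C / y.
Proof.
pose p := (2 * k + n)%N.
exists (p.+1`!%:R * 2 ^+ p.+1); first by rewrite mulr_ge0.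
move=> y y1; have y0 : 0 < y by rewrite (lt_le_trans _ y1).
have y2 : 0 <= y / 2 by rewrite divr_ge0// ltW.
rewrite ler_pdivlMr// /kdens -/p mulNr expRN mulrAC ler_pdivrMr ?expR_gt0//.
have := expn_le_expR p.+1 y2; rewrite exprMn exprVn ler_pdivrMr ?exprn_gt0// mulrAC => h.
apply: le_trans h; rewrite exprSr ler_wpM2r ?(ltW y0)//.
apply: lerXn2r; rewrite ?nnegrE ?sqrtr_ge0 ?(ltW y0)//.
by rewrite -[leRHS](gtr0_norm y0) -sqrtr_sqr ler_wsqrtr// expr2 ler_peMl// ltW.
Qed.

Lemma tail_le_inv k y : 1 <= y -> J k y <= J k.+1 1 / y.
Proof.
move=> y1; have y0 : 0 < y by rewrite (lt_le_trans _ y1).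
by rewrite ler_pdivlMr// mulrC (le_trans (J_S _ y0))// J_le.
Qed.

(** Integration by parts for r^(k + d/2) e^(-r/2) on (z, +oo), obtained by differentiation: the
    difference of the two sides has derivative 0 and decays at infinity. *)
Lemma tail_recursion k z : 0 < z ->
  J k.+1 z = (d + 2 * k%:R) * J k z + 2 * kcst * kdens k.+1 z.
Proof.
move=> z0; have K0 := kcst_ge0.
pose D (x : R) := J k.+1 x - (d + 2 * k%:R) * J k x - 2 * kcst * kdens k.+1 x.
have dD (x : R) : 0 < x -> is_derive x 1 D 0.
  move=> x0.
  apply: (is_derive_eq (is_derive_sub (is_derive_sub (is_derive_tail k.+1 x0)
    (is_derive_scale (d + 2 * k%:R) (is_derive_tail k x0)))
    (is_derive_scale (2 * kcst) (is_derive_kdensS k x0)))).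
  by rewrite mulrN; field.
have Dcst y : z <= y -> D z = D y.
  move=> zy; apply/eqP; rewrite eq_le; apply/andP; split; last first.
    have := @le_of_derive_le R D (fun=> 0) z y 0 zy; rewrite mul0r addr0; apply => // x /andP[zx _].
    by apply: dD; apply: lt_le_trans zx.
  have := @le_of_derive_le R (fun x => -1 * D x) (fun=> -1 * 0) z y 0 zy.
  rewrite mul0r addr0 !mulN1r lerN2; apply => // x /andP[zx _].
    have xp : 0 < x by apply: lt_le_trans zx.
    by apply: (is_derive_eq (is_derive_scale (-1) (dD x xp))); rewrite mulN1r.
have [C C0 hC] := kdens_le_inv k.+1.
have dk0 : 0 <= d + 2 * k%:R by rewrite addr_ge0// mulr_ge0.
suff D0 : D z = 0 by move: D0; rewrite /D => /eqP; rewrite subr_eq0 subr_eq addrC => /eqP.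
apply: (@norm_le_inv_eq0 _ _ (J k.+2 1 + (d + 2 * k%:R) * J k.+1 1 + 2 * kcst * C) (Num.max 1 z)).
move=> y; rewrite ge_max => /andP[y1 zy] y0.
rewrite (Dcst y zy) /D.
have h1 := tail_le_inv k.+1 y1; have h2 := tail_le_inv k y1; have h3 := hC y y1.
have p1 := J_ge0 k.+1 y; have p2 := J_ge0 k y; have p3 := kdens_ge0 k.+1 y.
apply: (@le_trans _ _ (J k.+1 y + (d + 2 * k%:R) * J k y + 2 * kcst * kdens k.+1 y)).
  apply: (le_trans (ler_normB _ _)); apply: lerD.
    apply: (le_trans (ler_normB _ _)); apply: lerD; rewrite ger0_norm// mulr_ge0//.
  by rewrite ger0_norm// !mulr_ge0.
rewrite (mulrDl _ _ y^-1) (mulrDl (J k.+2 1) _ y^-1); apply: lerD; first apply: lerD => //.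
  by rewrite -mulrA ler_wpM2l.
by rewrite -(mulrA (2 * kcst)) ler_wpM2l// mulr_ge0.
Qed.

(** The limit z -> 0 of [tail_recursion], taken with z = 1 / y; every correction is O(1 / y). *)
Lemma moment_recursion k : J k.+1 (-1) = (d + 2 * k%:R) * J k (-1).
Proof.
have K0 := kcst_ge0; have dk0 : 0 <= d + 2 * k%:R by rewrite addr_ge0// mulr_ge0.
apply/eqP; rewrite -subr_eq0; apply/eqP.
apply: (@norm_le_inv_eq0 _ _ (v + (d + 2 * k%:R) * v + 2 * kcst) 1) => y y1 y0.
pose e := y^-1.
have e0 : 0 < e by rewrite invr_gt0.
have e1 : e <= 1 by rewrite invf_le1.
have sle : Num.sqrt e <= 1 by rewrite -[leRHS]sqrtr1 ler_wsqrtr.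
have se : Num.sqrt e ^+ n.+2 <= e.
  rewrite -addn2 exprD sqr_sqrtr ?(ltW e0)// ler_piMl ?(ltW e0)//.
  by rewrite exprn_ile1.
have kd : kdens k.+1 e <= e.
  rewrite kdensS ?(ltW e0)// ler_piMr ?(ltW e0)// /kdens mulr_ile1 ?expR_ge0 ?exprn_ge0//.
    by rewrite exprn_ile1.
  by rewrite -[leRHS]expR0 ler_expR mulNr oppr_le0 divr_ge0// ltW.
have N1 : -1 <= e by rewrite (le_trans _ (ltW e0))//; lra.
have h1 := J_near0 k.+1 e0 e1; have h2 := J_near0 k e0 e1.
have m1 := J_le k.+1 N1; have m2 := J_le k N1.
have E := tail_recursion k e0.
have s1 : v * Num.sqrt e ^+ n.+2 <= v * e by rewrite ler_wpM2l.
have s2 : 2 * kcst * kdens k.+1 e <= 2 * kcst * e by rewrite ler_wpM2l// mulr_ge0.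
have s3 : 0 <= 2 * kcst * kdens k.+1 e by rewrite !mulr_ge0 ?kdens_ge0.
have s4 : (d + 2 * k%:R) * (J k (-1) - J k e) <= (d + 2 * k%:R) * (v * e).
  by rewrite ler_wpM2l//; lra.
have s5 : 0 <= (d + 2 * k%:R) * (J k (-1) - J k e) by rewrite mulr_ge0// subr_ge0.
have s6 : 0 <= (d + 2 * k%:R) * (v * e) by rewrite !mulr_ge0// ltW.
have s7 : 0 <= v * e by rewrite mulr_ge0// ltW.
rewrite mulrBr in s4 s5; rewrite -/e.
rewrite (_ : (v + (d + 2 * k%:R) * v + 2 * kcst) * e =
  v * e + (d + 2 * k%:R) * (v * e) + 2 * kcst * e); last by ring.
rewrite ler_norml; lra.
Qed.

(** The density at x + 2 is at least e^(-1) times that at x, since x^(n/2) is nondecreasing. So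
    J_0(x + 2) - e^(-1) J_0(x) is nonincreasing in x, and it vanishes at infinity. *)
Lemma tail0_shift2 z : 0 < z -> expR (-1) * J 0 z <= J 0 (z + 2).
Proof.
move=> z0; have K0 := kcst_ge0.
rewrite leNgt; apply/negP => lt0.
pose f (x : R) := J 0 (x + 2) - expR (-1) * J 0 x.
have df (x : R) : 0 < x -> is_derive x 1 f (- (kcst * kdens 0 (x + 2)) - expR (-1) * (- (kcst * kdens 0 x))).
  move=> x0; have x2 : 0 < 1 * x + 2 by rewrite mul1r addr_gt0.
  have := @is_derive_comp R (J 0) (fun y => 1 * y + 2) x _ _ (is_derive_tail 0 x2) (is_derive_affine 1 2 x).
  rewrite (_ : (fun y => J 0 (1 * y + 2)) = fun y => J 0 (y + 2)); last first.
    by apply/funext => y; rewrite mul1r.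
  rewrite mulr1 mul1r => h.
  exact: (is_derive_sub h (is_derive_scale _ (is_derive_tail 0 x0))).
have fz : f z < 0 by rewrite subr_lt0.
suff : f z = 0 by move=> h; move: fz; rewrite h ltxx.
apply: (@norm_le_inv_eq0 _ _ (expR (-1) * J 1 1) (Num.max 1 z)).
move=> y; rewrite ge_max => /andP[y1 zy] y0.
rewrite ltr0_norm//.
have h : f y <= f z + 0 * (y - z).
  apply: (le_of_derive_le zy (df := fun x => - (kcst * kdens 0 (x + 2)) - expR (-1) * (- (kcst * kdens 0 x)))).
    by move=> x /andP[zx _]; apply: df; apply: lt_le_trans zx.
  move=> x /andP[zx _]; have x0 : 0 < x by apply: lt_le_trans zx.
  have -> : - (kcst * kdens 0 (x + 2)) - expR (-1) * - (kcst * kdens 0 x) =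
      kcst * (expR (-1) * kdens 0 x - kdens 0 (x + 2)) by ring.
  rewrite mulr_ge0_le0// subr_le0 /kdens mulrCA -expRD.
  apply: ler_pM; rewrite ?expR_ge0 ?exprn_ge0//.
    by apply: lerXn2r; rewrite ?nnegrE ?sqrtr_ge0// ler_wsqrtr// lerDl.
  by rewrite ler_expR; lra.
rewrite mul0r addr0 in h.
apply: (@le_trans _ _ (expR (-1) * J 0 y)).
  by have := J_ge0 0 (y + 2); rewrite /f in h *; lra.
by rewrite -mulrA ler_wpM2l ?expR_ge0// tail_le_inv.
Qed.

Hypothesis J_poly : forall (c : nat -> R) N (D : R),
  (forall z, 0 <= z -> \sum_(i < N) c i * z ^+ i <= (D < z)%R%:R) ->
  \sum_(i < N) c i * J i (-1) <= J 0 D.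

(** The variable w = (|g|^2 - d) / sqrt d has E w = 0, E w^2 = 2 and E w^4 = 12 + 48 / d. The
    quartic [q] is nonpositive for w <= 0 and at most 1 for w > 0, and E q = (2 - (1 + 4 / d) / 3) /
    20 is at least 1/20 because d >= 2. *)
Lemma tail0_mean : 20^-1 <= J 0 d.
Proof.
pose s := Num.sqrt d.
have d2 : 2 <= d by rewrite ler_nat.
have s0 : 0 < s by rewrite sqrtr_gt0; lra.
have sd : d = s ^+ 2 by rewrite sqr_sqrtr//; lra.
have sn0 : s != 0 by rewrite gt_eqF.
(* The linear coefficient 12/5 is just above 4 / sqrt 3, the least value giving the right sign for w
   <= 0; the bracket then stays below 20, whence the factor. *)
pose q (w : R) := 20^-1 * (12 / 5 * w + w ^+ 2 - w ^+ 4 / 36).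
pose c (i : nat) : R := 20^-1 * nth 0 [:: - (12 / 5) * s + d - d ^+ 2 / 36;
  12 / 5 / s - 2 + d / 9; d^-1 - 6^-1; (9 * d)^-1; - (36 * d ^+ 2)^-1] i.
have cE z : \sum_(i < 5) c i * z ^+ i = q ((z - d) / s).
  rewrite !big_ord_recl big_ord0 /c /q /= /bump /= sd; field.
  exact: sn0.
have qub w : 0 < w -> q w <= 1.
  move=> w0; rewrite /q -[leRHS](mulVf (_ : 20 != 0)) ?ler_wpM2l//.
  have h1 : 0 <= (w ^+ 2 / 6 - 19 / 5) ^+ 2 by exact: sqr_ge0.
  have h2 : 0 <= (w - 9 / 2) ^+ 2 by exact: sqr_ge0.
  have -> : 12 / 5 * w + w ^+ 2 - w ^+ 4 / 36 = 361 / 25 - (w ^+ 2 / 6 - 19 / 5) ^+ 2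
     + 12 / 5 * w - 4 / 15 * w ^+ 2 by field.
  have : 4 / 15 * w ^+ 2 = 4 / 15 * (w - 9 / 2) ^+ 2 + 12 / 5 * w - 4 / 15 * (9 / 2) ^+ 2 by field.
  lra.
have qneg w : w <= 0 -> q w <= 0.
  move=> w0; rewrite /q pmulr_rle0//.
  have -> : 12 / 5 * w + w ^+ 2 - w ^+ 4 / 36 = w * (12 / 5 + w - w ^+ 3 / 36) by field.
  apply: mulr_le0_ge0 => //.
  have [u [u0 ->]] : exists u, 0 <= u /\ w = - u by exists (- w); rewrite opprK oppr_ge0.
  (* 7/2 approximates sqrt 12, where u^3 / 36 - u is least over u >= 0. *)
  have : 0 <= (u - 7 / 2) ^+ 2 * (u + 7) by rewrite mulr_ge0 ?sqr_ge0// addr_ge0.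
  have -> : (- u) ^+ 3 = - (u ^+ 3) by ring.
  have -> : (u - 7 / 2) ^+ 2 * (u + 7) =
    u ^+ 3 - 147 / 4 * u + 343 / 4 by field.
  lra.
have hq z : 0 <= z -> \sum_(i < 5) c i * z ^+ i <= (d < z)%R%:R.
  move=> z0; rewrite cE; have [dz|zd] := ltP d z.
    by apply: qub; rewrite divr_gt0// subr_gt0.
  by apply: qneg; rewrite pmulr_lle0 ?invr_gt0// subr_le0.
apply: le_trans (J_poly hq).
rewrite !big_ord_recl big_ord0 /c /= /bump /= !addn0 !add1n.
rewrite !moment_recursion J0_total.
have dn0 : d != 0 by rewrite gt_eqF//; lra.
have -> : 20^-1 * (- (12 / 5) * s + d - d ^+ 2 / 36) * 1 +
 (20^-1 * (12 / 5 / s - 2 + d / 9) * ((d + 2 * 0%:R) * 1) +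
  (20^-1 * (d^-1 - 6^-1) * ((d + 2 * 1%:R) * ((d + 2 * 0%:R) * 1)) +
   (20^-1 * (9 * d)^-1 * ((d + 2 * 2%:R) * ((d + 2 * 1%:R) * ((d + 2 * 0%:R) * 1))) +
    (20^-1 * - (36 * d ^+ 2)^-1 *
     ((d + 2 * 3%:R) * ((d + 2 * 2%:R) * ((d + 2 * 1%:R) * ((d + 2 * 0%:R) * 1)))) + 0)))) =
  20^-1 * (2 - (1 + 4 / d) / 3) :> R.
  have -> : d^-1 = s ^- 2 by rewrite sd.
  rewrite sd; field; exact: sn0.
rewrite ler_peMr//.
have : 4 / d <= 2 by rewrite ler_pdivrMr; lra.
by move: (4 / d) => x; lra.
Qed.

(** 80 = 4 * 20: moving the level by 2 costs a factor e, and e <= 4 because e^(-1/2) >= 1/2. *)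
Lemma tail0_mean2 : 80^-1 <= J 0 (d + 2).
Proof.
have d0 : 0 < d by rewrite ltr0n.
apply: le_trans (tail0_shift2 d0).
have e2 : 2^-1 <= expR (- 2^-1) :> R by have := expR_ge1Dx (- 2^-1 : R); lra.
have e1 : 4^-1 <= expR (-1) :> R.
  rewrite (_ : -1 = - 2^-1 + - 2^-1); last by field.
  rewrite expRD; have : 2^-1 * 2^-1 <= expR (- 2^-1) * expR (- 2^-1) :> R by apply: ler_pM.
  lra.
have : 4^-1 * 20^-1 <= expR (-1) * J 0 d by apply: ler_pM => //; exact: tail0_mean.
lra.
Qed.

(** By [moment_recursion] this is E |g|^(2k), the normalisation of J_k. *)
Definition rising k : R := \prod_(j < k) (d + 2 * j%:R).

Lemma risingS k : rising k.+1 = rising k * (d + 2 * k%:R).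
Proof. by rewrite /rising big_ord_recr. Qed.

Lemma rising_ge1 k : 1 <= rising k.
Proof.
elim: k => [|k IH]; first by rewrite /rising big_ord0.
rewrite risingS -[leLHS]mulr1; apply: ler_pM => //.
have : 1 <= d by rewrite ler1n.
by have := ler0n R k; lra.
Qed.

Lemma rising_gt0 k : 0 < rising k.
Proof. by apply: lt_le_trans (rising_ge1 k). Qed.

Lemma is_derive_mixture (al be z : R) N : 0 < z ->
  is_derive z 1 (fun z => \sum_(k < N) poisson k (al * z + be) * (J k z / rising k))
   (\sum_(k < N) ((((if nat_of_ord k is k'.+1 then poisson k' (al * z + be) else 0)
       - poisson k (al * z + be)) * al) * (J k z / rising k) +
      poisson k (al * z + be) * ((rising k)^-1 * - (kcst * kdens k z)))).
Proof.
move=> z0; apply: (@is_derive_bigsum R (fun k z => poisson k (al * z + be) * (J k z / rising k))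
  (fun k => (((if k is k'.+1 then poisson k' (al * z + be) else 0)
       - poisson k (al * z + be)) * al) * (J k z / rising k) +
      poisson k (al * z + be) * ((rising k)^-1 * - (kcst * kdens k z)))).
move=> k; apply: is_derive_mul.
  exact: (@is_derive_comp R (poisson k) (fun z => al * z + be) z _ _
    (is_derive_poisson k _) (is_derive_affine al be z)).
rewrite (_ : (fun z => _) = fun z => (rising k)^-1 * J k z); last first.
  by apply/funext => x; rewrite mulrC.
by apply: is_derive_scale; exact: is_derive_tail.
Qed.

(** Up to normalisation a Bessel law in k, with weights (m z)^k / (k! d (d + 2) ... (d + 2k)). The
    index [k.+1] of [rising] is the one that [tail_recursion] produces when the mixture is
    differentiated. *)
Definition tilted_poisson (m z : R) k := poisson k m * z ^+ k / rising k.+1.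

(* The tilted weights Q are ultra log-concave (k Q_k = lam_(k-1) Q_(k-1) with lam
   decreasing), hence their variance is at most their mean, and this forces their
   mean to be at least m; the right-hand side is the boundary term of the truncated
   sums. *)
Lemma tilted_poisson_mean (m z : R) N : 0 <= m -> d + 2 + 2 * m <= z ->
  \sum_(k < N.+1) tilted_poisson m z k * (m - k%:R) <=
  m * z * (1 + 2 * m) * tilted_poisson m z N.
Proof.
move=> m0 mz; set Q := tilted_poisson m z.
have d1 : 1 <= d by rewrite ler1n.
have z0 : 0 <= z by lra.
have Q0 k : 0 <= Q k.
  by rewrite /Q /tilted_poisson divr_ge0 ?(ltW (rising_gt0 _))// mulr_ge0 ?poisson_ge0 ?exprn_ge0.
pose den k : R := d + 2 * k%:R + 2.
have den1 k : 1 <= den k by rewrite /den; have := ler0n R k; lra.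
have den0 k : 0 < den k by apply: lt_le_trans (den1 k).
pose lam k := m * z / den k.
have QS k : k.+1%:R * Q k.+1 = lam k * Q k.
  have -> : k.+1%:R * Q k.+1 = (k.+1%:R * poisson k.+1 m) * z ^+ k.+1 / rising k.+2.
    by rewrite /Q /tilted_poisson; ring.
  rewrite poissonS risingS exprS /Q /tilted_poisson /lam.
  have -> : d + 2 * k.+1%:R = den k by rewrite /den -natr1; ring.
  by field; rewrite !gt_eqF ?rising_gt0.
have Qd k : k.+1%:R * (d + 2 * k.+1%:R) * Q k.+1 = m * z * Q k.
  rewrite mulrAC QS (_ : d + 2 * k.+1%:R = den k); last by rewrite /den -natr1; ring.
  by rewrite /lam; field; rewrite gt_eqF.
(* Summing k (d + 2k) Q_k = m z Q_(k-1): up to truncation, d E k + 2 E k^2 = m z. *)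
have I1 M : d * (\sum_(k < M.+1) k%:R * Q k) + 2 * (\sum_(k < M.+1) k%:R ^+ 2 * Q k) =
    m * z * (\sum_(k < M.+1) Q k - Q M).
  elim: M => [|M IH]; first by rewrite !big_ord1 /=; ring.
  rewrite big_ord_recr [in X in _ + X]big_ord_recr [in RHS]big_ord_recr /=.
  by have := Qd M; move: IH; lra.
have I2 M : \sum_(k < M.+1) k%:R * Q k = \sum_(k < M.+1) lam k * Q k - lam M * Q M.
  elim: M => [|M IH]; first by rewrite !big_ord1 /=; ring.
  by rewrite big_ord_recr IH [in RHS]big_ord_recr /= QS; ring.
have I3 M : \sum_(k < M.+1) k%:R ^+ 2 * Q k - \sum_(k < M.+1) k%:R * Q k =
    \sum_(k < M.+1) k%:R * lam k * Q k - M%:R * (lam M * Q M).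
  elim: M => [|M IH]; first by rewrite !big_ord1 /=; ring.
  rewrite big_ord_recr [in X in _ - X = _]big_ord_recr [in RHS]big_ord_recr /=.
  have h : (M.+1%:R ^+ 2 - M.+1%:R) * Q M.+1 = M%:R * (lam M * Q M).
    by rewrite -QS -natr1; ring.
  have h2 : M.+1%:R * lam M.+1 * Q M.+1 = M.+1%:R * (lam M.+1 * Q M.+1) by ring.
  have h3 : M%:R * lam M * Q M = M%:R * (lam M * Q M) by ring.
  by move: IH h; rewrite mulrBl; lra.
move: {I1 I2 I3}(I1 N) (I2 N) (I3 N).
set E1 := \sum_(k < N.+1) Q k.
set Ek := \sum_(k < N.+1) k%:R * Q k.
set Ekk := \sum_(k < N.+1) k%:R ^+ 2 * Q k.
set El := \sum_(k < N.+1) lam k * Q k.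
set Elk := \sum_(k < N.+1) k%:R * lam k * Q k.
move=> I1 I2 I3.
(* This is [lam] at the real index m. As [lam] decreases, (k - m) (lam_k - lm) <= 0 for every k, and
   the sum of these inequalities is [I4]; centring at m rather than at the mean avoids dividing by
   the total mass. *)
pose lm := m * z / (d + 2 * m + 2).
have lm0 : 0 <= lm by rewrite divr_ge0 ?mulr_ge0//; lra.
have I4 : Elk <= m * El + lm * Ek - lm * m * E1.
  rewrite /Elk /El /Ek /E1 !mulr_sumr -big_split /= -sumrB; apply: ler_sum => k _.
  have -> : m * (lam k * Q k) + lm * (k%:R * Q k) - lm * m * Q k =
    (m * lam k + lm * k%:R - lm * m) * Q k by ring.
  apply: ler_wpM2r => //.
  rewrite -subr_ge0.
  have dm : 0 < d + 2 * m + 2 by lra.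
  have -> : m * lam k + lm * k%:R - lm * m - k%:R * lam k =
    2 * (m * z) * (k%:R - m) ^+ 2 / (den k * (d + 2 * m + 2)).
    rewrite /lam /lm /den; field.
    have nn := ler0n R n; have kk := ler0n R k.
    by apply/andP; split; rewrite gt_eqF//; lra.
  apply: divr_ge0; first by rewrite mulr_ge0 ?sqr_ge0// mulr_ge0// mulr_ge0.
  by rewrite mulr_ge0 ?(ltW (den0 _)) ?(ltW dm).
have E10 : 0 <= E1 by apply: sumr_ge0.
have SE : \sum_(k < N.+1) Q k * (m - k%:R) = m * E1 - Ek.
  rewrite /E1 /Ek mulr_sumr -sumrB; apply: eq_bigr => k _; ring.
rewrite SE.
have b0 : 0 <= lam N * Q N by rewrite mulr_ge0// divr_ge0 ?mulr_ge0 ?(ltW (den0 _)).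
have b1 : lam N * Q N <= m * z * Q N.
  by rewrite ler_wpM2r// ler_pdivrMr// ler_peMr ?mulr_ge0.
have b2 : 0 <= N%:R * (lam N * Q N) by rewrite mulr_ge0.
have b3 : m * (lam N * Q N) <= m * (m * z * Q N) by rewrite ler_wpM2l.
have k1 : (d + 2 + 2 * m - z) * (m * E1) <= 0 by rewrite mulr_le0_ge0 ?mulr_ge0//; lra.
have mQ : 0 <= m * z * Q N by rewrite mulr_ge0// mulr_ge0.
have mmQ : 0 <= m * (m * z * Q N) by rewrite mulr_ge0.
have mEl : m * El = m * Ek + m * (lam N * Q N) by rewrite I2; ring.
have D : (d + 2 + 2 * m + 2 * lm) * (m * E1 - Ek) <= m * z * (1 + 2 * m) * Q N by lra.
have B0 : 0 <= m * z * (1 + 2 * m) * Q N by lra.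
have [h|h] := leP (m * E1 - Ek) 0; first exact: le_trans B0.
apply: le_trans D; rewrite ler_peMl ?(ltW h)//; lra.
Qed.

(** By [tail_recursion], J_(k+1) / rising (k+1) - J_k / rising k is the pure density term 2 kcst
    kdens_(k+1) / rising (k+1). So after summation by parts no tail remains outside the boundary
    term, and m = al z - d/2 turns the rest into a multiple of the sum of Q_k (m - k). *)
Lemma mixture_derive_le (z0 z al m : R) N : d + 2 <= z0 -> z0 <= z ->
  al = d / (2 * z0) -> m = al * z + - (d / 2) ->
  \sum_(k < N.+1) ((((if nat_of_ord k is k'.+1 then poisson k' m else 0)
       - poisson k m) * al) * (J k z / rising k) +
      poisson k m * ((rising k)^-1 * - (kcst * kdens k z))) <=
  2 * kcst * kdens 0 z * (m * z * (1 + 2 * m) * tilted_poisson m z N).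
Proof.
move=> hz0 z0z alE mE; have d0 : 0 < d by rewrite ltr0n.
have zz0 : 0 < z0 by lra.
have zp : 0 < z by lra.
have al0 : 0 <= al by rewrite alE divr_ge0// ltW//; lra.
have alz : al * z0 = d / 2 by rewrite alE; field; rewrite gt_eqF.
have m0 : 0 <= m by rewrite mE -alz subr_ge0 ler_wpM2l.
(* The origin of the threshold: this amounts to z (z0 - d) >= 2 z0, true for z >= z0 >= d + 2. *)
have mz : d + 2 + 2 * m <= z.
  rewrite mE -subr_ge0.
  have -> : z - (d + 2 + 2 * (al * z + - (d / 2))) = (z * (z0 - d) - 2 * z0) / z0.
    by rewrite alE; field; rewrite gt_eqF.
  rewrite divr_ge0 ?(ltW zz0)// subr_ge0 mulrC; apply: ler_pM => //; lra.
have K0 := kcst_ge0; have g0 := kdens_ge0 0 z.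
rewrite big_split /=.
have -> : \sum_(k < N.+1) ((if nat_of_ord k is k'.+1 then poisson k' m else 0) - poisson k m)
     * al * (J k z / rising k) =
   al * (\sum_(k < N.+1) poisson k m * (J k.+1 z / rising k.+1 - J k z / rising k) -
    poisson N m * (J N.+1 z / rising N.+1)).
  rewrite -(abel_poisson (fun k => J k z / rising k)) mulr_sumr.
  by apply: eq_bigr => k _; ring.
have kd k : kdens k z = z ^+ k * kdens 0 z.
  by rewrite kdensE ?(ltW zp)// [kdens 0 z]kdensE ?(ltW zp)// expr0 mul1r.
rewrite mulrBr mulr_sumr addrAC -big_split /=.
have -> : \sum_(k < N.+1) (al * (poisson k m * (J k.+1 z / rising k.+1 - J k z / rising k)) +
    poisson k m * ((rising k)^-1 * - (kcst * kdens k z))) =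
   2 * kcst * kdens 0 z * \sum_(k < N.+1) tilted_poisson m z k * (m - k%:R).
  rewrite mulr_sumr; apply: eq_bigr => k _.
  rewrite tail_recursion// kdensS ?(ltW zp)// kd /tilted_poisson risingS.
  have r0 := rising_gt0 k; have dk : 0 < d + 2 * k%:R by rewrite ltr_wpDr// mulr_ge0.
  rewrite mE alE; field.
  by rewrite !gt_eqF.
(* The boundary term of the summation by parts enters with a minus sign and is dropped. *)
rewrite lerBlDr; apply: (@le_trans _ _ (2 * kcst * kdens 0 z * (m * z * (1 + 2 * m) * tilted_poisson m z N))).
  by rewrite ler_wpM2l ?mulr_ge0//; exact: tilted_poisson_mean.
by rewrite lerDl mulr_ge0// mulr_ge0 ?poisson_ge0// divr_ge0 ?(ltW (rising_gt0 _)).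
Qed.

(** At z0 the Poisson parameter is 0 and the mixture is J_0(z0). Along the path [mm] the truncated
    mixture grows at most by the integrated boundary term, which tends to 0 as the truncation order
    M grows, while the first N terms are at most the first M + 1. *)
Lemma poisson_mixture_le (z0 z1 : R) N : d + 2 <= z0 -> z0 <= z1 ->
  \sum_(k < N) poisson k (d / 2 * (z1 / z0 - 1)) * (J k z1 / rising k) <= J 0 z0.
Proof.
move=> hz0 z01; have d0 : 0 < d by rewrite ltr0n.
have zz0 : 0 < z0 by lra.
have K0 := kcst_ge0.
pose al := d / (2 * z0); pose mm z := al * z + - (d / 2).
have al0 : 0 <= al by rewrite /al divr_ge0// ltW//; lra.
have alz : al * z0 = d / 2 by rewrite /al; field; rewrite gt_eqF.
have -> : d / 2 * (z1 / z0 - 1) = mm z1 by rewrite /mm /al; field; rewrite gt_eqF.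
pose m1 := mm z1.
have mmle z : z <= z1 -> mm z <= m1 by move=> zz; rewrite lerD2r ler_wpM2l.
have mm0 z : z0 <= z -> 0 <= mm z by move=> zz; rewrite /mm -alz subr_ge0 ler_wpM2l.
have m10 : 0 <= m1 by apply: mm0.
pose F M z := \sum_(k < M) poisson k (mm z) * (J k z / rising k).
pose C := 2 * kcst * Num.sqrt z1 ^+ n * (m1 * z1 * (1 + 2 * m1)).
have z10 : 0 <= z1 by lra.
have FM M : F M.+1 z1 <= J 0 z0 + C * (z1 - z0) * exp_coeff (m1 * z1) M.
  have F0 : F M.+1 z0 = J 0 z0.
    rewrite /F big_ord_recl big1 => [|k _].
      rewrite /mm alz subrr /poisson expr0 fact0 oppr0 expR0 /rising big_ord0.
      by rewrite !divr1 !mul1r addr0.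
    by rewrite /mm alz subrr /poisson lift0 expr0n /= !mul0r.
  rewrite -F0 mulrAC.
  apply: (le_of_derive_le z01 (df := fun z =>
    \sum_(k < M.+1) ((((if nat_of_ord k is k'.+1 then poisson k' (mm z) else 0)
       - poisson k (mm z)) * al) * (J k z / rising k) +
      poisson k (mm z) * ((rising k)^-1 * - (kcst * kdens k z))))).
    by move=> x /andP[h _]; apply: is_derive_mixture; apply: lt_le_trans h.
  move=> x /andP[z0x xz1].
  apply: (le_trans (mixture_derive_le M hz0 z0x erefl erefl)).
  rewrite -/al -/(mm x).
  have x0 : 0 < x by apply: lt_le_trans z0x.
  have mx := mm0 x z0x; have mx1 := mmle x xz1.
  have ex (y : R) : 0 <= y -> expR (- y) <= 1 by move=> y0; rewrite -[leRHS]expR0 ler_expR oppr_le0.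
  (* Uniform in x over [z0, z1], thanks to [rising] >= 1: the error is a term of the exponential
     series. *)
  have tq : tilted_poisson (mm x) x M <= exp_coeff (m1 * z1) M.
    rewrite /tilted_poisson /exp_coeff /= ler_pdivrMr ?rising_gt0//.
    apply: (@le_trans _ _ ((m1 * z1) ^+ M / M`!%:R)); last first.
      by rewrite ler_peMr ?rising_ge1// divr_ge0// exprn_ge0// mulr_ge0.
    have h1 : mm x ^+ M <= m1 ^+ M by apply: lerXn2r.
    have h2 : x ^+ M <= z1 ^+ M by apply: lerXn2r => //; exact: ltW.
    have -> : poisson M (mm x) * x ^+ M = (mm x ^+ M * x ^+ M / M`!%:R) * expR (- mm x).
      by rewrite /poisson; ring.
    rewrite exprMn -[leRHS]mulr1; apply: ler_pM; rewrite ?expR_ge0 ?ex//.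
      by rewrite !mulr_ge0 ?exprn_ge0 ?invr_ge0// ltW.
    rewrite ler_wpM2r ?invr_ge0//; apply: ler_pM; rewrite ?exprn_ge0// ltW//.
  have tq0 : 0 <= tilted_poisson (mm x) x M.
    by rewrite /tilted_poisson divr_ge0 ?(ltW (rising_gt0 _))// mulr_ge0 ?poisson_ge0 ?exprn_ge0// ltW.
  have kd : kdens 0 x <= Num.sqrt z1 ^+ n.
    rewrite /kdens muln0 add0n -[leRHS]mulr1; apply: ler_pM; rewrite ?expR_ge0 ?exprn_ge0//.
      by apply: lerXn2r; rewrite ?nnegrE ?sqrtr_ge0// ler_wsqrtr.
    by rewrite mulNr ex// divr_ge0// ltW.
  rewrite /C -(mulrA (2 * kcst * Num.sqrt z1 ^+ n)).
  have P1 : 0 <= mm x * x by rewrite mulr_ge0// ltW.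
  have P2 : 0 <= 1 + 2 * mm x by lra.
  have P3 := mulr_ge0 P1 P2.
  apply: ler_pM.
  - by rewrite !mulr_ge0 ?kdens_ge0.
  - exact: mulr_ge0.
  - by rewrite ler_wpM2l// mulr_ge0.
  apply: ler_pM => //.
  apply: ler_pM => //.
  - by apply: ler_pM => //; exact: ltW.
  - by rewrite lerD2l ler_wpM2l.
have cv : (fun M => J 0 z0 + C * (z1 - z0) * exp_coeff (m1 * z1) M) @ \oo -->
    J 0 z0 + C * (z1 - z0) * 0.
  apply: cvgD; first exact: cvg_cst.
  apply: cvgM; first exact: cvg_cst.
  exact: cvg_exp_coeff.
rewrite mulr0 addr0 in cv.
rewrite -/(F N z1) -(cvg_lim _ cv)//.
apply: limr_ge; first by apply/cvg_ex; exists (J 0 z0).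
near=> M; apply: le_trans (FM M).
have NM : (N <= M.+1)%N.
  by apply: leqW; near: M; exact: nbhs_infty_ge.
rewrite /F (big_ord_widen M.+1 (fun k => poisson k (mm z1) * (J k z1 / rising k)) NM).
rewrite [leRHS](bigID (fun k : 'I_M.+1 => (k < N)%N)) /= lerDl sumr_ge0// => k _.
by rewrite mulr_ge0 ?poisson_ge0// divr_ge0// ltW// rising_gt0.
Unshelve. all: by end_near. Qed.

End ChiSquareTail.

(** * Orthogonal maps taking a vector to the first axis *)

Section Rotations.
Context (R : realType) (n : nat).
Notation d := n.+2.
Implicit Types x y : d.-tuple R.

Lemma mxapply_dotp (U : 'M[R]_d) y x : dotp y (mxapply U x) = dotp (mxapply U^T y) x.
Proof.
rewrite /dotp; under eq_bigr do rewrite tnth_mktuple mulr_sumr.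
rewrite exchange_big /=; apply: eq_bigr => k _.
rewrite tnth_mktuple mulr_suml; apply: eq_bigr => j _.
by rewrite mxE; ring.
Qed.

Lemma mxapply1 x : mxapply 1%:M x = x.
Proof.
apply: eq_from_tnth => i; rewrite tnth_mktuple (bigD1 i)//= mxE eqxx mul1r.
by rewrite big1 ?addr0// => k ki; rewrite mxE eq_sym (negbTE ki) mul0r.
Qed.

Lemma sqn_dotp x : sqn x = dotp x x.
Proof. by rewrite /sqn /dotp; apply: eq_bigr => j _; rewrite expr2. Qed.

Lemma measurable_mxapply (U : 'M[R]_d) : measurable_fun setT (mxapply U).
Proof.
apply: measurable_mktuple => j; apply: measurable_sum => k.
by apply: measurable_funM => //; exact: measurable_tnth.
Qed.

Definition e0 : d.-tuple R := [tuple (j == ord0)%:R | j < d].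

Lemma dotp_e0 c x : dotp (vscale c e0) x = c * tnth x ord0.
Proof.
rewrite /dotp (bigD1 ord0)//= !tnth_mktuple eqxx mulr1 big1 ?addr0// => j j0.
by rewrite !tnth_mktuple (negbTE j0) mulr0 mul0r.
Qed.

(** Householder reflection: U = 1 - (2 / |w|^2) w w^T with w = y - |y| e_0 exchanges y and |y| e_0.
    It is symmetric, so U^T y = |y| e_0. For w = 0 the identity serves. *)
Lemma rotation_to_axis y : exists2 U : 'M[R]_d, orthogonal_mx U &
  forall x, dotp y (mxapply U x) = Num.sqrt (sqn y) * tnth x ord0.
Proof.
pose r := Num.sqrt (sqn y).
have r2 : r ^+ 2 = sqn y by rewrite sqr_sqrtr ?sqn_ge0.
pose w : 'cV[R]_d := \col_j (tnth y j - r * (j == ord0)%:R).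
pose q : R := \sum_j w j ord0 ^+ 2.
have [q0|q0] := eqVneq q 0.
  have w0 j : tnth y j = r * (j == ord0)%:R.
    apply/eqP; rewrite -subr_eq0 -sqrf_eq0.
    have := q0; rewrite /q => /psumr_eq0P/(_ j isT); rewrite mxE => -> //.
    by move=> i _; exact: sqr_ge0.
  exists 1%:M; first by rewrite /orthogonal_mx trmx1 mulmx1.
  move=> x; rewrite mxapply1 -/r -dotp_e0; congr dotp.
  by apply: eq_from_tnth => j; rewrite !tnth_mktuple.
pose c := 2 / q.
pose P : 'M[R]_d := w *m w^T.
have wTw : w^T *m w = q%:M.
  apply/matrixP => i j; rewrite !ord1 !mxE eqxx mulr1n /q.
  by apply: eq_bigr => k _; rewrite !mxE expr2.
have PP : P *m P = q *: P.
  by rewrite /P mulmxA -(mulmxA w) wTw mul_mx_scalar -scalemxAl.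
pose U : 'M[R]_d := 1%:M - c *: P.
have UT : U^T = U.
  by rewrite /U linearB /= trmx1 linearZ /= /P trmx_mul trmxK.
have cq : c * c * q = 2 * c by rewrite /c; field.
exists U.
  rewrite /orthogonal_mx UT /U mulmxBl mul1mx mulmxBr mulmx1.
  rewrite -scalemxAl -scalemxAr PP !scalerA cq mulr_natl mulr2n scalerDl.
  by rewrite opprB addrK subrK.
move=> x; rewrite mxapply_dotp UT -/r -dotp_e0; congr dotp.
(* Because |y| = r, both <w, y> and |w|^2 / 2 equal r^2 - r y_0. *)
have wy : \sum_k w k ord0 * tnth y k = q / 2.
  have s1 : \sum_k w k ord0 * tnth y k = r ^+ 2 - r * tnth y ord0.
    under eq_bigr do rewrite mxE mulrBl -expr2.
    rewrite sumrB r2 -/(sqn y); congr (_ - _).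
    by rewrite (bigD1 ord0)//= mulr1 big1 ?addr0// => j j0; rewrite (negbTE j0) mulr0 mul0r.
  have s2 : q = 2 * (r ^+ 2 - r * tnth y ord0).
    rewrite /q; under eq_bigr do rewrite mxE sqrrB.
    rewrite big_split /= sumrB -/(sqn y) -r2.
    have -> : \sum_(j < d) tnth y j * (r * (j == ord0)%:R) *+ 2 = 2 * (r * tnth y ord0).
      by rewrite (bigD1 ord0)//= big1 ?addr0 => [|j j0]; [ring|rewrite (negbTE j0) !mulr0 mul0rn].
    have -> : \sum_(j < d) (r * (j == ord0)%:R) ^+ 2 = r ^+ 2.
      by rewrite (bigD1 ord0)//= big1 ?addr0 => [|j j0]; [ring|rewrite (negbTE j0) mulr0 expr0n].
    by ring.
  by rewrite s1 s2; field.
apply: eq_from_tnth => j; rewrite !tnth_mktuple.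
have -> : \sum_k U j k * tnth y k = tnth y j - c * (w j ord0 * \sum_k w k ord0 * tnth y k).
  have Ujk k : U j k = (j == k)%:R - c * (w j ord0 * w k ord0).
    by rewrite !mxE big_ord1 !mxE.
  under eq_bigr do rewrite Ujk mulrBl.
  rewrite sumrB (bigD1 j)//= eqxx mul1r big1 ?addr0 => [|k kj]; last first.
    by rewrite eq_sym (negbTE kj) mul0r.
  by congr (_ - _); rewrite !mulr_sumr; apply: eq_bigr => k _; ring.
rewrite wy mxE /c.
have -> : 2 / q * ((tnth y j - r * (j == ord0)%:R) * (q / 2)) = tnth y j - r * (j == ord0)%:R.
  by field.
by rewrite opprB addrC subrK.
Qed.

End Rotations.

(** * Even moments and Laplace transform of the uniform law on the sphere *)

(** Only even powers remain, so every term is nonnegative and the series can be integrated termwise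
    by monotone convergence. *)
Lemma cosh_series (R : realType) (t : R) :
  (((expR t + expR (- t)) / 2)%:E = \sum_(k <oo) (t ^+ (2 * k) / (2 * k)`!%:R)%:E)%E.
Proof.
have E N : \sum_(0 <= k < N) t ^+ (2 * k) / (2 * k)`!%:R =
    (series (exp_coeff t) (2 * N)%N + series (exp_coeff (- t)) (2 * N)%N) / 2.
  elim: N => [|N IH]; first by rewrite muln0 /series /= !big_geq// addr0 mul0r.
  rewrite big_nat_recr//= IH mulnS /series /= !big_nat_recr//= /exp_coeff /=.
  by rewrite !exprS !exprM sqrrN; field; rewrite !pnatr_eq0 -!lt0n !fact_gt0.
have c2 : (fun N : nat => (2 * N)%N) @ \oo --> \oo.
  by apply: cvg_mulnl.
have cs (s : R) : series (exp_coeff s) (2 * N)%N @[N --> \oo] --> expR s.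
  apply: (@cvg_comp _ _ _ (fun N => (2 * N)%N) (series (exp_coeff s)) _ _ _ c2).
  exact: is_cvg_series_exp_coeff.
apply/esym/cvg_lim => //.
rewrite (_ : (fun N => _) = EFin \o (fun N => (series (exp_coeff t) (2 * N)%N +
    series (exp_coeff (- t)) (2 * N)%N) / 2)); last first.
  by apply/funext => N /=; rewrite -E sumEFin.
apply: cvg_EFin; first exact: nearW.
apply: cvgM; last exact: cvg_cst.
by apply: cvgD; exact: cs.
Qed.

Section UniformSphere.
Context (R : realType) (n : nat).
Notation d := n.+2.
Variable nu : probability (d.-tuple R) R.
Hypothesis nu_sphere : nu [set x | sqn x = 1] = 1%E.
Hypothesis nu_rot : forall U : 'M[R]_d, orthogonal_mx U ->
  forall B, measurable B -> nu (mxapply U @^-1` B) = nu B.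
Notation S := [set x : d.-tuple R | sqn x = 1].

Lemma measurable_usphere : measurable S.
Proof.
rewrite (_ : S = @sqn R d @^-1` [set 1])//.
by rewrite -[X in measurable X]setTI; apply: measurable_sqn.
Qed.

Lemma integral_usphere (f : d.-tuple R -> \bar R) :
  measurable_fun setT f -> (forall x, 0 <= f x)%E ->
  (\int[nu]_x f x = \int[nu]_(x in S) f x)%E.
Proof.
move=> mf f0; have mS := measurable_usphere.
have mSc : measurable (~` S) by exact: measurableC.
rewrite -(setUv S) ge0_integral_setU//; last 2 first.
- by rewrite setUv.
- by apply/disj_setPS => x [].
rewrite [X in (_ + X)%E]null_set_integral ?adde0//.
  exact: measurable_funTS.
by rewrite [LHS]probability_setC// nu_sphere subee.
Qed.

Lemma integral_rotation (U : 'M[R]_d) (f : d.-tuple R -> \bar R) : orthogonal_mx U ->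
  measurable_fun setT f -> (forall x, 0 <= f x)%E ->
  (\int[nu]_x f (mxapply U x) = \int[nu]_x f x)%E.
Proof.
move=> hU mf f0; rewrite -(ge0_integral_law nu (measurable_mxapply U))//.
by apply: eq_measure_integral => A mA _; exact: nu_rot.
Qed.

(** Rotates y onto the first axis; this is the form in which rotation invariance is used from here
    on. *)
Lemma integral_radial (h : R -> \bar R) y : measurable_fun setT h -> (forall t, 0 <= h t)%E ->
  (\int[nu]_x h (dotp y x) = \int[nu]_x h (Num.sqrt (sqn y) * tnth x ord0)%R)%E.
Proof.
move=> mh h0; have [U hU UE] := rotation_to_axis y.
rewrite -(integral_rotation hU (f := fun x => h (dotp y x)))//.
  by apply: eq_integral => x _; rewrite UE.
by apply: measurableT_comp => //; exact: measurable_dotp.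
Qed.

Lemma tnth_usphere (x : d.-tuple R) j : S x -> `|tnth x j| <= 1.
Proof.
move=> /= x1; rewrite -(ler_pXn2r (n := 2))// ?nnegrE// expr1n real_normK ?num_real//.
by rewrite -x1 /sqn (bigD1 j)//= lerDl sumr_ge0// => i _; exact: sqr_ge0.
Qed.

Definition sphere_moment (i j : nat) (l : 'I_d) : R :=
  fine (\int[nu]_(x in S) (tnth x ord0 ^+ i * tnth x l ^+ j)%:E).

Lemma integrable_mono i j l :
  nu.-integrable S (fun x => (tnth x ord0 ^+ i * tnth x l ^+ j)%:E).
Proof.
have mS := measurable_usphere.
apply: measurable_bounded_integrable => //.
- by rewrite (le_lt_trans (probability_le1 _ _)) ?ltry.
- apply: measurable_funTS; apply: measurable_funM; apply: measurable_funX; exact: measurable_tnth.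
- exists 1; split => // M M1 x Sx /=; rewrite normrM !normrX.
  apply: le_trans (ltW M1).
  by apply: mulr_ile1; rewrite ?exprn_ge0// exprn_ile1 ?normr_ge0 ?(tnth_usphere _ Sx).
Qed.

Lemma sphere_momentE i j l : (sphere_moment i j l)%:E =
  (\int[nu]_(x in S) (tnth x ord0 ^+ i * tnth x l ^+ j)%:E)%E.
Proof.
rewrite fineK//; apply: integrable_fin_num; first exact: measurable_usphere.
exact: integrable_mono.
Qed.

(** Rotation invariance for y = e_0 + [e] e_l, of squared norm 1 + e^2: the moment of order 2k of
    x_0 + e x_l is (1 + e^2)^k times that of x_0, and the left side expands it in e. *)
Lemma sphere_moment_binomial (k : nat) (l : 'I_d) (e : R) : l != ord0 ->
  \sum_(i < (2 * k).+1) 'C(2 * k, i)%:R * sphere_moment (2 * k - i) i l * e ^+ i =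
  (1 + e ^+ 2) ^+ k * sphere_moment (2 * k) 0 ord0.
Proof.
move=> l0; have mS := measurable_usphere.
pose y : d.-tuple R := [tuple (if j == ord0 then 1 else if j == l then e else 0) | j < d].
have dy x : dotp y x = tnth x ord0 + e * tnth x l.
  rewrite /dotp (bigD1 ord0)//= (bigD1 l)//= !tnth_mktuple !eqxx (negbTE l0) mul1r big1 ?addr0//.
  by move=> j /andP[j0 jl]; rewrite tnth_mktuple (negbTE j0) (negbTE jl) mul0r.
have sy : sqn y = 1 + e ^+ 2.
  by rewrite sqn_dotp dy !tnth_mktuple !eqxx (negbTE l0) expr2.
have mh : measurable_fun setT (fun t : R => (t ^+ (2 * k))%:E).
  by apply/measurable_EFinP; exact: measurable_funX.
have h0 (t : R) : (0 <= (t ^+ (2 * k))%:E)%E by rewrite lee_fin exprM exprn_ge0// sqr_ge0.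
have := integral_radial y mh h0.
rewrite integral_usphere//; last exact: (measurableT_comp mh (measurable_dotp y)).
rewrite [in RHS]integral_usphere//; last first.
  apply: (measurableT_comp mh); apply: measurable_funM => //; exact: measurable_tnth.
have -> : (\int[nu]_(x in S) ((Num.sqrt (sqn y) * tnth x ord0) ^+ (2 * k))%:E)%E =
    ((1 + e ^+ 2) ^+ k * sphere_moment (2 * k) 0 ord0)%:E.
  rewrite EFinM sphere_momentE -integralZl//; last exact: integrable_mono.
  apply: eq_integral => x _; by rewrite -EFinM expr0 mulr1 exprMn exprM sqr_sqrtr ?sqn_ge0// sy.
have -> : (\int[nu]_(x in S) (dotp y x ^+ (2 * k))%:E)%E =
    (\sum_(i < (2 * k).+1) 'C(2 * k, i)%:R * sphere_moment (2 * k - i) i l * e ^+ i)%:E.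
  have [_ E] := integral_lincomb (fun i => 'C(2 * k, i)%:R * e ^+ i) (2 * k).+1 mS
    (fun i => integrable_mono (2 * k - i) i l) (fun i => esym (sphere_momentE (2 * k - i) i l)).
  transitivity (\sum_(i < (2 * k).+1)
      'C(2 * k, i)%:R * e ^+ i * sphere_moment (2 * k - i) i l)%:E; last first.
    by congr EFin; apply: eq_bigr => i _; rewrite mulrAC.
  rewrite -E; apply: eq_integral => x _; congr EFin; rewrite dy exprDn.
  by apply: eq_bigr => i _; rewrite exprMn -mulr_natl; ring.
by case.
Qed.

(** The identity above holds for all e, so the coefficients of e^2 agree; at order 2k + 2 they carry
    C(2k + 2, 2) = (k + 1) (2k + 1) on one side and k + 1 on the other. *)
Lemma sphere_moment_cross k (l : 'I_d) : l != ord0 ->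
  (2 * k).+1%:R * sphere_moment (2 * k) 2 l = sphere_moment (2 * k.+1) 0 ord0.
Proof.
move=> l0; pose K := k.+1.
pose p := \poly_(i < (2 * K).+1) ('C(2 * K, i)%:R * sphere_moment (2 * K - i) i l).
pose q := (sphere_moment (2 * K) 0 ord0) *: ('X^2 + 1) ^+ K : {poly R}.
have pq : p = q.
  apply/eqP; rewrite -subr_eq0; apply/eqP.
  (* The difference vanishes at as many naturals as its size, that is, at more points than its
     degree. *)
  apply: (@roots_geq_poly_eq0 _ _ [seq i%:R | i <- iota 0 (size (p - q)%R)]).
  - apply/allP => x _; rewrite /root hornerD hornerN subr_eq0 horner_poly.
    rewrite hornerZ horner_exp hornerD hornerXn hornerC addrC mulrC.
    by apply/eqP; rewrite -(sphere_moment_binomial K x l0).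
  - by rewrite map_inj_uniq ?iota_uniq//; exact: mulrIn (oner_neq0 R).
  - by rewrite size_map size_iota.
have c3 m : [/\ (('X^2 + 1 : {poly R}) ^+ m)`_0 = 1, (('X^2 + 1 : {poly R}) ^+ m)`_1 = 0 &
    (('X^2 + 1 : {poly R}) ^+ m)`_2 = m%:R].
  elim: m => [|m [h0 h1 h2]]; first by rewrite expr0 !coef1.
  rewrite exprSr mulrDr mulr1 !coefD !coefMXn /= h0 h1 h2 !add0r.
  by rewrite nat1r.
have [_ _ c2] := c3 K.
have := congr1 (fun r : {poly R} => r`_2) pq.
rewrite /p /q coef_poly coefZ c2.
have -> : (2 < (2 * K).+1)%N by rewrite /K mulnS.
rewrite (_ : (2 * K - 2 = 2 * k)%N); last by rewrite /K mulnS addKn.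
rewrite bin2 /K (_ : ((2 * k.+1) * (2 * k.+1).-1)./2 = (k.+1 * (2 * k).+1)%N); last first.
  by rewrite -mulnA mul2n doubleK (mulnS 2).
rewrite natrM -mulrA [RHS]mulrC => E.
by apply: (mulfI (x := k.+1%:R)); [rewrite pnatr_eq0|exact: E].
Qed.

(** On the sphere, insert 1 = sum of x_l^2: the term l = 0 gives the moment of order 2k + 2, each of
    the d - 1 others a cross moment, and (2k + 1) + (d - 1) = d + 2k. *)
Lemma sphere_moment_recursion k : (2 * k).+1%:R * sphere_moment (2 * k) 0 ord0 =
  (d%:R + 2 * k%:R) * sphere_moment (2 * k.+1) 0 ord0.
Proof.
have mS := measurable_usphere.
have s : sphere_moment (2 * k) 0 ord0 = \sum_l sphere_moment (2 * k) 2 l.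
  have [_ E] := integral_lincomb (fun=> 1) d mS (fun i => integrable_mono (2 * k) 2 (inord i))
    (fun i => esym (sphere_momentE (2 * k) 2 (inord i))).
  apply: EFin_inj; transitivity (\sum_(i < d) 1 * sphere_moment (2 * k) 2 (inord i))%:E; last first.
    by congr EFin; apply: eq_bigr => l _; rewrite mul1r inord_val.
  rewrite sphere_momentE -E; apply: eq_integral => x /[!inE] Sx; congr EFin.
  under eq_bigr do rewrite mul1r inord_val.
  by rewrite -mulr_sumr -/(sqn x) Sx expr0 mulr1.
rewrite s (bigD1 ord0)//= mulrDr mulr_sumr.
rewrite (eq_bigr (fun=> sphere_moment (2 * k.+1) 0 ord0)); last first.
  by move=> l l0; exact: sphere_moment_cross.
have -> : sphere_moment (2 * k) 2 ord0 = sphere_moment (2 * k.+1) 0 ord0.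
  rewrite /sphere_moment; congr fine; apply: eq_integral => x _.
  by rewrite -exprD expr0 mulr1 mulnS addnC.
rewrite sumr_const cardC1 card_ord /= -[X in _ + X]mulr_natl -mulrDl; congr (_ * _).
by rewrite -natrM -!natrD; congr (_%:R); rewrite addnC addnS !addSn addnC.
Qed.

Lemma sphere_moment_closed k :
  sphere_moment (2 * k) 0 ord0 / (2 * k)`!%:R = (2 ^+ k * k`!%:R * rising R n k)^-1.
Proof.
elim: k => [|k IH].
  rewrite muln0 fact0 divr1 expr0 /rising big_ord0 !mulr1 invr1.
  apply: EFin_inj; rewrite sphere_momentE.
  under eq_integral do rewrite !expr0 mulr1.
  rewrite integral_cst ?mul1e; last exact: measurable_usphere.
  exact: nu_sphere.
have r := sphere_moment_recursion k.
have f0 : (2 * k)`!%:R != 0 :> R by rewrite pnatr_eq0 -lt0n fact_gt0.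
have f1 : k`!%:R != 0 :> R by rewrite pnatr_eq0 -lt0n fact_gt0.
have k1 : 1 + k%:R != 0 :> R by rewrite nat1r pnatr_eq0.
have k2 : 1 + 2 * k%:R != 0 :> R by rewrite gt_eqF// ltr_wpDr// mulr_ge0.
have rn0 : rising R n k != 0 by rewrite gt_eqF// rising_gt0.
have dk : d%:R + 2 * k%:R != 0 :> R by rewrite gt_eqF// ltr_wpDr// mulr_ge0.
have E : sphere_moment (2 * k.+1) 0 ord0 =
    (2 * k).+1%:R * sphere_moment (2 * k) 0 ord0 / (d%:R + 2 * k%:R).
  by rewrite r; field.
have M : sphere_moment (2 * k) 0 ord0 = (2 * k)`!%:R * (2 ^+ k * k`!%:R * rising R n k)^-1.
  by rewrite -IH; field.
have t0 : 2 ^+ k != 0 :> R by rewrite expf_neq0.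
have k3 : (2 * k).+1%:R = 1 + 2 * k%:R :> R by rewrite -nat1r natrM.
have k4 : (2 * k).+2%:R = 2 * (1 + k%:R) :> R.
  by rewrite -[(2 * k).+2]addn2 natrD natrM; ring.
rewrite E M risingS (mulnS 2) !factS !(natrM _ _.+1) k3 k4 exprS -(nat1r k).
field.
have dk' : 2 + n%:R + 2 * k%:R != 0 :> R by rewrite -natrD add2n.
by rewrite t0 rn0 f0 f1 k1 k2 dk'.
Qed.

(** Symmetrise to the hyperbolic cosine, expand, and insert the even moments. Their closed form 1 /
    (2^k k! rising k) is what later makes Poisson weights and normalised chi-square tails appear. *)
Lemma integral_expR_dotp y :
  (\int[nu]_x (expR (dotp y x))%:E =
   \sum_(k <oo) ((sqn y / 2) ^+ k / (k`!%:R * rising R n k))%:E)%E.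
Proof.
pose r := Num.sqrt (sqn y).
have r2 : r ^+ 2 = sqn y by rewrite sqr_sqrtr ?sqn_ge0.
have r0 : 0 <= r by exact: sqrtr_ge0.
have mE : measurable_fun setT (fun t : R => (expR t)%:E).
  by apply/measurable_EFinP; exact: measurable_expR.
have E0 (t : R) : (0 <= (expR t)%:E)%E by rewrite lee_fin expR_ge0.
have mrx (c : R) : measurable_fun setT (fun x : d.-tuple R => c * tnth x ord0).
  by apply: measurable_funM => //; exact: measurable_tnth.
rewrite (integral_radial y mE E0) -/r.
(* The vector - r e_0 also has norm r, so the exponential may be averaged with its reflection. *)
have EN : (\int[nu]_x (expR (- r * tnth x ord0))%:E = \int[nu]_x (expR (r * tnth x ord0))%:E)%E.
  have := integral_radial (vscale (- r) (e0 R n)) mE E0.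
  rewrite sqn_vscale sqrrN sqn_dotp.
  rewrite -[X in dotp X _](_ : vscale 1 (e0 R n) = e0 R n); last first.
    by apply: eq_from_tnth => j; rewrite !tnth_mktuple mul1r.
  rewrite dotp_e0 tnth_mktuple eqxx !mulr1 sqrtr_sqr ger0_norm// => <-.
  by apply: eq_integral => x _; rewrite dotp_e0.
have -> : (\int[nu]_x (expR (r * tnth x ord0))%:E =
    \int[nu]_x ((expR (r * tnth x ord0) + expR (- (r * tnth x ord0))) / 2)%:E)%E.
  under [RHS]eq_integral do rewrite mulrC EFinM EFinD -mulNr.
  rewrite ge0_integralZl//; last 2 first.
  - by apply: emeasurable_funD; apply: (measurableT_comp mE); exact: mrx.
  - by move=> x _; rewrite adde_ge0.
  rewrite ge0_integralD//; last 2 first.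
  - by apply: (measurableT_comp mE); exact: mrx.
  - by apply: (measurableT_comp mE); exact: mrx.
  rewrite EN; case: (\int[nu]_x _)%E => [a| |] //=.
    by rewrite -EFinD -EFinM; congr EFin; field.
  by rewrite gt0_muley.
  by rewrite gt0_muleNy.
under eq_integral do rewrite cosh_series.
have P0 k (t : R) : 0 <= t ^+ (2 * k) / (2 * k)`!%:R.
  by rewrite divr_ge0// exprM exprn_ge0// sqr_ge0.
rewrite integral_nneseries//; last 2 first.
- move=> k; apply/measurable_EFinP; apply: measurable_funM => //.
  by apply: measurable_funX; exact: mrx.
- by move=> k x _; rewrite lee_fin.
apply: eq_eseriesr => k _.
rewrite integral_usphere//; last 2 first.
- apply/measurable_EFinP; apply: measurable_funM => //.
  by apply: measurable_funX; exact: mrx.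
- by move=> x; rewrite lee_fin.
transitivity ((r ^+ (2 * k) / (2 * k)`!%:R)%:E *
    \int[nu]_(x in S) (tnth x ord0 ^+ (2 * k) * tnth x ord0 ^+ 0)%:E)%E.
  rewrite -integralZl//; [|exact: measurable_usphere|exact: integrable_mono].
  by apply: eq_integral => x _; rewrite -EFinM exprMn expr0 mulr1 mulrAC.
rewrite -sphere_momentE -EFinM; congr EFin.
rewrite -mulrA (mulrC _^-1) sphere_moment_closed exprM r2 exprMn exprVn.
by rewrite !invfM !mulrA.
Qed.

End UniformSphere.

(** * Exchange of one spherical summand for a Gaussian one *)

Section ChiSquareGaussian.
Context (R : realType) (n : nat).
Notation d := n.+2.
Variable gam : probability (d.-tuple R) R.
Hypothesis hg : has_iid_coords (std_normal R) gam.

Lemma gaussian_tail_mean2 : 80^-1 <= tail_moment gam 0 (d%:R + 2).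
Proof.
apply: (@tail0_mean2 R n (tail_moment gam) (unit_vol gam)).
- exact: unit_vol_ge0.
- exact: tail_moment_ge0.
- by move=> k u w; exact: tail_moment_le.
- by move=> k z; exact: tail_momentS.
- by move=> k u w; exact: tail_momentB_ub.
- by move=> k u w; exact: tail_momentB_lb.
- by move=> k e; exact: tail_moment_near0.
- exact: tail_moment0_total.
- by move=> c N D; exact: tail_moment_poly.
Qed.

Lemma gaussian_poisson_mixture (z0 z1 : R) N : d%:R + 2 <= z0 -> z0 <= z1 ->
  \sum_(k < N) poisson k (d%:R / 2 * (z1 / z0 - 1)) * (tail_moment gam k z1 / rising R n k)
    <= tail_moment gam 0 z0.
Proof.
apply: (@poisson_mixture_le R n (tail_moment gam) (unit_vol gam)).
- exact: unit_vol_ge0.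
- exact: tail_moment_ge0.
- by move=> k u w; exact: tail_moment_le.
- by move=> k z; exact: tail_momentS.
- by move=> k u w; exact: tail_momentB_ub.
- by move=> k u w; exact: tail_momentB_lb.
Qed.

Variable nu : probability (d.-tuple R) R.
Hypothesis nu_sphere : nu [set x | sqn x = 1] = 1%E.
Hypothesis nu_rot : forall U : 'M[R]_d, orthogonal_mx U ->
  forall B, measurable B -> nu (mxapply U @^-1` B) = nu B.
Notation S := [set x : d.-tuple R | sqn x = 1].

Lemma dotpC (x y : d.-tuple R) : dotp x y = dotp y x.
Proof. by apply: eq_bigr => j _; rewrite mulrC. Qed.

Lemma dotp_vscalel c (x y : d.-tuple R) : dotp (vscale c x) y = c * dotp x y.
Proof. by rewrite /dotp mulr_sumr; apply: eq_bigr => j _; rewrite tnth_mktuple mulrA. Qed.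

Lemma measurable_dotp2 : measurable_fun setT (fun p : d.-tuple R * d.-tuple R => dotp p.1 p.2).
Proof.
apply: measurable_sum => j; apply: measurable_funM.
  exact: (measurableT_comp (measurable_tnth j) measurable_fst).
exact: (measurableT_comp (measurable_tnth j) measurable_snd).
Qed.

(** The hypothesis on z says b^2 / 2 = d/2 (z / z0 - 1), the path of [gaussian_poisson_mixture]. The
    shift by b x becomes a density; averaging it over x gives the sum of (m |g|^2)^k / (k! rising
    k), and e^(-m) completes the Poisson weights. Bounding every partial sum bounds the series. *)
Lemma noncentral_tail (b z z0 : R) :
  d%:R + 2 <= z0 -> z = z0 * (1 + b ^+ 2 / d%:R) ->
  (\int[nu]_x gam [set g | (z < sqn (vadd (vscale b x) g))%R] <= gam [set g | (z0 < sqn g)%R])%E.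
Proof.
move=> hz0 zE; pose m := b ^+ 2 / 2.
have d0 : 0 < d%:R :> R by rewrite ltr0n.
have z00 : 0 < z0 by apply: lt_le_trans hz0; rewrite addr_gt0.
have m0 : 0 <= m by rewrite divr_ge0// sqr_ge0.
have zz : z0 <= z by rewrite zE ler_peMr ?(ltW z00)// lerDl divr_ge0// sqr_ge0.
pose A := [set g : d.-tuple R | (z < sqn g)%R].
have mA : measurable A by exact: measurable_sqn_gt.
pose Phi (p : d.-tuple R * d.-tuple R) : \bar R :=
  (\1_A p.2 * (expR (- m) * expR (b * dotp p.1 p.2)))%:E.
have Phi0 p : (0 <= Phi p)%E by rewrite lee_fin !mulr_ge0 ?expR_ge0.
have mPhi : measurable_fun setT Phi.
  apply/measurable_EFinP; apply: measurable_funM.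
    have mi : measurable_fun setT (\1_A : d.-tuple R -> R) by exact: measurable_indic.
    exact: (measurableT_comp mi measurable_snd).
  apply: measurable_funM => //; apply: measurableT_comp => //.
  by apply: measurable_funM => //; exact: measurable_dotp2.
have mB : measurable [set p : d.-tuple R * d.-tuple R | (z < sqn (vadd (vscale b p.1) p.2))%R].
  have mf : measurable_fun setT (fun p : d.-tuple R * d.-tuple R => vadd (vscale b p.1) p.2).
    rewrite (_ : (fun p => _) = fun p : d.-tuple R * d.-tuple R => vadd (vscale b p.1) (vscale 1 p.2)).
      exact: measurable_comb2.
    apply/funext => p; congr vadd; apply: eq_from_tnth => j.
    by rewrite tnth_mktuple mul1r.
  by rewrite -[X in measurable X]setTI; exact: (mf measurableT _ mA).
have -> : (\int[nu]_x gam [set g | (z < sqn (vadd (vscale b x) g))%R] =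
    \int[nu]_x \int[gam]_g Phi (x, g))%E.
  (* On the sphere |b x|^2 = b^2, so the factor e^(-|b x|^2/2) of the shifted density is the
     constant e^(-m) used in [Phi]. *)
  rewrite (integral_usphere nu_sphere); last 2 first.
  - rewrite (_ : (fun x => _) = gam \o xsection
        [set p : d.-tuple R * d.-tuple R | (z < sqn (vadd (vscale b p.1) p.2))%R]).
      exact: (measurable_fun_xsection gam mB).
    apply/funext => x /=; congr (gam _); apply/seteqP; split=> g;
    by rewrite /xsection /= inE.
  - by move=> x; exact: measure_ge0.
  rewrite [RHS](integral_usphere nu_sphere); last 2 first.
  - exact: (measurable_fun_fubini_tonelli_F Phi mPhi Phi0).
  - by move=> x; apply: integral_ge0 => g _; exact: Phi0.
  apply: eq_integral => x /[!inE] Sx.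
  rewrite -[LHS]/(gam (vadd (vscale b x) @^-1` A)) (cameron_martin hg)//.
  rewrite integral_mkcond; apply: eq_integral => g _.
  rewrite patchE /Phi /= indicE sqn_vscale Sx mulr1 dotp_vscalel expRD -/m mulrC.
  by case: ifPn => _; rewrite ?mul1r ?mul0r.
rewrite (fubini_tonelli Phi)//.
have inner g : (\int[nu]_x Phi (x, g) = \sum_(k <oo) (\1_A g *
    (poisson k m / rising R n k * sqn g ^+ k))%:E)%E.
  rewrite /Phi /=; under eq_integral do rewrite mulrA EFinM.
  rewrite ge0_integralZl; last 4 first.
  - exact: measurableT.
  - apply/measurable_EFinP; apply: measurableT_comp => //; apply: measurable_funM => //.
    rewrite (_ : (fun x => _) = dotp g); first exact: measurable_dotp.
    by apply/funext => x; rewrite dotpC.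
  - by move=> x _; rewrite lee_fin expR_ge0.
  - by rewrite lee_fin mulr_ge0 ?expR_ge0.
  under eq_integral do rewrite dotpC -dotp_vscalel.
  rewrite (integral_expR_dotp nu_sphere nu_rot) -nneseriesZl; last first.
    by move=> k _; rewrite lee_fin divr_ge0 ?exprn_ge0 ?divr_ge0 ?sqn_ge0// mulr_ge0// ltW// rising_gt0.
  apply: eq_eseriesr => k _; rewrite -EFinM; congr EFin.
  rewrite sqn_vscale /poisson (_ : b ^+ 2 * sqn g / 2 = m * sqn g); last by rewrite mulrAC.
  have r0 : rising R n k != 0 by rewrite gt_eqF// rising_gt0.
  have f0 : k`!%:R != 0 :> R by rewrite pnatr_eq0 -lt0n fact_gt0.
  by rewrite exprMn; field; rewrite r0 f0.
under eq_integral do rewrite inner.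
have P0 k (g : d.-tuple R) : (0 <= (\1_A g * (poisson k m / rising R n k * sqn g ^+ k))%:E)%E.
  rewrite lee_fin mulr_ge0// mulr_ge0 ?exprn_ge0 ?sqn_ge0// divr_ge0 ?poisson_ge0//.
  by rewrite ltW// rising_gt0.
rewrite integral_nneseries//; last first.
  move=> k; apply/measurable_EFinP; apply: measurable_funM; first exact: measurable_indic.
  by apply: measurable_funM => //; apply: measurable_funX; exact: measurable_sqn.
have term k : (\int[gam]_g (\1_A g * (poisson k m / rising R n k * sqn g ^+ k))%:E =
    (poisson k m * (tail_moment gam k z / rising R n k))%:E)%E.
  have c0 : 0 <= poisson k m / rising R n k by rewrite divr_ge0 ?poisson_ge0// ltW// rising_gt0.
  transitivity ((poisson k m / rising R n k)%:E * (tail_moment gam k z)%:E)%E; last first.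
    by rewrite -EFinM; congr EFin; rewrite mulrAC mulrA.
  rewrite (tail_momentE hg) -ge0_integralZl//; last 2 first.
  - exact: measurable_sqnX.
  - by move=> g _; exact: sqnX_ge0.
  rewrite [RHS]integral_mkcond; apply: eq_integral => g _.
  by rewrite patchE indicE; case: ifPn => _; rewrite ?mul1r ?mul0r ?EFinM.
rewrite (eq_eseriesr (fun k _ => term k)) -(tail_moment0 hg).
apply: lime_le.
  apply: is_cvg_nneseries => k _ _; rewrite lee_fin mulr_ge0 ?poisson_ge0//.
  by rewrite divr_ge0 ?tail_moment_ge0// ltW// rising_gt0.
apply: nearW => N; rewrite sumEFin lee_fin big_mkord.
have -> : m = d%:R / 2 * (z / z0 - 1).
  by rewrite zE /m; field; rewrite !gt_eqF.
exact: gaussian_poisson_mixture.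
Qed.

Lemma slice_swap (rho : probability (d.-tuple R) R) (D : set (d.-tuple R * d.-tuple R)) :
  measurable D ->
  (\int[nu]_x rho [set s | D (x, s)] = \int[rho]_s nu [set x | D (x, s)])%E.
Proof.
move=> mD.
have mi : measurable_fun setT (fun p => (\1_D p)%:E : \bar R).
  by apply/measurable_EFinP; exact: measurable_indic.
have m1 x : measurable [set s | D (x, s)].
  have -> : [set s | D (x, s)] = xsection D x.
    by apply/seteqP; split=> s; rewrite /xsection /= inE.
  exact: measurable_xsection.
have m2 s : measurable [set x | D (x, s)].
  have -> : [set x | D (x, s)] = ysection D s.
    by apply/seteqP; split=> x; rewrite /ysection /= inE.
  exact: measurable_ysection.
transitivity (\int[nu]_x \int[rho]_s (\1_D (x, s))%:E)%E.
  apply: eq_integral => x _.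
  rewrite -[LHS](_ : (\int[rho]_s (\1_[set s | D (x, s)] s)%:E)%E = _); last first.
    by rewrite integral_indic// setIT.
  by apply: eq_integral => s _; rewrite !indicE.
rewrite (fubini_tonelli (fun p => (\1_D p)%:E)); [|exact: mi|by move=> p; rewrite lee_fin].
apply: eq_integral => s _.
rewrite -[RHS](_ : (\int[nu]_x (\1_[set x | D (x, s)] x)%:E)%E = _); last first.
  by rewrite integral_indic// setIT.
by apply: eq_integral => x _; rewrite !indicE.
Qed.

Lemma measurable_lt_fun d' (T : measurableType d') (f : T -> R) (t : R) :
  measurable_fun setT f -> measurable [set x | t < f x].
Proof.
move=> mf; rewrite (_ : [set x | t < f x] = setT `&` f @^-1` `]t, +oo[%classic).
  exact: mf.
by apply/seteqP; split=> x /=; rewrite in_itv /= andbT //; case.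
Qed.

Lemma measurable_sum_set (a t : R) :
  measurable [set p : d.-tuple R * d.-tuple R | t < sqn (vadd (vscale a p.1) p.2)].
Proof.
apply: measurable_lt_fun; apply: (measurableT_comp (@measurable_sqn R d)).
apply: measurable_mktuple => j; apply: measurable_funD.
  apply: (measurableT_comp (measurable_tnth j)).
  exact: (measurableT_comp (measurable_vscale a) measurable_fst).
exact: (measurableT_comp (measurable_tnth j) measurable_snd).
Qed.

Lemma measurable_axis_set (a t : R) :
  measurable [set p : d.-tuple R * d.-tuple R | t <
    a ^+ 2 + 2 * (`|a| * Num.sqrt (sqn p.2) * tnth p.1 ord0) + sqn p.2].
Proof.
have ms := measurableT_comp (@measurable_sqn R d) (@measurable_snd _ _ (d.-tuple R) (d.-tuple R)).
apply: measurable_lt_fun; apply: measurable_funD => //; apply: measurable_funD => //.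
apply: measurable_funM => //; apply: measurable_funM.
  apply: measurable_funM => //; apply: measurableT_comp ms.
  by apply: continuous_measurable_fun; exact: sqrt_continuous.
exact: (measurableT_comp (measurable_tnth ord0) measurable_fst).
Qed.

(* Conditionally on s, the law of |a x + s| depends on s only through |s|. *)
Lemma rotate_summand (rho : probability (d.-tuple R) R) (a t : R) :
  (\int[nu]_x rho [set s | (t < sqn (vadd (vscale a x) s))%R] =
   \int[nu]_x rho [set s | (t < a ^+ 2 + 2 * (`|a| * Num.sqrt (sqn s) * tnth x ord0) + sqn s)%R])%E.
Proof.
rewrite (slice_swap rho (measurable_sum_set a t)) (slice_swap rho (measurable_axis_set a t)) /=.
apply: eq_integral => s _.
pose h (u : R) : \bar R := (\1_[set v | t < a ^+ 2 + 2 * v + sqn s] u)%:E.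
have mset : measurable [set v : R | t < a ^+ 2 + 2 * v + sqn s].
  by apply: measurable_lt_fun; apply: measurable_funD => //; apply: measurable_funD => //; exact: measurable_funM.
have mh : measurable_fun setT h by apply/measurable_EFinP; exact: measurable_indic.
have h0 u : (0 <= h u)%E by rewrite lee_fin.
have m1 : measurable [set x : d.-tuple R | t < sqn (vadd (vscale a x) s)].
  have -> : [set x : d.-tuple R | t < sqn (vadd (vscale a x) s)] =
      ysection [set p : d.-tuple R * d.-tuple R | t < sqn (vadd (vscale a p.1) p.2)] s.
    by apply/seteqP; split=> x; rewrite /ysection /= inE.
  by apply: measurable_ysection; exact: measurable_sum_set.
have m2 : measurable [set x : d.-tuple R | t < a ^+ 2 + 2 * (`|a| * Num.sqrt (sqn s) * tnth x ord0) + sqn s].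
  have mc : measurable_fun setT (fun x : d.-tuple R => `|a| * Num.sqrt (sqn s) * tnth x ord0).
    by apply: measurable_funM => //; exact: measurable_tnth.
  rewrite -[X in measurable X]setTI; exact: (mc measurableT _ mset).
have := integral_radial nu_rot (vscale a s) mh h0.
rewrite sqn_vscale sqrtrM ?sqr_ge0// sqrtr_sqr.
rewrite [LHS](integral_usphere nu_sphere)//; last exact: (measurableT_comp mh (measurable_dotp _)).
have -> : (\int[nu]_x h (`|a| * Num.sqrt (sqn s) * tnth x ord0)%R =
   nu [set x | (t < a ^+ 2 + 2 * (`|a| * Num.sqrt (sqn s) * tnth x ord0) + sqn s)%R])%E.
  by rewrite -[X in _ = nu X]setIT -integral_indic.
move=> <-.
rewrite -[X in nu X]setIT -integral_indic// (integral_usphere nu_sphere).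
- apply: eq_integral => x /[!inE] Sx; rewrite /h !indicE; congr ((nat_of_bool _)%:R%:E).
  have E : sqn (vadd (vscale a x) s) = a ^+ 2 + 2 * dotp (vscale a s) x + sqn s.
    by rewrite sqn_vadd sqn_vscale Sx mulr1 !dotp_vscalel (dotpC x).
  by apply/idP/idP; rewrite !inE /= E.
- by apply/measurable_EFinP; exact: measurable_indic.
- by move=> x; rewrite lee_fin.
Qed.

(** As a quadratic in r, the difference of the two sides of the inequality is negative at r = 0, so
    it changes sign once on r >= 0, at sqrt D - q. For a fixed first coordinate [u] of x the event
    is thus a tail event of the norm of the other summand, to which a tail bound applies. *)
Lemma axis_set_ball (a t u : R) : a ^+ 2 < t ->
  exists2 b : R, 0 < b & forall r, 0 <= r ->
    (t < a ^+ 2 + 2 * (`|a| * r * u) + r ^+ 2) = (b < r ^+ 2).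
Proof.
move=> at_; pose q := `|a| * u.
pose D := q ^+ 2 + (t - a ^+ 2).
have D0 : 0 < D by rewrite /D ltr_wpDl ?sqr_ge0// subr_gt0.
have sD : Num.sqrt D ^+ 2 = D by rewrite sqr_sqrtr// ltW.
have s0 : 0 < Num.sqrt D by rewrite sqrtr_gt0.
have qs : `|q| < Num.sqrt D.
  by rewrite -(ltr_pXn2r (n := 2))// ?nnegrE// ?(ltW s0)// sD real_normK ?num_real// /D ltrDl subr_gt0.
have [q1 q2] : q < Num.sqrt D /\ - q < Num.sqrt D.
  by move: qs; rewrite ltr_norml => /andP[h1 h2]; split => //; rewrite ltrNl.
exists ((Num.sqrt D - q) ^+ 2); first by rewrite exprn_gt0// subr_gt0.
move=> r r0.
rewrite [RHS]ltr_pXn2r ?nnegrE ?subr_ge0 ?(ltW q1)// ltrBlDr.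
have -> : (t < a ^+ 2 + 2 * (`|a| * r * u) + r ^+ 2) = (D < (r + q) ^+ 2).
  by rewrite -subr_gt0 -[RHS]subr_gt0; congr (0 < _); rewrite /D /q; ring.
apply/idP/idP => h; last first.
  by rewrite -sD ltr_pXn2r ?nnegrE ?(ltW s0) ?(ltW (lt_trans s0 h)).
rewrite ltNge; apply/negP => h1.
have : `|r + q| <= Num.sqrt D.
  by rewrite ler_norml h1 andbT lerNl opprD; apply: le_trans (ltW q2); rewrite gerDr oppr_le0.
rewrite -(ler_pXn2r (n := 2))// ?nnegrE ?(ltW s0)// sD real_normK ?num_real//.
by rewrite leNgt h.
Qed.

(** The hypothesis compares [rho] with the law of c g, c = sqrt (s / d), with constant K. It is
    applied at each fixed x after [rotate_summand], which is then undone; the remaining comparison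
    of a x + c g with a Gaussian vector has constant 1, so K is not multiplied. *)
Lemma sphere_summand_step (K : R) (rho : probability (d.-tuple R) R) (s a t : R) :
  0 <= K -> 1 <= K * tail_moment gam 0 (d%:R + 2) -> 0 <= s -> 0 < t -> a != 0 ->
  (forall t', 0 < t' -> (rho [set y | (t' < sqn y)%R] <=
     K%:E * gam [set g | (d%:R * t' < s * sqn g)%R])%E) ->
  (\int[nu]_x rho [set y | (t < sqn (vadd (vscale a x) y))%R] <=
   K%:E * gam [set g | (d%:R * t < (s + a ^+ 2) * sqn g)%R])%E.
Proof.
move=> K0 K1 s0 t0 a0 IH.
have d0 : 0 < d%:R :> R by rewrite ltr0n.
have a2 : 0 < a ^+ 2 by rewrite exprn_even_gt0.
have sa : 0 < s + a ^+ 2 by rewrite ltr_wpDl.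
have gE : [set g : d.-tuple R | d%:R * t < (s + a ^+ 2) * sqn g] =
    [set g | d%:R * t / (s + a ^+ 2) < sqn g].
  by apply/seteqP; split=> g /=; rewrite ltr_pdivrMr// (mulrC (sqn g)).
have mslice (rh : probability (d.-tuple R) R) (D : set (d.-tuple R * d.-tuple R)) : measurable D ->
    measurable_fun setT (fun x => rh [set y | D (x, y)]).
  move=> mD; rewrite (_ : (fun x => _) = rh \o xsection D).
    exact: (measurable_fun_xsection rh mD).
  by apply/funext => x /=; congr (rh _); apply/seteqP; split=> y; rewrite /xsection /= inE.
(* At a low level K times the Gaussian tail is already at least 1, by [K1]. *)
have [small|large] := leP (d%:R * t / (s + a ^+ 2)) (d%:R + 2).
  apply: (@le_trans _ _ 1%E).
    apply: (@le_trans _ _ (\int[nu]_x 1)%E); last by rewrite integral_cst// mul1e probability_le1.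
    apply: ge0_le_integral => //.
    - by have := mslice rho _ (measurable_sum_set a t).
    - move=> x _; apply: probability_le1.
      have -> : [set y : d.-tuple R | t < sqn (vadd (vscale a x) y)] =
          xsection [set p : d.-tuple R * d.-tuple R | t < sqn (vadd (vscale a p.1) p.2)] x.
        by apply/seteqP; split=> y; rewrite /xsection /= inE.
      by apply: measurable_xsection; exact: measurable_sum_set.
  rewrite gE -(tail_moment0 hg) -EFinM lee_fin.
  apply: (le_trans K1); rewrite ler_wpM2l//.
  exact: (tail_moment_le hg 0 small).
(* From d t > (d + 2) (s + a^2) >= d a^2. This is what makes the event at fixed x the exterior of a
   ball centred at 0. *)
have at_ : a ^+ 2 < t.
  move: large; rewrite ltr_pdivlMr// => h.
  rewrite -(ltr_pM2l d0); apply: le_lt_trans h; apply: ler_pM; rewrite ?(ltW a2)// ?lerDl//.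
  by rewrite lerDr.
pose c := Num.sqrt (s / d%:R).
have c2 : c ^+ 2 = s / d%:R by rewrite sqr_sqrtr// divr_ge0// ltW.
pose rho2 := law gam (@measurable_vscale R d c).
rewrite rotate_summand.
apply: (@le_trans _ _ (\int[nu]_x (K%:E * rho2 [set y | (t < a ^+ 2 +
    2 * (`|a| * Num.sqrt (sqn y) * tnth x ord0) + sqn y)%R]))%E).
  rewrite (integral_usphere nu_sphere) ?[leRHS](integral_usphere nu_sphere).
  - apply: ge0_le_integral.
    + exact: measurable_usphere.
    + by move=> x _; exact: measure_ge0.
    + apply: measurable_funTS; by have := mslice rho _ (measurable_axis_set a t).
    + apply: measurable_funTS; apply: emeasurable_funM => //.
      by have := mslice rho2 _ (measurable_axis_set a t).
    + move=> x Sx; have [b b0 bE] := axis_set_ball (tnth x ord0) at_.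
      have sE : [set y : d.-tuple R | t < a ^+ 2 + 2 * (`|a| * Num.sqrt (sqn y) * tnth x ord0) + sqn y] =
          [set y | b < sqn y].
        apply/seteqP; split=> y /=; rewrite -[X in _ + X](sqr_sqrtr (sqn_ge0 y)) bE ?sqrtr_ge0//;
        by rewrite sqr_sqrtr ?sqn_ge0.
      rewrite sE; apply: le_trans (IH b b0) _; rewrite lee_wpmul2l ?lee_fin//.
      rewrite [leRHS]lawE (_ : _ @^-1` _ = [set g | d%:R * b < s * sqn g])//.
      apply/seteqP; split=> g /=; rewrite sqn_vscale c2 mulrAC ltr_pdivlMr//;
      by rewrite (mulrC b).
  - apply: emeasurable_funM => //; by have := mslice rho2 _ (measurable_axis_set a t).
  - by move=> x; rewrite mule_ge0 ?lee_fin.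
  - by have := mslice rho _ (measurable_axis_set a t).
  - by move=> x; exact: measure_ge0.
rewrite ge0_integralZl//; last first.
  by have := mslice rho2 _ (measurable_axis_set a t).
rewrite lee_wpmul2l ?lee_fin// -rotate_summand gE.
(* For s = 0 also c = 0, and |a x|^2 = a^2 < t on the sphere, so the left side vanishes. *)
have [s00|sn0] := eqVneq s 0.
  rewrite (integral_usphere nu_sphere).
  - rewrite (eq_integral (cst 0%E)) ?integral0 ?measure_ge0// => x /[!inE] Sx.
    rewrite [LHS]lawE (_ : _ @^-1` _ = set0) ?measure0//.
    apply/seteqP; split=> // g /=; rewrite sqn_vadd !sqn_vscale Sx mulr1 c2 s00 !mul0r addr0.
    have c0 : c = 0 by rewrite /c s00 mul0r sqrtr0.
    by rewrite dotpC dotp_vscalel c0 mul0r mulr0 addr0 => /(lt_trans at_); rewrite ltxx.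
  - by have := mslice rho2 _ (measurable_sum_set a t).
  - by move=> x; exact: measure_ge0.
have sp : 0 < s by rewrite lt_neqAle eq_sym sn0.
have cp : 0 < c by rewrite sqrtr_gt0 divr_gt0.
(* After division by c the shift has size b = a / c, with b^2 / d = a^2 / s; thus z0 = d t / (s +
   a^2) corresponds to z = d t / s. *)
have zE : d%:R * t / s = d%:R * t / (s + a ^+ 2) * (1 + (a / c) ^+ 2 / d%:R).
  by rewrite exprMn exprVn c2; field; rewrite !gt_eqF.
apply: le_trans (noncentral_tail (ltW large) zE).
apply: ge0_le_integral => //.
- by have := mslice rho2 _ (measurable_sum_set a t).
- by have := mslice gam _ (measurable_sum_set (a / c) (d%:R * t / s)).
- move=> x _; rewrite lawE le_eqVlt; apply/orP; left; apply/eqP; congr (gam _).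
  have sE g : sqn (vadd (vscale a x) (vscale c g)) = s / d%:R * sqn (vadd (vscale (a / c) x) g).
    rewrite -c2 -sqn_vscale; congr sqn; apply: eq_from_tnth => j; rewrite !tnth_mktuple.
    by field; rewrite gt_eqF.
  have lE (Y : R) : (t < s / d%:R * Y) = (d%:R * t / s < Y).
    by rewrite ltr_pdivrMr// mulrAC ltr_pdivlMr// (mulrC t) (mulrC Y).
  by apply/seteqP; split=> g /=; rewrite sE lE.
Qed.

End ChiSquareGaussian.

(** * Independence of partial sums from later terms *)

Lemma rectangle_measure_unique d1 d2 (T1 : measurableType d1) (T2 : measurableType d2)
    (R : realType) (m1 m2 : {measure set (T1 * T2) -> \bar R}) :
  (forall A B, measurable A -> measurable B -> m1 (A `*` B) = m2 (A `*` B)) ->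
  (m1 setT < +oo)%E -> forall D, measurable D -> m1 D = m2 D.
Proof.
move=> m12 m1oo D mD.
pose G : set (set (T1 * T2)) := [set A `*` B | A in measurable & B in measurable].
apply: (measure_unique G (fun=> setT)) => //.
- by rewrite measurable_prod_measurableType.
- move=> _ _ [A mA [B mB <-]] [A' mA' [B' mB' <-]]; rewrite -setXI.
  by exists (A `&` A'); [exact: measurableI|exists (B `&` B') => //; exact: measurableI].
- by move=> _; exists setT => //; exists setT => //; rewrite setXTT.
- by rewrite bigcup_const//; exists 0%N.
- by move=> _ [A mA [B mB <-]]; exact: m12.
Qed.

Section Independence.
Local Open Scope ereal_scope.
Context (R : realType) (dO : measure_display) (Omega : measurableType dO).
Variables (P : probability Omega R) (d : nat).

Lemma joint_law (Y Z : Omega -> d.-tuple R)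
    (mY : measurable_fun setT Y) (mZ : measurable_fun setT Z) :
  (forall A B, measurable A -> measurable B ->
    P (Y @^-1` A `&` Z @^-1` B) = P (Y @^-1` A) * P (Z @^-1` B)) ->
  forall D, measurable D ->
  P [set w | D (Y w, Z w)] = (law P mY \x law P mZ) D.
Proof.
move=> ind D mD.
have mYZ : measurable_fun setT (fun w => (Y w, Z w)) by exact: measurable_fun_pair.
rewrite (@product_measure_unique _ _ _ _ _ (law P mY) (law P mZ) (law P mYZ) _ D mD)//.
Qed.

Variable X : nat -> Omega -> d.-tuple R.
Hypothesis indX : mutually_independent P X.
Variable a : nat -> R.

Definition vsum k (w : Omega) : d.-tuple R :=
  [tuple (\sum_(i < k) a i * tnth (X i w) j)%R | j < d].

Let mX i : measurable_fun setT (X i). Proof. by have [] := indX. Qed.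

Lemma measurable_vsum k : measurable_fun setT (vsum k).
Proof.
apply: measurable_mktuple => j; apply: measurable_sum => i.
by apply: measurable_funM => //; exact: (measurableT_comp (measurable_tnth j) (mX i)).
Qed.

Lemma vsumS k w : vsum k.+1 w = vadd (vscale (a k) (X k w)) (vsum k w).
Proof.
apply: eq_from_tnth => j; rewrite !tnth_mktuple big_ord_recr /= addrC.
by [].
Qed.

Let mpre i B : measurable B -> measurable (X i @^-1` B).
Proof. by move=> mB; rewrite -[X in measurable X]setTI; exact: mX. Qed.

(** Quantifying over all finite families of indices at least k makes the induction pass: the step
    moves [X k] from the family into the sum. The law of the pair (X k, vsum k) restricted to the
    event [E] and the same law scaled by P(E) agree on rectangles, hence everywhere. *)
Lemma vsum_indep k (s : seq nat) (B : nat -> set (d.-tuple R)) A :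
  uniq s -> all (leq k) s -> (forall i, measurable (B i)) -> measurable A ->
  P (vsum k @^-1` A `&` \big[setI/setT]_(i <- s) (X i @^-1` B i)) =
  P (vsum k @^-1` A) * P (\big[setI/setT]_(i <- s) (X i @^-1` B i)).
Proof.
elim: k => [|k IH] in s B A *.
  move=> us _ mB mA.
  have v0 w : vsum 0 w = [tuple 0%R | j < d].
    by apply: eq_from_tnth => j; rewrite !tnth_mktuple big_ord0.
  have [A0|A0] := pselect (A [tuple 0%R | j < d]).
    have -> : vsum 0 @^-1` A = setT by apply/seteqP; split=> // w _ /=; rewrite v0.
    by rewrite setTI probability_setT mul1e.
  have -> : vsum 0 @^-1` A = set0 by apply/seteqP; split=> // w /=; rewrite v0.
  by rewrite set0I measure0 mul0e.
move=> us ks mB mA.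
set E := \big[setI/setT]_(i <- s) (X i @^-1` B i).
have mE : measurable E.
  by apply: bigsetI_measurable => i _; exact: mpre.
have ks' : all (leq k) s by apply: sub_all ks => i; exact: ltnW.
have kns : k \notin s.
  by apply/negP => /(allP ks); rewrite ltnn.
have EX C : measurable C -> P (X k @^-1` C `&` E) = P (X k @^-1` C) * P E.
  (* Since k is not in [s], prescribing the set [C] at index k leaves [E] unaltered. *)
  move=> mC; pose B' i := if i == k then C else B i.
  have mB' i : measurable (B' i) by rewrite /B'; case: ifP.
  have BE : \big[setI/setT]_(i <- s) (X i @^-1` B' i) = E.
    rewrite /E big_seq [RHS]big_seq; apply: eq_bigr => i is_; rewrite /B'.
    by case: eqP => // ik; move: kns; rewrite -ik is_.
  have [_ ind] := indX.
  have := ind (k :: s) B'; rewrite /= kns us => /(_ isT mB').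
  rewrite !big_cons BE {1 2}/B' eqxx => ->; congr (_ * _).
  by rewrite -BE (ind s B').
have EXS C A' : measurable C -> measurable A' ->
    P (vsum k @^-1` A' `&` (X k @^-1` C `&` E)) = P (vsum k @^-1` A') * (P (X k @^-1` C) * P E).
  move=> mC mA'; pose B' i := if i == k then C else B i.
  have mB' i : measurable (B' i) by rewrite /B'; case: ifP.
  have BE : \big[setI/setT]_(i <- s) (X i @^-1` B' i) = E.
    rewrite /E big_seq [RHS]big_seq; apply: eq_bigr => i is_; rewrite /B'.
    by case: eqP => // ik; move: kns; rewrite -ik is_.
  have := IH (k :: s) B' A'; rewrite /= kns us leqnn ks' => /(_ isT isT mB' mA').
  by rewrite big_cons BE {1 2}/B' eqxx => ->; rewrite EX.
have EXS0 C A' : measurable C -> measurable A' ->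
    P (vsum k @^-1` A' `&` X k @^-1` C) = P (vsum k @^-1` A') * P (X k @^-1` C).
  move=> mC mA'; have := IH [:: k] (fun=> C) A' isT _ (fun=> mC) mA'.
  by rewrite /= leqnn big_seq1 => /(_ isT).
pose T w := (X k w, vsum k w).
have mT : measurable_fun setT T by apply: measurable_fun_pair => //; exact: measurable_vsum.
have pE : (0 <= fine (P E))%R by exact: fine_ge0.
have PEf : P E \is a fin_num by exact: fin_num_measure.
pose m1 := image_measure (mrestr P mE) mT.
pose m2 := mscale (NngNum pE) (image_measure P mT).
have m12 D : measurable D -> m1 D = m2 D.
  apply: rectangle_measure_unique => [C A' mC mA'|].
    transitivity (P (T @^-1` (C `*` A') `&` E)) => //.
    transitivity ((fine (P E))%:E * P (T @^-1` (C `*` A'))) => //.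
    have -> : T @^-1` (C `*` A') = vsum k @^-1` A' `&` X k @^-1` C.
      by apply/seteqP; split=> w [].
    by rewrite -setIA EXS// EXS0// fineK// muleA muleC.
  apply: (@le_lt_trans _ _ (P setT)); last by rewrite probability_setT ltry.
  transitivity (P (T @^-1` setT `&` E) <= P setT) => //.
  by apply: le_measure => //; rewrite inE// preimage_setT setTI.
pose f (p : d.-tuple R * d.-tuple R) := vadd (vscale (a k) p.1) p.2.
have mf : measurable_fun setT f.
  apply: measurable_mktuple => j; apply: measurable_funD.
    apply: (measurableT_comp (measurable_tnth j)).
    exact: (measurableT_comp (measurable_vscale (a k)) measurable_fst).
  exact: (measurableT_comp (measurable_tnth j) measurable_snd).
have fE : vsum k.+1 @^-1` A = T @^-1` (f @^-1` A).
  by apply/seteqP; split=> w /=; rewrite vsumS.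
have mfA : measurable (f @^-1` A) by rewrite -[X in measurable X]setTI; exact: mf.
have := m12 _ mfA.
rewrite [LHS](_ : _ = P (T @^-1` (f @^-1` A) `&` E))//.
rewrite [RHS](_ : _ = (fine (P E))%:E * P (T @^-1` (f @^-1` A)))//.
by rewrite -fE fineK// muleC.
Qed.

Lemma vsum_indep1 k A C : measurable A -> measurable C ->
  P (vsum k @^-1` A `&` X k @^-1` C) = P (vsum k @^-1` A) * P (X k @^-1` C).
Proof.
move=> mA mC; have := @vsum_indep k [:: k] (fun=> C) A isT.
by rewrite /= leqnn big_seq1 => /(_ isT (fun=> mC) mA).
Qed.

End Independence.

(** * Induction on the number of summands *)

Section MainInduction.
Local Open Scope ereal_scope.
Context (R : realType) (n : nat) (dO : measure_display) (Omega : measurableType dO).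
Notation d := n.+2.
Variable P : probability Omega R.
Variable a : nat -> R.

Definition sqsum k : R := (\sum_(i < k) a i ^+ 2)%R.

Lemma sqsum_ge0 k : (0 <= sqsum k)%R.
Proof. by apply: sumr_ge0 => i _; exact: sqr_ge0. Qed.

(** Every [G i] has law [gam], so by [gaussian_convolution] each new summand adds its squared
    coefficient to the variance. *)
Lemma vsum_gaussian (G : nat -> Omega -> d.-tuple R) (gam : probability (d.-tuple R) R) :
  has_iid_coords (std_normal R) gam -> mutually_independent P G ->
  (forall i, std_gaussian_vector P (G i)) ->
  forall k A, measurable A ->
  P (vsum G a k @^-1` A) = gam [set x | A (vscale (Num.sqrt (sqsum k)) x)].
Proof.
move=> hg indG stdG; have mG i : measurable_fun setT (G i) by have [] := indG.
have GE i A : measurable A -> law P (mG i) A = gam A.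
  apply: tuple_measure_unique => [B mB|k].
    transitivity (\prod_(j < d) (std_normal R) (B j)); last exact/esym/hg.
    by have [_ h] := stdG i; exact: h.
  rewrite (le_lt_trans (probability_le1 _ _)) ?ltry//.
  by apply: measurable_box => j; exact: measurable_itv.
elim=> [|k IH] A mA.
  have z x : vscale (Num.sqrt (sqsum 0)) x = [tuple 0%R | j < d].
    by apply: eq_from_tnth => j; rewrite !tnth_mktuple /sqsum big_ord0 sqrtr0 mul0r.
  have v0 w : vsum G a 0 w = [tuple 0%R | j < d].
    by apply: eq_from_tnth => j; rewrite !tnth_mktuple big_ord0.
  have [A0|A0] := pselect (A [tuple 0%R | j < d]).
    have -> : vsum G a 0 @^-1` A = setT by apply/seteqP; split=> // w _ /=; rewrite v0.
    have -> : [set x | A (vscale (Num.sqrt (sqsum 0)) x)] = setT.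
      by apply/seteqP; split=> // x _ /=; rewrite z.
    by rewrite !probability_setT.
  have -> : vsum G a 0 @^-1` A = set0 by apply/seteqP; split=> // w /=; rewrite v0.
  have -> : [set x | A (vscale (Num.sqrt (sqsum 0)) x)] = set0.
    by apply/seteqP; split=> // x /=; rewrite z.
  by rewrite !measure0.
have mV := measurable_vsum indG a k.
pose s := Num.sqrt (sqsum k).
pose f (p : d.-tuple R * d.-tuple R) := vadd (vscale 1 p.1) (vscale (a k) p.2).
have mf : measurable_fun setT f by exact: measurable_comb2.
have mD : measurable (f @^-1` A) by rewrite -[X in measurable X]setTI; exact: mf.
have -> : vsum G a k.+1 @^-1` A = [set w | (f @^-1` A) (vsum G a k w, G k w)].
  apply/seteqP; split=> w /=; rewrite /f /= vsumS;
    rewrite (_ : vadd (vscale 1 _) _ = vadd (vscale (a k) (G k w)) (vsum G a k w))//;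
    by apply: eq_from_tnth => j; rewrite !tnth_mktuple mul1r addrC.
rewrite (joint_law mV (mG k) (fun A B mA mB => vsum_indep1 indG a k mA mB) mD).
transitivity (\int[law P mV]_x (law P (mG k)) (xsection (f @^-1` A) x)) => //.
transitivity (\int[law gam (@measurable_vscale R d s)]_x gam (xsection (f @^-1` A) x)).
  rewrite (eq_measure_integral (law gam (@measurable_vscale R d s))); last first.
    by move=> B mB _; exact: IH.
  by apply: eq_integral => x _; apply: GE; exact: measurable_xsection.
rewrite ge0_integral_law//; last exact: (measurable_fun_xsection gam mD).
have s0 : (0 <= s)%R by exact: sqrtr_ge0.
have ss : (s ^+ 2 + a k ^+ 2 = sqsum k.+1)%R.
  by rewrite sqr_sqrtr ?sqsum_ge0// /sqsum big_ord_recr.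
rewrite -ss -(gaussian_convolution hg (a k) s0 mA).
transitivity (\int[gam]_x gam (xsection [set p | A (vadd (vscale s p.1) (vscale (a k) p.2))] x)) => //.
apply: eq_integral => x _; congr (gam _); apply/seteqP; split=> y;
rewrite /xsection /= !inE /f /= (_ : vscale 1 (vscale s x) = vscale s x)//;
by apply: eq_from_tnth => j; rewrite !tnth_mktuple mul1r.
Qed.

(** The Gaussian side is stated through [sqsum] alone, with squared norms and the factor d kept in
    the level: this is the shape that [sphere_summand_step] reproduces. *)
Lemma vsum_sphere_tail (xi : nat -> Omega -> d.-tuple R) (gam : probability (d.-tuple R) R) :
  has_iid_coords (std_normal R) gam -> mutually_independent P xi ->
  (forall i, uniform_on_sphere P (xi i)) ->
  forall k (t : R), (0 < t)%R ->
  P [set w | (t < sqn (vsum xi a k w))%R] <=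
  397%:E * gam [set g | (d%:R * t < sqsum k * sqn g)%R].
Proof.
move=> hg indX unifX; have mX i : measurable_fun setT (xi i) by have [] := indX.
(* The Gaussian tail at d + 2 is at least 1/80, and 80 <= 397. *)
have K1 : (1 <= 397 * tail_moment gam 0 (d%:R + 2))%R.
  have := gaussian_tail_mean2 hg; rewrite -div1r ler_pdivrMr// => h; apply: (le_trans h).
  by rewrite mulrC ler_wpM2r ?tail_moment_ge0// ler_nat.
elim=> [|k IH] t t0.
  have -> : [set w | (t < sqn (vsum xi a 0 w))%R] = set0.
    apply/seteqP; split=> // w /=; rewrite /sqn big1 => [|j _].
      by move=> h; have := lt_trans t0 h; rewrite ltxx.
    by rewrite tnth_mktuple big_ord0 expr0n.
  by rewrite measure0; apply: mule_ge0; rewrite ?measure_ge0// lee_fin ler0n.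
(* [sphere_summand_step] asks for a nonzero coefficient; a zero one changes neither side. *)
have [a0|a0] := eqVneq (a k) 0%R.
  have -> : sqsum k.+1 = sqsum k by rewrite /sqsum big_ord_recr /= a0 expr0n addr0.
  have -> : [set w | (t < sqn (vsum xi a k.+1 w))%R] = [set w | (t < sqn (vsum xi a k w))%R].
    apply/seteqP; split=> w /=; rewrite vsumS a0;
      rewrite (_ : vadd _ _ = vsum xi a k w)//;
      by apply: eq_from_tnth => j; rewrite !tnth_mktuple mul0r add0r.
  exact: IH.
have mV := measurable_vsum indX a k.
have mD := @measurable_sum_set R n (a k) t.
have -> : [set w | (t < sqn (vsum xi a k.+1 w))%R] =
   [set w | [set p : d.-tuple R * d.-tuple R | (t < sqn (vadd (vscale (a k) p.1) p.2))%R] (xi k w, vsum xi a k w)].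
  by apply/seteqP; split=> w /=; rewrite vsumS.
have ind A B : measurable A -> measurable B -> P (xi k @^-1` A `&` vsum xi a k @^-1` B) =
    P (xi k @^-1` A) * P (vsum xi a k @^-1` B).
  by move=> mA mB; rewrite setIC (vsum_indep1 indX)// muleC.
rewrite (joint_law (mX k) mV ind mD).
have -> : sqsum k.+1 = (sqsum k + a k ^+ 2)%R by rewrite /sqsum big_ord_recr.
have [_ Sph Rot] := unifX k.
have nus : law P (mX k) [set x | sqn x = 1%R] = 1.
  rewrite lawE -[RHS]Sph; congr (P _); apply/seteqP; split=> w /=.
    by rewrite /unit_sphere /= /enorm -/(sqn _) => ->; rewrite sqrtr1.
  rewrite /unit_sphere /= /enorm -/(sqn _) => h.
  by rewrite -[LHS](sqr_sqrtr (sqn_ge0 _)) h expr1n.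
have nur (U : 'M[R]_d) : orthogonal_mx U -> forall B, measurable B ->
    law P (mX k) (mxapply U @^-1` B) = law P (mX k) B.
  by move=> hU B mB; exact: Rot.
have := @sphere_summand_step R n gam hg (law P (mX k)) nus nur 397 (law P mV) (sqsum k) (a k) t
  (ler0n R 397) K1 (sqsum_ge0 k) t0 a0 (fun t' h => IH t' h).
apply: le_trans; rewrite le_eqVlt; apply/orP; left; apply/eqP.
transitivity (\int[law P (mX k)]_x (law P mV) (xsection
  [set p : d.-tuple R * d.-tuple R | (t < sqn (vadd (vscale (a k) p.1) p.2))%R] x)) => //.
apply: eq_integral => x _; congr (P (_ @^-1` _)); apply/seteqP; split=> y;
by rewrite /xsection /= inE.
Qed.

End MainInduction.

Theorem theorem1 (R : realType) (d : nat) (dO : measure_display)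
  (Omega : measurableType dO) (P : probability Omega R)
  (xi G : nat -> Omega -> d.-tuple R) :
  (2 <= d)%N ->
  mutually_independent P xi -> (forall i, uniform_on_sphere P (xi i)) ->
  mutually_independent P G -> (forall i, std_gaussian_vector P (G i)) ->
  forall (m : nat) (a : 'I_m -> R) (t : R), (1 <= m)%N -> 0 < t ->
  (P [set w | (t < enorm (lincomb a (fun i => xi i w)))%R]
   <= 397%:E *
      P [set w | (t < enorm (lincomb a
                   (fun i => vscale (Num.sqrt d%:R)^-1 (G i w))))%R])%E.
Proof.
case: d xi G => [|[|n]] // xi G _ indX unifX indG stdG m a t _ t0.
(* The induction uses coefficients indexed by all naturals: [a] is extended by 0 from m on. *)
pose b i := oapp a 0 (insub i).
have bE (i : 'I_m) : b i = a i by rewrite /b valK.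
pose q := Num.sqrt n.+2%:R : R.
have d0 : 0 < n.+2%:R :> R by rewrite ltr0n.
have q0 : 0 < q by rewrite sqrtr_gt0.
have q2 : q ^+ 2 = n.+2%:R by rewrite sqr_sqrtr// ltW.
have lincombE (X : nat -> Omega -> n.+2.-tuple R) w : lincomb a (fun i => X i w) = vsum X b m w.
  apply: eq_from_tnth => j; rewrite !tnth_mktuple.
  by apply: eq_bigr => i _; rewrite bE.
have enorm_gt (x : n.+2.-tuple R) : (t < enorm x) = (t ^+ 2 < sqn x).
  rewrite /enorm -/(sqn x) -(ltr_pXn2r (n := 2)) ?nnegrE ?sqrtr_ge0 ?(ltW t0)//.
  by rewrite sqr_sqrtr ?sqn_ge0.
have t2 : 0 < t ^+ 2 by rewrite exprn_gt0.
have mG0 : measurable_fun setT (G 0%N) by have [] := indG.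
(* The law of [G 0] serves as the reference Gaussian measure. *)
pose gam := law P mG0.
have hg : has_iid_coords (std_normal R) gam.
  by move=> B mB; have [_ h] := stdG 0%N; exact: h.
under eq_set do rewrite lincombE enorm_gt.
(* The factor 1 / sqrt d is moved into the level, which becomes d t^2 for the squared norm. *)
have -> : [set w | t < enorm (lincomb a (fun i => vscale q^-1 (G i w)))] =
    vsum G b m @^-1` [set x | n.+2%:R * t ^+ 2 < sqn x].
  apply/seteqP; split=> w /=; rewrite enorm_gt;
    rewrite (_ : lincomb _ _ = vscale q^-1 (vsum G b m w)) ?sqn_vscale ?exprVn ?q2;
    rewrite ?(mulrC _^-1) ?ltr_pdivlMr// ?(mulrC (t ^+ 2))//;
    by apply: eq_from_tnth => j; rewrite !tnth_mktuple mulr_sumr;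
    apply: eq_bigr => i _; rewrite tnth_mktuple bE mulrCA.
rewrite (vsum_gaussian b hg indG stdG); last exact: measurable_sqn_gt.
apply: le_trans (vsum_sphere_tail b hg indX unifX m t2) _.
rewrite (_ : [set x | [set x | n.+2%:R * t ^+ 2 < sqn x] (vscale (Num.sqrt (sqsum b m)) x)] =
  [set g | n.+2%:R * t ^+ 2 < sqsum b m * sqn g])//.
by apply/seteqP; split=> g /=; rewrite sqn_vscale sqr_sqrtr ?sqsum_ge0.
Qed.
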